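(* If $\le_T^{U}\neq\le_T^{p}$ (as sets of pairs $(A,B)$ with $A\le B$), then $\mathrm{P}\neq\mathrm{NP}$.
   Context: $\le_T^p$ is polynomial-time Turing reducibility. An NPTM is a nondeterministic oracle Turing machine $N$ each of whose computation paths ends in one of three outcomes $\mathbf{acc}$, $\mathbf{rej}$, $\mathbf{?}$, such that there is a polynomial $p$ with: for every oracle $D$ and every input $x$, every computation path of $N^D(x)$ has length at most $p(|x|)$. For an oracle $D$ and input $x$, let $out_{N^D}(x)$ be the set of outcomes occurring on some path of $N^D(x)$; $L(N^D)=\{x:\mathbf{acc}\in out_{N^D}(x)\}$. $N^D(x)$ is underproductive if $\{\mathbf{acc},\mathbf{rej}\}\not\subseteq out_{N^D}(x)$, and overproductive if $out_{N^D}(x)\neq\{\mathbf{?}\}$; $N^D$ is underproductive (overproductive) if $N^D(x)$ is so for every $x$. $N$ is robustly underproductive if $N^D$ is underproductive for every oracle $D$. $A\le_T^{U}B$ if there is an NPTM $N$ that is robustly underproductive, with $N^B$ overproductive, and $A=L(N^B)$. *)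

(* Defs.v *)
From HB Require Import structures.
From mathcomp Require Import all_boot all_algebra.
From mathcomp Require Import all_classical.

Set Implicit Arguments.
Unset Strict Implicit.
Unset Printing Implicit Defensive.

Local Open Scope classical_set_scope.

Definition word := seq bool.
Definition language := set word.

(** A machine with auxiliary alphabet [G] has tape alphabet [option (bool + G)]:
    [None] is the blank, [Some (inl b)] is the bit [b]. *)
Definition symbol (G : finType) : finType := option (bool + G)%type.
Definition bit (G : finType) (b : bool) : symbol G := Some (inl b).

Inductive dir := MoveLeft | Stay | MoveRight.

Definition dir_code (d : dir) : option bool :=
  match d with MoveLeft => Some false | Stay => None | MoveRight => Some true end.
Definition dir_decode (c : option bool) : dir :=
  match c with Some false => MoveLeft | None => Stay | Some true => MoveRight end.
Lemma dir_codeK : cancel dir_code dir_decode. Proof. by case. Qed.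
HB.instance Definition _ := Countable.copy dir (can_type dir_codeK).
HB.instance Definition _ : isFinite dir := CanIsFinite dir_codeK.

(** A two-way infinite tape: [right_part] starts at the scanned cell, [left_part]
    lists the cells to the left of the head, nearest first; cells beyond either
    list are blank. *)
Record tape (G : finType) := Tape {
  left_part : seq (symbol G);
  right_part : seq (symbol G) }.

Definition empty_tape (G : finType) : tape G := Tape [::] [::].

Definition tape_of_word (G : finType) (w : word) : tape G :=
  Tape [::] (map (@bit G) w).

Definition read (G : finType) (t : tape G) : symbol G := head None (right_part t).

Definition write (G : finType) (s : symbol G) (t : tape G) : tape G :=
  Tape (left_part t) (s :: behead (right_part t)).

Definition move (G : finType) (d : dir) (t : tape G) : tape G :=
  match d with
  | MoveLeft =>
      Tape (behead (left_part t)) (head None (left_part t) :: right_part t)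
  | Stay => t
  | MoveRight =>
      Tape (read t :: left_part t) (behead (right_part t))
  end.

Fixpoint bit_prefix (G : finType) (s : seq (symbol G)) : word :=
  if s is Some (inl b) :: s' then b :: bit_prefix s' else [::].

(** The word queried when [t] is the oracle tape: the maximal block of bits
    starting at the scanned cell. *)
Definition query_word (G : finType) (t : tape G) : word :=
  bit_prefix (right_part t).

(** What a machine with states [Q], auxiliary alphabet [G], tapes indexed by [T]
    and outcomes in [O] does in a given state: stop with an outcome, consult the
    oracle and branch on a positive or negative answer (in one step), or perform
    one of finitely many ordinary moves depending on the scanned symbols. *)
Inductive instr (O : Type) (Q G T : finType) :=
| Halt of O
| Query of Q & Q
| Step of ({ffun T -> symbol G} -> {set Q * {ffun T -> symbol G * dir}}).

Definition instr_total (O : Type) (Q G T : finType) (i : instr O Q G T) : Prop :=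
  if i is Step d then forall s, (0 < #|d s|)%N else True.

(** [code_total]: only [Halt] states end a computation path, so every maximal
    finite path has an outcome. *)
Record otm (O : Type) := OTM {
  state : finType;
  aux : finType;
  tape_index : finType;
  input_tape : tape_index;
  oracle_tape : tape_index;
  start : state;
  code : state -> instr O state aux tape_index;
  input_neq_oracle : input_tape != oracle_tape;
  code_total : forall q, instr_total (code q) }.

Section Semantics.
Variables (O : Type) (M : otm O).

Record config := Config {
  cstate : state M;
  ctapes : {ffun tape_index M -> tape (aux M)} }.

Definition init (x : word) : config :=
  Config (start M)
    [ffun i => if i == input_tape M then tape_of_word (aux M) x
               else empty_tape (aux M)].

Definition scanned (c : config) : {ffun tape_index M -> symbol (aux M)} :=
  [ffun i => read (ctapes c i)].

Definition act (c : config)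
    (a : state M * {ffun tape_index M -> symbol (aux M) * dir}) : config :=
  Config a.1 [ffun i => move (a.2 i).2 (write (a.2 i).1 (ctapes c i))].

Definition step (D : language) (c c' : config) : Prop :=
  match code (cstate c) with
  | Halt _ => False
  | Query qyes qno =>
      let w := query_word (ctapes c (oracle_tape M)) in
      (D w /\ c' = Config qyes (ctapes c)) \/
      (~ D w /\ c' = Config qno (ctapes c))
  | Step d => exists2 a, a \in d (scanned c) & c' = act c a
  end.

Fixpoint run (D : language) (n : nat) (c c' : config) : Prop :=
  if n is n'.+1 then exists2 c1, step D c c1 & run D n' c1 c' else c = c'.

Definition outcomes (D : language) (x : word) : set O :=
  [set o | exists n c, run D n (init x) c /\ code (cstate c) = Halt _ _ _ o].

(** Bounding all initial segments of computation paths also rules out infinite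
    paths. *)
Definition poly_time : Prop :=
  exists p : {poly nat}, forall (D : language) (x : word) (n : nat) (c : config),
    run D n (init x) c -> (n <= p.[size x]%R)%N.

Definition deterministic : Prop :=
  forall q : state M, if code q is Step d then forall s, #|d s| = 1%N else True.

Definition oracle_free : Prop :=
  forall q : state M, if code q is Query _ _ then False else True.

End Semantics.

(** Here the outcome [true] means acceptance. *)
Definition accepted (M : otm bool) (D : language) : language :=
  [set x | outcomes M D x true].

(** For oracle-free machines the oracle is irrelevant. *)
Definition class_P : set language :=
  [set A | exists M : otm bool,
     [/\ deterministic M, oracle_free M, poly_time M & A = accepted M set0]].

Definition class_NP : set language :=
  [set A | exists M : otm bool,
     [/\ oracle_free M, poly_time M & A = accepted M set0]].

Definition le_T_p : set (language * language) :=
  [set AB | exists M : otm bool,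
     [/\ deterministic M, poly_time M & AB.1 = accepted M AB.2]].

Inductive outcome := acc | rej | unknown.

Definition lang (N : otm outcome) (D : language) : language :=
  [set x | outcomes N D x acc].

Definition underproductive (N : otm outcome) (D : language) : Prop :=
  forall x, ~ ([set acc; rej] `<=` outcomes N D x).

Definition overproductive (N : otm outcome) (D : language) : Prop :=
  forall x, outcomes N D x <> [set unknown].

Definition robustly_underproductive (N : otm outcome) : Prop :=
  forall D, underproductive N D.

Definition le_T_U : set (language * language) :=
  [set AB | exists N : otm outcome,
     [/\ poly_time N, robustly_underproductive N, overproductive N AB.2
       & AB.1 = lang N AB.2]].

(* Main.v *)
Require Import Defs.
From mathcomp Require Import all_boot all_algebra.
From mathcomp Require Import all_classical.
From mathcomp Require Import zify.

(* Suppose P = NP, let [N] be robustly underproductive and let [N] with oracle [B] be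
   overproductive. An accepting path of [N] on [x] under some oracle and a rejecting
   path under [B] must disagree on a query, since otherwise some oracle would yield
   both outcomes. To decide [x] with oracle [B], keep a list of answers known to agree
   with [B]. In each round, find by prefix search an extension of the list under which
   [N] has an accepting path asking listed queries only; this search is in NP. If there
   is none, reject: not even [B] makes [N] accept. Otherwise ask [B] for all the listed
   words and correct the answers. If [N] with oracle [B] has a rejecting path, each
   round makes a new query of that path known, so that polynomially many successful
   rounds exclude rejection, and overproductivity yields acceptance.

   Lists of answers have first-match semantics, so a guessed answer never overrides a
   known one. *)

Set Implicit Arguments.
Unset Strict Implicit.
Unset Printing Implicit Defensive.

(** P = NP supplies an unknown deterministic machine for one language, the inputs accepted by a
    verifier attached to [N]. Both that verifier and the final reduction must therefore be exhibited
    as multi-tape machines with explicit running times, the reduction calling the unknown machine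
    many times. Machines are assembled from structured fragments whose specifications contain a step
    budget. Every polynomial is majorized by a power $(n+2)^d$, which a machine can count with [d]
    nested loops over tapes of [n + 2] marks. And since the unknown machine may leave symbols
    scattered among blanks, its steps are recorded on a tape of marks that tells how far to erase
    before the next call.

    The verifier has no oracle, so the list of answers is part of its input, and the input [x] of
    [N] is stored as the first word of that list. One number [U], a power of [size x + 2], serves as
    the number of columns added per round and as the number of rounds: it leaves room for all
    queries of an accepting path and exceeds the length of any path. *)

(** * Canonical representation of tapes *)

Section CanonicalTapes.
Variable G : finType.
Implicit Types (a : symbol G) (s : seq (symbol G)) (t : tape G).

(* [bcons], [norm], [nmove] and [nwrite] keep both halves of a tape free of
   trailing blanks, so that tapes with the same contents are equal. *)
Definition bcons a s : seq (symbol G) :=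
  match a, s with None, [::] => [::] | _, _ => a :: s end.

Definition norm s := foldr bcons [::] s.

Definition nmove d t : tape G :=
  match d with
  | MoveLeft => Tape (behead (left_part t))
                     (bcons (head None (left_part t)) (right_part t))
  | Stay => t
  | MoveRight => Tape (bcons (read t) (left_part t)) (behead (right_part t))
  end.

(* The test makes rewriting the scanned symbol the identity on every tape. *)
Definition nwrite a t : tape G :=
  if a == read t then t else Tape (left_part t) (bcons a (behead (right_part t))).

Definition ntape t := Tape (norm (left_part t)) (norm (right_part t)).

Lemma behead_bcons a s : behead (bcons a s) = s.
Proof. by case: a; case: s. Qed.

Lemma head_bcons a s : head None (bcons a s) = a.
Proof. by case: a; case: s. Qed.

Lemma head_norm s : head None (norm s) = head None s.
Proof. by case: s => //= a s; rewrite head_bcons. Qed.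

Lemma behead_norm s : behead (norm s) = norm (behead s).
Proof. by case: s => //= a s; rewrite behead_bcons. Qed.

Lemma ntape_read t : read (ntape t) = read t.
Proof. exact: head_norm. Qed.

Lemma ntape_move d t : ntape (move d t) = nmove d (ntape t).
Proof.
by case: d; rewrite //= /ntape /= ?behead_norm ?head_norm // /read /= head_norm.
Qed.

Lemma ntape_write a t : ntape (write a t) = nwrite a (ntape t).
Proof.
rewrite /nwrite ntape_read /ntape /= behead_norm; case: eqP => // ->.
by case: t => l [].
Qed.

Lemma bit_prefix_norm s : bit_prefix (norm s) = bit_prefix s.
Proof.
elim: s => //= -[[b|g]|] s IH; last by case: (norm s).
- by rewrite /= IH.
- by [].
Qed.

Lemma ntape_query t : query_word (ntape t) = query_word t.
Proof. exact: bit_prefix_norm. Qed.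

Lemma nwrite_read t : nwrite (read t) t = t.
Proof. by rewrite /nwrite eqxx. Qed.

Lemma nwrite_bit b l r :
  nwrite (bit G b) (Tape l r) = Tape l (bit G b :: behead r).
Proof.
rewrite /nwrite /read /=; case: r => [|a r] //=.
by case: eqP => // <-.
Qed.

Lemma nwrite_blank a l r : a != None ->
  nwrite None (Tape l (a :: r)) = Tape l (bcons None r).
Proof. by rewrite /nwrite /read /= eq_sym => /negPf ->. Qed.

Lemma size_bcons a s : size (bcons a s) <= (size s).+1.
Proof. by case: a; case: s. Qed.

Lemma norm_bits (w : word) : norm (map (@bit G) w) = map (@bit G) w.
Proof. by elim: w => //= b w ->. Qed.

End CanonicalTapes.
Arguments bcons : simpl never.

(** * Machine parts and their total correctness *)

Section Win.
Variables (C : Type) (stp : C -> C -> Prop) (Q : C -> Prop).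

(* [m = true]: every computation path reaches [Q] within [n] steps;
   [m = false]: some path does. *)
Fixpoint win (m : bool) (n : nat) (c : C) : Prop :=
  Q c \/
  if n is n'.+1 then
    (exists2 c', stp c c' & win m n' c') /\
    (m -> forall c', stp c c' -> win m n' c')
  else False.

Lemma win_ret m n c : Q c -> win m n c.
Proof. by case: n; left. Qed.

Lemma win_le m n n' c : n <= n' -> win m n c -> win m n' c.
Proof.
elim: n n' c => [|n IH] [|n'] c //=.
- by move=> _ []//; left.
- move=> le_nn' [|[[c' s w] H]]; first by left.
  right; split; first by exists c' => //; exact: IH w.
  by move=> hm c'' /(H hm); exact: IH.
Qed.

Lemma win_step m n c :
  (exists2 c', stp c c' & win m n c') ->
  (m -> forall c', stp c c' -> win m n c') -> win m n.+1 c.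
Proof. by move=> *; right. Qed.

End Win.
Arguments win : simpl never.

Lemma win_imp C stp (Q Q' : C -> Prop) m n c :
  (forall c, Q c -> Q' c) -> win stp Q m n c -> win stp Q' m n c.
Proof.
move=> QQ'; elim: n c => [|n IH] c; first by case=> // /QQ'; left.
case=> [/QQ'|[[c' s w] H]]; first by left.
right; split; first by exists c' => //; exact: IH.
by move=> hm c'' /(H hm); exact: IH.
Qed.

Section Fragments.
Variables (O : Type) (G T : finType) (ot : T).

Definition instr_map (Q Q' : finType) (g : Q -> Q') (i : instr O Q G T) :
    instr O Q' G T :=
  match i with
  | Halt o => Halt _ _ _ o
  | Query y n => Query _ _ _ (g y) (g n)
  | Step d => Step _ (fun s => [set (g a.1, a.2) | a in d s])
  end.

Definition instr_det (Q : finType) (i : instr O Q G T) : Prop :=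
  if i is Step d then forall s, #|d s| = 1 else True.

Definition instr_free (Q : finType) (i : instr O Q G T) : Prop :=
  if i is Query _ _ then False else True.

Lemma instr_map_total (Q Q' : finType) (g : Q -> Q') (i : instr O Q G T) :
  instr_total i -> instr_total (instr_map g i).
Proof.
case: i => //= d H s; have /card_gt0P [a ha] := H s.
by apply/card_gt0P; exists (g a.1, a.2); apply/imsetP; exists a.
Qed.

Lemma instr_map_det (Q Q' : finType) (g : Q -> Q') (i : instr O Q G T) :
  instr_det i -> instr_det (instr_map g i).
Proof.
case: i => //= d H s; have /eqP/cards1P [a ->] := H s.
by rewrite imset_set1 cards1.
Qed.

Lemma instr_map_free (Q Q' : finType) (g : Q -> Q') (i : instr O Q G T) :
  instr_free i -> instr_free (instr_map g i).
Proof. by case: i. Qed.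

(* A machine part entered at [fstart]; a transition to [None] leaves it. *)
Record frag := Frag {
  fstate : finType;
  fstart : fstate;
  fcode : fstate -> instr O (option fstate) G T;
  ftotal : forall q, instr_total (fcode q) }.

Definition ffree (f : frag) := forall q : fstate f, instr_free (fcode q).

Definition fdet (f : frag) := forall q : fstate f, instr_det (fcode q).

(** Plain functions rather than finite functions, so that updates are compared by function
    extensionality and the value at a concrete tape computes. *)
Definition tapes := T -> tape G.
Definition rd (ts : tapes) : T -> symbol G := fun i => read (ts i).
Definition app (a : T -> symbol G * dir) (ts : tapes) : tapes :=
  fun i => nmove (a i).2 (nwrite (a i).1 (ts i)).

Definition upd (ts : tapes) (i : T) (t : tape G) : tapes :=
  fun j => if j == i then t else ts j.

Definition istep (Q : finType) (D : language) (i : instr O Q G T)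
    (ts : tapes) (c' : Q * tapes) : Prop :=
  match i with
  | Halt _ => False
  | Query y n => let w := query_word (ts ot) in
      (D w /\ c' = (y, ts)) \/ (~ D w /\ c' = (n, ts))
  | Step d => exists2 a, a \in d [ffun i => rd ts i] & c' = (a.1, app a.2 ts)
  end.

Lemma istep_map (Q Q' : finType) (g : Q -> Q') D i ts c' :
  istep D (instr_map g i) ts c' <->
  exists2 c, istep D i ts c & c' = (g c.1, c.2).
Proof.
case: i => [o|y n|d] /=; first by split=> // -[].
- split=> [[[h ->]|[h ->]]|[c [[h ->]|[h ->]] ->]].
  + by exists (y, ts) => //; left.
  + by exists (n, ts) => //; right.
  + by left.
  + by right.
- split=> [[a' /imsetP [a ha ->] ->]|[c [a ha ->] ->]].
  + by exists (a.1, app a.2 ts) => //; exists a.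
  + by exists (g a.1, a.2) => //; apply/imsetP; exists a.
Qed.

Variables (D : language) (QH : O -> Prop).

Definition fstep (f : frag) (c c' : option (fstate f) * tapes) : Prop :=
  if c.1 is Some q then istep D (fcode q) c.2 c' else False.

Definition ffin (f : frag) (Q : tapes -> Prop) (c : option (fstate f) * tapes) :=
  if c.1 is Some q then if fcode q is Halt o then QH o else False
  else Q c.2.

Definition fwin (f : frag) m n c Q := win (@fstep f) (@ffin f Q) m n c.

(* [f], started on [ts], stops within [n] steps, either by leaving [f] with tapes
   satisfying [Q] or by halting with an outcome satisfying [QH]. *)
Definition ex (m : bool) (f : frag) (ts : tapes) (n : nat) (Q : tapes -> Prop) :=
  fwin m n (Some (fstart f), ts) Q.

Lemma ex_le m f ts n n' Q : n <= n' -> ex m f ts n Q -> ex m f ts n' Q.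
Proof. by move=> le_n; apply: win_le. Qed.

Lemma fwin_imp f m n c (Q Q' : tapes -> Prop) :
  (forall ts, Q ts -> Q' ts) -> fwin (f := f) m n c Q -> fwin m n c Q'.
Proof. by move=> H; apply: win_imp => -[[q|] ts] //=; apply: H. Qed.

Lemma ex_imp m f ts n (Q Q' : tapes -> Prop) :
  (forall ts, Q ts -> Q' ts) -> ex m f ts n Q -> ex m f ts n Q'.
Proof. exact: fwin_imp. Qed.

Definition retarget (f F : frag) (e : fstate f -> fstate F)
    (x : option (fstate F)) (q : option (fstate f)) : option (fstate F) :=
  if q is Some s then Some (e s) else x.

(* [F] contains a copy of [f] whose exit is redirected to [x]. *)
Lemma fwin_lift (f F : frag) (e : fstate f -> fstate F) (x : option (fstate F)) :
  (forall s, fcode (e s) = instr_map (retarget e x) (fcode s)) ->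
  forall m n1 n2 Q s ts,
  fwin (f := f) m n1 (s, ts) (fun ts' => fwin (f := F) m n2 (x, ts') Q) ->
  fwin (f := F) m (n1 + n2) (retarget e x s, ts) Q.
Proof.
move=> He m n1 n2 Q; elim: n1 => [|n1 IH] s ts H.
  case: s H => [s|] [] // H.
  move: H; rewrite {1}/ffin /=; case E: (fcode s) => [o||] // H; apply: win_ret; rewrite /ffin /=.
  by rewrite He E.
case: H => [|[[c' s1 w] H]].
  rewrite {1}/ffin /=; case: s => [s|] /= H; last first.
    exact: (@win_le _ _ _ m n2 (n1.+1 + n2) _ (leq_addl _ _) H).
  move: H; case E: (fcode s) => [o||] // H; apply: win_ret; rewrite /ffin /=.
  by rewrite He E.
case: s s1 H => [s|] // s1 H.
apply: win_step.
  exists (retarget e x c'.1, c'.2); last by apply: IH; case: (c') w.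
  by rewrite /fstep /= He; apply/istep_map; exists c'.
move=> hm c''; rewrite /fstep /= He => /istep_map [c h ->].
by apply: IH; case: c h => a b h /=; exact: (H hm (a, b)).
Qed.

Definition fhalt (o : O) : frag :=
  @Frag unit tt (fun _ => Halt _ _ _ o) (fun _ => I).

Lemma fhalt_det o : fdet (fhalt o). Proof. by []. Qed.

Lemma ex_halt m o ts n Q : QH o -> ex m (fhalt o) ts n Q.
Proof. by move=> h; apply: win_ret. Qed.

Definition do_instr (Q : finType) (q : (T -> symbol G) -> Q)
    (h : (T -> symbol G) -> T -> symbol G * dir) : instr O Q G T :=
  Step _ (fun s => [set (q s, [ffun i => h s i])]).

Lemma do_instr_total (Q : finType) (q : _ -> Q) h : instr_total (do_instr q h).
Proof. by move=> s; rewrite cards1. Qed.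

Lemma do_instr_det (Q : finType) (q : _ -> Q) h : instr_det (do_instr q h).
Proof. by move=> s; rewrite cards1. Qed.

Lemma istep_do (Q : finType) (q : _ -> Q) h ts c' :
  istep D (do_instr q h) ts c' <-> c' = (q (rd ts), app (h (rd ts)) ts).
Proof.
have E : (([ffun i => rd ts i] : {ffun T -> symbol G}) : T -> symbol G) = rd ts.
  by apply/funext => i; rewrite ffunE.
have E' : app (([ffun i => h (rd ts) i] : {ffun T -> symbol G * dir}) : T -> _) ts = app (h (rd ts)) ts.
  by apply/funext => i; rewrite /app ffunE.
split=> /=.
  by case=> a; rewrite inE => /eqP -> ->; rewrite /= E E'.
move=> ->; exists (q (rd ts), [ffun i => h (rd ts) i]); last by rewrite /= E'.
by rewrite inE E.
Qed.

Definition stay (r : T -> symbol G) : T -> symbol G * dir := fun i => (r i, Stay).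

Lemma app_stay ts : app (stay (rd ts)) ts = ts.
Proof. by apply/funext => i; rewrite /app /= nwrite_read. Qed.

Definition fdo (h : (T -> symbol G) -> T -> symbol G * dir) : frag :=
  @Frag unit tt (fun _ => do_instr (fun _ => None) h)
    (fun _ => do_instr_total _ _).

Lemma fdo_free h : ffree (fdo h). Proof. by []. Qed.

Lemma fdo_det h : fdet (fdo h).
Proof. by move=> q; apply: do_instr_det. Qed.

Lemma ex_do m h ts n (Q : tapes -> Prop) :
  0 < n -> Q (app (h (rd ts)) ts) -> ex m (fdo h) ts n Q.
Proof.
case: n => // n _ H; apply: win_step.
  by exists (None, app (h (rd ts)) ts); [apply/istep_do|apply: win_ret].
by move=> _ c' /istep_do ->; apply: win_ret.
Qed.

Definition fseq (f g : frag) : frag.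
Proof.
refine (@Frag (fstate f + fstate g)%type (inl (fstart f))
  (fun q => match q with
   | inl s => instr_map (fun q => Some (if q is Some s then inl s else inr (fstart g)))
                        (fcode s)
   | inr s => instr_map (omap inr) (fcode s)
   end) _).
by case=> s; apply: instr_map_total; apply: ftotal.
Defined.

Lemma fseq_det f g : fdet f -> fdet g -> fdet (fseq f g).
Proof. by move=> hf hg [s|s]; apply: instr_map_det. Qed.

Lemma fseq_free f g : ffree f -> ffree g -> ffree (fseq f g).
Proof. by move=> hf hg [s|s]; apply: instr_map_free. Qed.

Lemma instr_map_ext (Q Q' : finType) (g g' : Q -> Q') i :
  g =1 g' -> instr_map g i = instr_map g' i.
Proof. by move=> /funext ->. Qed.

(** The postcondition of [f] is the success of [g] from there on, so a composite program is verified
    forwards along its text, splitting the budget at each semicolon. *)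
Lemma ex_seq m f g ts n1 n2 n (Q : tapes -> Prop) : n1 + n2 <= n ->
  ex m f ts n1 (fun ts' => ex m g ts' n2 Q) -> ex m (fseq f g) ts n Q.
Proof.
move=> le_n H; apply: win_le le_n _.
apply: (@fwin_lift f (fseq f g) inl (Some (inr (fstart g))) _ m n1 n2 Q
         (Some (fstart f))) => [s|].
  by apply: instr_map_ext => -[].
apply: fwin_imp H => ts' H; rewrite -[n2]addn0.
apply: (@fwin_lift g (fseq f g) inr None _ m n2 0 Q (Some (fstart g))) => [s|].
  by apply: instr_map_ext => -[].
by apply: fwin_imp H => ts'' H; apply: win_ret.
Qed.

Definition fif (c : (T -> symbol G) -> bool) (f g : frag) : frag.
Proof.
refine (@Frag (option (fstate f + fstate g)%type) None
  (fun q => match q with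
   | None => do_instr (fun r => Some (Some (if c r then inl (fstart f)
                                            else inr (fstart g)))) stay
   | Some (inl s) => instr_map (omap (Some \o inl)) (fcode s)
   | Some (inr s) => instr_map (omap (Some \o inr)) (fcode s)
   end) _).
case=> [[s|s]|]; [| |exact: do_instr_total];
  by apply: instr_map_total; apply: ftotal.
Defined.

Lemma fif_det c f g : fdet f -> fdet g -> fdet (fif c f g).
Proof.
by move=> hf hg [[s|s]|]; [| |exact: do_instr_det]; apply: instr_map_det.
Qed.

Lemma fif_free c f g : ffree f -> ffree g -> ffree (fif c f g).
Proof. by move=> hf hg [[s|s]|] //; apply: instr_map_free. Qed.

Lemma ex_if m (c : _ -> bool) (f g : frag) ts n n' Q : n < n' ->
  (c (rd ts) -> ex m f ts n Q) -> (~~ c (rd ts) -> ex m g ts n Q) ->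
  ex m (fif c f g) ts n' Q.
Proof.
move=> le_n Hf Hg; apply: win_le le_n _.
have H : fwin (f := fif c f g) m n
    (Some (Some (if c (rd ts) then inl (fstart f) else inr (fstart g))), ts) Q.
  rewrite -[n]addn0; case: ifP => [/Hf|/negbT/Hg] H.
    apply: (@fwin_lift f (fif c f g) (Some \o inl) None _ m n 0 Q
             (Some (fstart f))) => [s|].
      by apply: instr_map_ext => -[].
    by apply: fwin_imp H => ts'' H; apply: win_ret.
  apply: (@fwin_lift g (fif c f g) (Some \o inr) None _ m n 0 Q
           (Some (fstart g))) => [s|].
    by apply: instr_map_ext => -[].
  by apply: fwin_imp H => ts'' H; apply: win_ret.
apply: win_step; first by eexists; [apply/istep_do; reflexivity|rewrite app_stay].
by move=> _ c' /istep_do ->; rewrite app_stay.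
Qed.

Definition fwhile (c : (T -> symbol G) -> bool) (f : frag) : frag.
Proof.
refine (@Frag (option (fstate f)) None
  (fun q => match q with
   | None => do_instr (fun r => if c r then Some (Some (fstart f)) else None) stay
   | Some s => instr_map Some (fcode s)
   end) _).
by case=> [s|]; [apply: instr_map_total; apply: ftotal|exact: do_instr_total].
Defined.

Lemma fwhile_det c f : fdet f -> fdet (fwhile c f).
Proof. by move=> hf [s|]; [apply: instr_map_det|exact: do_instr_det]. Qed.

Lemma fwhile_free c f : ffree f -> ffree (fwhile c f).
Proof. by move=> hf [s|] //; apply: instr_map_free. Qed.

Lemma ex_while_end m (c : _ -> bool) (f : frag) ts n (Q : tapes -> Prop) :
  0 < n -> ~~ c (rd ts) -> Q ts -> ex m (fwhile c f) ts n Q.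
Proof.
move=> le_n /negPf hc HQ; apply: win_le le_n _.
apply: win_step.
  eexists; first by apply/istep_do; reflexivity.
  by rewrite app_stay hc; apply: win_ret.
by move=> _ c' /istep_do ->; rewrite app_stay hc; apply: win_ret.
Qed.

(** Loops have no invariant rule: one iteration is unfolded, and the induction is done where the
    loop is used, on whatever data it consumes. The strict inequality pays for the test. *)
Lemma ex_while_next m (c : _ -> bool) (f : frag) ts n1 n2 n Q : n1 + n2 < n -> c (rd ts) ->
  ex m f ts n1 (fun ts' => ex m (fwhile c f) ts' n2 Q) ->
  ex m (fwhile c f) ts n Q.
Proof.
move=> le_n hc H; apply: win_le le_n _.
have K : fwin (f := fwhile c f) m (n1 + n2) (Some (Some (fstart f)), ts) Q.
  apply: (@fwin_lift f (fwhile c f) Some (Some None) _ m n1 n2 Q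
           (Some (fstart f))) => // s.
  by apply: instr_map_ext => -[].
apply: win_step.
  eexists; first by apply/istep_do; reflexivity.
  by rewrite app_stay hc.
by move=> _ c' /istep_do ->; rewrite app_stay hc.
Qed.

Definition fask (f g : frag) : frag.
Proof.
refine (@Frag (option (fstate f + fstate g)%type) None
  (fun q => match q with
   | None => Query _ _ _ (Some (Some (inl (fstart f)))) (Some (Some (inr (fstart g))))
   | Some (inl s) => instr_map (omap (Some \o inl)) (fcode s)
   | Some (inr s) => instr_map (omap (Some \o inr)) (fcode s)
   end) _).
by case=> [[s|s]|] //; apply: instr_map_total; apply: ftotal.
Defined.

Lemma fask_det f g : fdet f -> fdet g -> fdet (fask f g).
Proof. by move=> hf hg [[s|s]|] //; apply: instr_map_det. Qed.

Lemma ex_ask m (f g : frag) ts n n' Q : n < n' ->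
  (D (query_word (ts ot)) -> ex m f ts n Q) ->
  (~ D (query_word (ts ot)) -> ex m g ts n Q) ->
  ex m (fask f g) ts n' Q.
Proof.
move=> le_n Hf Hg; apply: win_le le_n _.
have Kf : D (query_word (ts ot)) ->
    fwin (f := fask f g) m n (Some (Some (inl (fstart f))), ts) Q.
  move=> /Hf H; rewrite -[n]addn0.
  apply: (@fwin_lift f (fask f g) (Some \o inl) None _ m n 0 Q
           (Some (fstart f))) => [s|].
    by apply: instr_map_ext => -[].
  by apply: fwin_imp H => ts'' H; apply: win_ret.
have Kg : ~ D (query_word (ts ot)) ->
    fwin (f := fask f g) m n (Some (Some (inr (fstart g))), ts) Q.
  move=> /Hg H; rewrite -[n]addn0.
  apply: (@fwin_lift g (fask f g) (Some \o inr) None _ m n 0 Q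
           (Some (fstart g))) => [s|].
    by apply: instr_map_ext => -[].
  by apply: fwin_imp H => ts'' H; apply: win_ret.
apply: win_step.
  have [h|h] := EM (D (query_word (ts ot))).
    by eexists; [left; split; [exact: h|reflexivity]|exact: Kf].
  by eexists; [right; split; [exact: h|reflexivity]|exact: Kg].
by move=> _ c' [[h ->]|[h ->]]; [exact: Kf|exact: Kg].
Qed.

End Fragments.

Lemma fwin_outcome (O : Type) (G T : finType) (ot : T) D (QH QH' : O -> Prop)
    (f : frag O G T) m n c Q : (forall o, QH o -> QH' o) ->
  fwin ot D QH (f := f) m n c Q -> fwin ot D QH' (f := f) m n c Q.
Proof.
move=> H; apply: win_imp => -[[q|] ts] //; rewrite /ffin /=.
by case: (fcode q) => // o; apply: H.
Qed.
Arguments ex_seq {O G T ot D QH m f g ts} n1 n2 {n Q}.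
Arguments ex_while_next {O G T ot D QH m c f ts} n1 n2 {n Q}.
Arguments ex_if {O G T ot D QH m c f g ts} n {n' Q}.
Arguments ex_ask {O G T ot D QH m f g ts} n {n' Q}.

(** * From fragments to complete machines *)

Section Machines.
Variables (O : Type) (G T : finType) (it ot : T) (it_ot : it != ot) (o0 : O).
Variable f : frag O G T.

Definition machine_code (q : option (fstate f)) : instr O (option (fstate f)) G T :=
  if q is Some s then fcode s else Halt _ _ _ o0.

Lemma machine_total q : instr_total (machine_code q).
Proof. by case: q => //= s; apply: ftotal. Qed.

Definition machine : otm O := OTM (Some (fstart f)) it_ot machine_total.

Lemma machine_det : fdet f -> deterministic machine.
Proof. by move=> H [q|] //=; apply: H. Qed.

Variables (D : language) (QH : O -> Prop).

Definition ntapes (c : config machine) : tapes G T := fun i => ntape (ctapes c i).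

Notation fst_ := (@fstep O G T ot D f).

Lemma ntapes_act c (a : state machine * {ffun T -> symbol G * dir}) :
  ntapes (act (M := machine) c a) = app a.2 (ntapes c).
Proof.
by apply/funext => i; rewrite /ntapes /app ffunE ntape_move ntape_write.
Qed.

Lemma scanned_ntapes c : scanned (M := machine) c = [ffun i => rd (ntapes c) i].
Proof. by apply/ffunP => i; rewrite !ffunE /rd /ntapes ntape_read. Qed.

(** Normalizing tapes commutes with reading, writing, moving and querying; with [fstep_step] this
    makes the machine and the fragment semantics bisimilar. *)
Lemma step_fstep c c' : step (M := machine) D c c' ->
  fst_ (cstate c, ntapes c) (cstate c', ntapes c').
Proof.
rewrite /step /fstep /=; case: c => -[q|] ts //=.
case: (fcode q) => [o|y n|d] //=.
- by rewrite ntape_query => -[[h ->]|[h ->]]; [left|right].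
- by rewrite scanned_ntapes => -[a ha ->]; exists a => //;
  congr pair; exact: ntapes_act.
Qed.

Lemma fstep_step c e : fst_ (cstate c, ntapes c) e ->
  exists2 c', step (M := machine) D c c' & e = (cstate c', ntapes c').
Proof.
rewrite /step /fstep /=; case: c => -[q|] ts //=.
case: (fcode q) => [o|y n|d] //=.
- rewrite ntape_query => -[[h ->]|[h ->]].
    by exists (Config (M := machine) y ts); [left|].
  by exists (Config (M := machine) n ts); [right|].
- rewrite -(scanned_ntapes (Config (M := machine) (Some q) ts)) => -[a ha ->].
  eexists; first by exists a.
  by congr pair; apply/esym; exact: ntapes_act.
Qed.

(** As exit condition it forbids leaving the fragment, so that a machine verified with it ends in a
    [Halt] of the fragment itself. *)
Definition none (_ : tapes G T) := False.

(** Each step of a run uses up one unit of the budget, and what remains is still a winning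
    configuration. Both the time bound and the correctness of outcomes follow from this
    invariant. *)
Lemma fwin_run n c c' B : run (M := machine) D n c c' ->
  fwin ot D QH (f := f) true B (cstate c, ntapes c) none ->
  exists2 B', n + B' = B
    & fwin ot D QH (f := f) true B' (cstate c', ntapes c') none.
Proof.
elim: n c B => [|n IH] c B /=; first by move=> <- ?; exists B.
move=> [c1 /step_fstep s r]; case: B => [|B] [Hf|//].
- by move: s Hf; rewrite /ffin /fstep /=; case: (cstate c) => //= q; case: fcode.
- by move: s Hf; rewrite /ffin /fstep /=; case: (cstate c) => //= q; case: fcode.
- move=> [_ /(_ isT _ s) /(IH _ _ r)] [B' <- h]; by exists B' => //; rewrite addSn.
Qed.

Lemma run_bound n c c' B : run (M := machine) D n c c' ->
  fwin ot D QH (f := f) true B (cstate c, ntapes c) none -> n <= B.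
Proof. by move=> r /(fwin_run r) [B' <- _]; rewrite leq_addr. Qed.

Lemma run_halt n c c' B o : run (M := machine) D n c c' ->
  fwin ot D QH (f := f) true B (cstate c, ntapes c) none ->
  code (cstate c') = Halt _ _ _ o -> QH o.
Proof.
move=> r /(fwin_run r) [B' _]; case: c' {r} => q ts /=.
case: q => [q|] /=; last first.
  by case: B' => [|B'] [|] //; case=> -[].
move=> + E; case: B' => [|B'] [|]; rewrite /ffin /fstep /= ?E //.
by case=> -[].
Qed.

(** Following the successors that [win] guarantees yields an actual halting run, in either mode: a
    run of the deterministic reduction as well as an accepting path of the verifier. *)
Lemma fwin_halts m c B :
  fwin ot D QH (f := f) m B (cstate c, ntapes c) none ->
  exists n c' o, [/\ run (M := machine) D n c c',
    code (cstate c') = Halt _ _ _ o & QH o].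
Proof.
have ret c1 : ffin QH (f := f) none (cstate c1, ntapes c1) ->
  exists n c' o, [/\ run (M := machine) D n c1 c',
    code (cstate c') = Halt _ _ _ o & QH o].
  rewrite /ffin /=; case E: (cstate c1) => [q|] //=.
  case E': (fcode q) => [o||] // h; exists 0, c1, o; split=> //.
  by rewrite E.
elim: B c => [|B IH] c [/ret|] //.
case=> -[e /fstep_step [c1 s ->] /IH [n [c' [o [r E h]]]] _].
by exists n.+1, c', o; split=> //; exists c1.
Qed.

End Machines.

(** * Tape primitives, rewinding and counted loops *)

Section Primitives.
Variables (O : Type) (G T : finType) (ot : T).
Variables (D : language) (QH : O -> Prop).
Notation frag := (frag O G T).
Notation tapes := (tapes G T).
Notation ex := (@ex O G T ot D QH).
Implicit Types (ts : tapes) (i j : T) (l : word) (Q : tapes -> Prop).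

Lemma upd_eq ts i t : upd ts i t i = t.
Proof. by rewrite /upd eqxx. Qed.

Lemma upd_neq ts i j t : j != i -> upd ts i t j = ts j.
Proof. by rewrite /upd => /negPf ->. Qed.

Lemma upd_upd ts i t t' : upd (upd ts i t) i t' = upd ts i t'.
Proof. by apply/funext => j; rewrite /upd; case: eqP. Qed.

Lemma upd_id ts i : upd ts i (ts i) = ts.
Proof. by apply/funext => j; rewrite /upd; case: eqP => // ->. Qed.

Lemma upd_idE ts i t : ts i = t -> upd ts i t = ts.
Proof. by move=> <-; exact: upd_id. Qed.

Lemma updC ts i j t t' : i != j ->
  upd (upd ts i t) j t' = upd (upd ts j t') i t.
Proof.
move=> ne; apply/funext => k; rewrite /upd; case: eqP => // ->.
by rewrite eq_sym (negPf ne).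
Qed.

Definition prim i (g : (T -> symbol G) -> symbol G) (d : dir) : frag :=
  fdo O (fun r j => if j == i then (g r, d) else (r j, Stay)).
Definition put i b d := prim i (fun _ => bit G b) d.
Definition erase i d := prim i (fun _ => None) d.
Definition go i d := prim i (fun r => r i) d.
Definition cpy i j d := prim j (fun r => r i) d.

Lemma prim_det i g d : fdet (prim i g d). Proof. exact: fdo_det. Qed.

Lemma prim_free i g d : ffree (prim i g d). Proof. exact: fdo_free. Qed.

Lemma ex_prim m i g d ts n Q : 0 < n ->
  Q (upd ts i (nmove d (nwrite (g (rd ts)) (ts i)))) -> ex m (prim i g d) ts n Q.
Proof.
move=> n0 H; apply: ex_do n0 _; congr (Q _): H; apply/funext => j.
by rewrite /app /upd; case: eqP => [->//|_] /=; rewrite nwrite_read.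
Qed.

Lemma ex_go m i d ts n Q : 0 < n ->
  Q (upd ts i (nmove d (ts i))) -> ex m (go i d) ts n Q.
Proof. by move=> n0 H; apply: ex_prim n0 _; rewrite nwrite_read. Qed.

(* The tape holding [l ++ r], with the head on the first cell of [r]. *)
Definition bits (l r : word) : tape G := Tape (map (@bit G) (rev l)) (map (@bit G) r).

Lemma rcons_nseq n (b : bool) : rcons (nseq n b) b = nseq n.+1 b.
Proof. by elim: n => //= n ->. Qed.

Lemma right_bits l b r : nmove MoveRight (bits l (b :: r)) = bits (rcons l b) r.
Proof. by rewrite /bits rev_rcons. Qed.

Lemma left_bits l b r : nmove MoveLeft (bits (rcons l b) r) = bits l (b :: r).
Proof. by rewrite /bits rev_rcons. Qed.

Lemma write_bits b l r : nwrite (bit G b) (bits l r) = bits l (b :: behead r).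
Proof. by rewrite nwrite_bit /bits /= behead_map. Qed.

(** The blank left behind has nothing to its left and is dropped by the normal form, so an erased
    prefix leaves no trace. *)
Lemma erase_bits b r :
  nmove MoveRight (nwrite None (bits [::] (b :: r))) = bits [::] r.
Proof. by rewrite nwrite_blank /nmove //= /bits behead_bcons /read /= head_bcons. Qed.

(** The head may stand on the blank behind the word, where the loop would stop at once; hence the
    first left move. The last move returns from the blank in front of the word. *)
Definition rew i : frag :=
  fseq (go i MoveLeft)
    (fseq (fwhile (fun r => r i != None) (go i MoveLeft)) (go i MoveRight)).

Lemma rew_det i : fdet (rew i).
Proof.
by apply: fseq_det; [exact: prim_det|apply: fseq_det; [apply: fwhile_det|]];
  exact: prim_det.
Qed.

Lemma rew_free i : ffree (rew i).
Proof.
by apply: fseq_free; [exact: prim_free|apply: fseq_free; [apply: fwhile_free|]];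
  exact: prim_free.
Qed.

Lemma ex_rew m i ts l r n Q : ts i = bits l r -> (size l).*2 + 5 <= n ->
  Q (upd ts i (bits [::] (l ++ r))) -> ex m (rew i) ts n Q.
Proof.
move=> E le_n H.
pose Q' ts' := ts' = upd ts i (Tape [::] (bcons None (map (@bit G) (l ++ r)))).
apply: (ex_seq 1 ((size l).*2 + 3)); first by lia.
apply: ex_go => //; apply: (ex_seq ((size l).*2 + 1) 1).
  by lia.
suff K : ex m (fwhile (fun r => r i != None) (go i MoveLeft))
    (upd ts i (nmove MoveLeft (ts i))) ((size l).*2 + 1) Q'.
  apply: ex_imp K => ts' ->; apply: ex_go => //; rewrite upd_upd upd_eq.
  by rewrite /nmove /= /read /= head_bcons behead_bcons.
rewrite {}/Q' {H le_n}; elim/last_ind: l ts r E => [|l b IH] ts r E; rewrite E.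
  apply: ex_while_end => //.
  by rewrite /rd upd_eq /nmove /= /read /= head_bcons.
apply: (ex_while_next 1 ((size l).*2 + 1)).
- by rewrite size_rcons; lia.
- by rewrite /rd upd_eq left_bits.
- apply: ex_go => //; rewrite upd_upd upd_eq left_bits.
  have := IH (upd ts i (bits l (b :: r))) (b :: r).
  rewrite upd_eq !upd_upd cat_rcons; exact.
Qed.

Definition clear i : frag :=
  fwhile (fun r => r i != None) (erase i MoveRight).

Lemma clear_det i : fdet (clear i).
Proof. by apply: fwhile_det; exact: prim_det. Qed.

Lemma clear_free i : ffree (clear i).
Proof. by apply: fwhile_free; exact: prim_free. Qed.

Lemma ex_clear m i ts r n Q : ts i = bits [::] r -> (size r).*2 + 1 <= n ->
  Q (upd ts i (bits [::] [::])) -> ex m (clear i) ts n Q.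
Proof.
move=> + le_n H; elim: r ts n le_n H => [|b r IH] ts n le_n H E.
  apply: ex_while_end; [by lia|by rewrite /rd E|].
  by rewrite upd_idE in H.
apply: (ex_while_next 1 ((size r).*2 + 1)).
- by move: le_n => /=; lia.
- by rewrite /rd E.
- apply: ex_prim => //; rewrite E erase_bits; apply: IH => //.
    by rewrite upd_upd.
  by rewrite upd_eq.
Qed.

(* Runs [body] [k ^ size s] times when every tape of [s] holds [k] marks. *)
Fixpoint nest (s : seq T) (body : frag) : frag :=
  if s is i :: s' then
    fseq (fwhile (fun r => r i != None) (fseq (nest s' body) (go i MoveRight)))
         (rew i)
  else body.

Lemma nest_det s body : fdet body -> fdet (nest s body).
Proof.
move=> H; elim: s => //= i s IH; apply: fseq_det; last exact: rew_det.
by apply: fwhile_det; apply: fseq_det => //; exact: prim_det.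
Qed.

(** Here [k] is the nesting depth and [m] the number of marks per tape, which is called [k] in
    [ex_nest]. An iteration adds a test and a move to the inner time; a level ends with a failed
    test and a rewinding. *)
Fixpoint nest_time (k m B : nat) : nat :=
  if k is k'.+1 then m * (nest_time k' m B + 2) + 1 + (m.*2 + 5) else B.

(** The invariant [I j] describes the tapes after [j] executions of the body in total. It has to be
    insensitive to the counter tapes, whose heads move between executions, and the body has to leave
    those tapes as they are. *)
Lemma ex_nest m (s0 : seq T) (k B : nat) (body : frag) (I : nat -> tapes -> Prop) :
  (forall (j : nat) ts i t, i \in s0 -> I j ts -> I j (upd ts i t)) ->
  (forall (j : nat) ts, j < k ^ size s0 -> I j ts ->
     ex m body ts B (fun ts' => I j.+1 ts' /\ {in s0, ts' =1 ts})) ->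
  uniq s0 -> forall ts, I 0 ts -> 
  {in s0, forall i, ts i = bits [::] (nseq k true)} ->
  ex m (nest s0 body) ts (nest_time (size s0) k B)
    (fun ts' => I (k ^ size s0) ts' /\ {in s0, ts' =1 ts}).
Proof.
move=> Istable Hbody us0 ts I0 Hs0.
(* An inner nest uses only part of the counters and starts when [j0] executions are already done. *)
suff H s : {subset s <= s0} -> uniq s -> forall (j0 : nat) ts,
    j0 + k ^ size s <= k ^ size s0 -> I j0 ts ->
    {in s, forall i, ts i = bits [::] (nseq k true)} ->
    ex m (nest s body) ts (nest_time (size s) k B)
      (fun ts' => I (j0 + k ^ size s) ts' /\ {in s0, ts' =1 ts}).
  by have := H s0 (fun _ => id) us0 0 ts (leqnn _) I0 Hs0.
elim: s {ts I0 Hs0 us0} => [|i s IH] sub /=.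
  by move=> _ j0 ts; rewrite expn0 addn1 => lt_j I0 _; apply: Hbody.
move=> /andP [i_s us] j0 ts le_j I0 Hs.
have i0 : i \in s0 by apply: sub; rewrite mem_head.
apply: (ex_seq
  (k * (nest_time (size s) k B + 2) + 1) (k.*2 + 5)) => //.
suff W t : t <= k -> forall ts1,
    I (j0 + t * k ^ size s) ts1 ->
    (forall x, x \in s0 -> x != i -> ts1 x = ts x) ->
    ts1 i = bits (nseq t true) (nseq (k - t) true) ->
    ex m (fwhile (fun r => r i != None) (fseq (nest s body) (go i MoveRight)))
      ts1 ((k - t) * (nest_time (size s) k B + 2) + 1)
      (fun ts' => ex m (rew i) ts' (k.*2 + 5)
        (fun ts'' => I (j0 + k ^ (size s).+1) ts'' /\ {in s0, ts'' =1 ts})).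
  have := W 0 (leq0n _) ts; rewrite mul0n addn0 subn0; apply => //.
  by rewrite Hs ?mem_head.
move=> le_t; move E: (k - t) => d; elim: d t le_t E => [|d IHd] t le_t E ts1 I1 F1 Z1.
  apply: ex_while_end; [by lia|by rewrite /rd Z1|].
  have Et : t = k by lia.
  apply: ex_rew Z1 _ _; first by rewrite size_nseq; lia.
  split; first by apply: Istable => //; rewrite expnS; rewrite Et in I1.
  move=> x x0; rewrite /upd; case: eqP => [->|/eqP ne]; last exact: F1.
  by rewrite Hs ?mem_head // cats0 Et.
apply: (ex_while_next (nest_time (size s) k B + 1)
  (d * (nest_time (size s) k B + 2) + 1)).
- by rewrite mulSn; lia.
- by rewrite /rd Z1.
apply: (ex_seq (nest_time (size s) k B) 1) => //.
have le_j' : j0 + t * k ^ size s + k ^ size s <= k ^ size s0.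
  apply: leq_trans le_j; rewrite -addnA leq_add2l addnC -mulSn expnS.
  by rewrite leq_mul2r; apply/orP; right; lia.
have := IH _ us _ ts1 le_j' I1; move=> /(_ _ _) K.
apply: ex_imp (K _ _) => [ts2 [I2 F2]||].
- apply: ex_go => //; apply: (IHd t.+1); [by lia|by lia| | |].
  + by apply: Istable => //; rewrite mulSn [k ^ _ + _]addnC addnA.
  + by move=> x x0 ne; rewrite upd_neq // F2 // F1.
  + rewrite upd_eq F2 // Z1 -[nseq d.+1 true]/(true :: nseq d true) right_bits.
    by rewrite rcons_nseq.
- by move=> x xs; apply: sub; rewrite inE xs orbT.
- move=> x xs; rewrite F1 ?Hs ?inE ?xs ?orbT //.
    by apply: sub; rewrite inE xs orbT.
  by apply: contraNneq i_s => <-.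
Qed.

End Primitives.

Ltac free_tac := repeat match goal with
  | |- ffree (fseq _ _) => apply: fseq_free
  | |- ffree (fif _ _ _) => apply: fif_free
  | |- ffree (fwhile _ _) => apply: fwhile_free
  | |- ffree (fdo _ _) => exact: fdo_free
  | |- ffree (prim _ _ _ _) => exact: prim_free
  | |- ffree (go _ _ _ _) => exact: prim_free
  | |- ffree (put _ _ _ _ _) => exact: prim_free
  | |- ffree (cpy _ _ _ _ _) => exact: prim_free
  | |- ffree (erase _ _ _ _) => exact: prim_free
  | |- ffree (rew _ _ _) => exact: rew_free
  | |- ffree (clear _ _ _) => exact: clear_free
  end.

Ltac det_tac := repeat match goal with
  | |- fdet (fseq _ _) => apply: fseq_det
  | |- fdet (fif _ _ _) => apply: fif_det
  | |- fdet (fwhile _ _) => apply: fwhile_det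
  | |- fdet (fdo _ _) => exact: fdo_det
  | |- fdet (prim _ _ _ _) => exact: prim_det
  | |- fdet (go _ _ _ _) => exact: prim_det
  | |- fdet (put _ _ _ _ _) => exact: prim_det
  | |- fdet (cpy _ _ _ _ _) => exact: prim_det
  | |- fdet (erase _ _ _ _) => exact: prim_det
  | |- fdet (rew _ _ _) => exact: rew_det
  | |- fdet (clear _ _ _) => exact: clear_det
  | |- fdet (fask _ _) => apply: fask_det
  | |- fdet (fhalt _ _ _) => exact: fhalt_det
  end.

(** * Partial oracles and certificates *)

Notation column := (bool * bool)%type.

(* A column [(true, b)] is a letter [b] of the current word, and [(false, a)]
   ends the word and records the oracle answer [a] to it. *)
Fixpoint parse (cur : word) (cs : seq column) : seq (word * bool) :=
  match cs with
  | (true, b) :: cs' => parse (rcons cur b) cs'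
  | (false, a) :: cs' => (cur, a) :: parse [::] cs'
  | [::] => [::]
  end.

Fixpoint pending (cur : word) (cs : seq column) : word :=
  match cs with
  | (true, b) :: cs' => pending (rcons cur b) cs'
  | (false, _) :: cs' => pending [::] cs'
  | [::] => cur
  end.

Definition item (q : word) (a : bool) : seq column :=
  rcons [seq (true, b) | b <- q] (false, a).

Fixpoint lookup (l : seq (word * bool)) (q : word) : option bool :=
  if l is (p, a) :: l' then if p == q then Some a else lookup l' q else None.

Fixpoint leading (cs : seq column) : word :=
  if cs is (true, b) :: cs' then b :: leading cs' else [::].

Section Truth.
Variable D : language.

Fixpoint truth (cur : word) (cs : seq column) : seq column :=
  match cs with
  | (true, b) :: cs' => (true, b) :: truth (rcons cur b) cs'
  | (false, _) :: cs' => (false, `[< D cur >]) :: truth [::] cs'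
  | [::] => [::]
  end.

Lemma parse_truth cur cs :
  parse cur (truth cur cs) = [seq (p.1, `[< D p.1 >]) | p <- parse cur cs].
Proof. by elim: cs cur => [|[[] b] cs IH] cur //=; rewrite IH. Qed.

Lemma size_truth cur cs : size (truth cur cs) = size cs.
Proof. by elim: cs cur => [|[[] b] cs IH] cur //=; rewrite IH. Qed.

Lemma lookup_truthful (l : seq (word * bool)) q : lookup [seq (p.1, `[< D p.1 >]) | p <- l] q =
  if q \in map fst l then Some `[< D q >] else None.
Proof.
elim: l => //= -[p a] l IH /=; rewrite inE eq_sym.
by case: eqP => [->|_].
Qed.

End Truth.

Lemma parse_cat cur cs cs' :
  parse cur (cs ++ cs') = parse cur cs ++ parse (pending cur cs) cs'.
Proof. by elim: cs cur => [|[[] b] cs IH] cur //=; rewrite IH. Qed.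

Lemma parse_item cur q a cs :
  parse cur (item q a ++ cs) = (cur ++ q, a) :: parse [::] cs.
Proof.
rewrite /item; elim: q cur => [|b q IH] cur /=; first by rewrite cats0.
by rewrite IH cat_rcons.
Qed.

Lemma size_item q a : size (item q a) = (size q).+1.
Proof. by rewrite /item size_rcons size_map. Qed.

Lemma lookup_cat l l' q :
  lookup (l ++ l') q = if lookup l q is Some b then Some b else lookup l' q.
Proof. by elim: l => //= -[p a] l IH; case: eqP. Qed.

Lemma lookup_dom l q : (lookup l q != None) = (q \in map fst l).
Proof. by elim: l => //= -[p a] l IH; rewrite inE [q == p]eq_sym; case: (p =P q). Qed.

Section Certificates.
Variables (O : Type) (N : otm O).
Implicit Types c : config N.

(** A query outside the list blocks, so a path found this way depends on the listed answers only and
    exists under every oracle that agrees with them. *)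
Definition pstep (l : seq (word * bool)) c c' : Prop :=
  match code (cstate c) with
  | Halt _ => False
  | Query qyes qno =>
      exists2 b, lookup l (query_word (ctapes c (oracle_tape N))) = Some b
               & c' = Config (if b then qyes else qno) (ctapes c)
  | Step d => exists2 a, a \in d (scanned c) & c' = act c a
  end.

Fixpoint prun l (n : nat) c c' : Prop :=
  if n is n'.+1 then exists2 c1, pstep l c c1 & prun l n' c1 c' else c = c'.

Lemma ctapes_act c a i :
  ctapes (act c a) i = move (a.2 i).2 (write (a.2 i).1 (ctapes c i)).
Proof. by rewrite ffunE. Qed.

Lemma run_rcons D n c c1 c2 :
  run D n c c1 -> step D c1 c2 -> run D n.+1 c c2.
Proof.
elim: n c => [|n IH] c; first by move=> -> s; exists c2.
by move=> [c' s r] s'; exists c' => //; apply: IH s'.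
Qed.

Lemma prun_rcons l n c c1 c2 :
  prun l n c c1 -> pstep l c1 c2 -> prun l n.+1 c c2.
Proof.
elim: n c => [|n IH] c; first by move=> -> s; exists c2.
by move=> [c' s r] s'; exists c' => //; apply: IH s'.
Qed.

Lemma pstep_step l (D : language) c c' :
  (forall q b, lookup l q = Some b -> D q <-> b) ->
  pstep l c c' -> step D c c'.
Proof.
move=> H; rewrite /pstep /step; case: (code (cstate c)) => // y n.
case=> -[] /H E ->; [left|right]; split=> //; first exact/E.
by move/E.
Qed.

Lemma prun_run l (D : language) n c c' :
  (forall q b, lookup l q = Some b -> D q <-> b) ->
  prun l n c c' -> run D n c c'.
Proof.
move=> H; elim: n c => //= n IH c [c1 s r]; exists c1; last exact: IH.
exact: pstep_step s.
Qed.

Lemma size_bit_prefix G (s : seq (symbol G)) : size (bit_prefix s) <= size s.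
Proof. by elim: s => // -[[]|]. Qed.

(** Writing can add the scanned cell to the list and a left move one more; this is the source of the
    factor two in all bounds on query lengths. *)
Lemma size_right_step G s d (t : tape G) :
  size (right_part (move d (write s t))) <= size (right_part t) + 2.
Proof. by case: d; case: t => l [|a r] /=; lia. Qed.

Lemma size_right_run D n c c' i : run D n c c' ->
  size (right_part (ctapes c' i)) <= size (right_part (ctapes c i)) + n.*2.
Proof.
elim: n c => [|n IH] c; first by move=> ->; rewrite addn0.
move=> [c1 s /IH H]; apply: leq_trans H _.
suff : size (right_part (ctapes c1 i)) <= size (right_part (ctapes c i)) + 2 by lia.
move: s; rewrite /step; case: (code _) => // [y m|d].
  by case=> -[_ ->] /=; lia.
by move=> [a _ ->] /=; rewrite ffunE; apply: size_right_step.
Qed.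

(** Only the queries met on the path matter. This is recorded in two forms for two uses: [rounds_le]
    changes the oracle and keeps the path, [cert_complete] replaces the oracle by a list. *)
Lemma run_local (D : language) n c c' : run D n c c' ->
  exists qs : seq word,
  [/\ size qs <= n,
      {in qs, forall q,
        size q <= size (right_part (ctapes c (oracle_tape N))) + n.*2},
      forall D' : language, {in qs, forall q, D' q <-> D q} -> run D' n c c'
    & forall l, {in qs, forall q, lookup l q = Some `[< D q >]} ->
        prun l n c c'].
Proof.
elim: n c => [|n IH] c; first by move=> <-; exists [::].
move=> [c1 s r]; have [qs [sz szq H1 H2]] := IH c1 r.
pose q0 := query_word (ctapes c (oracle_tape N)).
exists (q0 :: qs); split=> //.
- move=> q; rewrite inE => /orP [/eqP ->|/szq H].
    by apply: leq_trans (size_bit_prefix _) _; rewrite leq_addr.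
  apply: leq_trans H _.
  have /(size_right_run (oracle_tape N)) : run D 1 c c1 by exists c1.
  by lia.
- move=> D' HD; exists c1; last first.
    by apply: H1 => q hq; apply: HD; rewrite inE hq orbT.
  have HD0 := HD q0 (mem_head _ _); move: s; rewrite /step.
  by case: (code _) => // y m; rewrite -/q0 HD0.
- move=> l Hl; exists c1; last first.
    by apply: H2 => q hq; apply: Hl; rewrite inE hq orbT.
  have Hl0 := Hl q0 (mem_head _ _); move: s; rewrite /step /pstep.
  case: (code _) => // y m; rewrite -/q0 => s; exists `[< D q0 >] => //.
  by case: s => -[h ->]; [rewrite asboolT|rewrite asboolF].
Qed.

End Certificates.

(** * Rounds of certificates and corrections *)

Section Rounds.
Variable N : otm outcome.

(* The first matching item of the list answers each query, and every query must be
   answered by the list. *)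
Definition cert (x : word) (cs : seq column) : Prop :=
  exists n c, prun (N := N) (parse [::] cs) n (init N x) c
    /\ code (cstate c) = Halt _ _ _ acc.

Variables (D : language) (x : word) (U : nat).

(* The lists reached after [j] successful rounds: [U] unknown columns are appended
   to the list with corrected answers and filled in so as to get a certificate. *)
Inductive rounds : nat -> seq column -> Prop :=
| rounds0 : rounds 0 (item x false)
| roundsS j cs u : rounds j cs -> size u = U -> cert x (truth D [::] cs ++ u) ->
    rounds j.+1 (truth D [::] cs ++ u).

Lemma rounds_size j cs : rounds j cs -> size cs = (size x).+1 + j * U.
Proof.
elim=> [|{}j {}cs u _ IH su _]; first by rewrite size_item addn0.
by rewrite size_cat size_truth IH su mulSn; lia.
Qed.

Lemma leading_item q a cs : leading (item q a ++ cs) = q.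
Proof. by rewrite /item; elim: q => //= b q ->. Qed.

Lemma truth_item cur q a cs : truth D cur (item q a ++ cs) =
  item q `[< D (cur ++ q) >] ++ truth D [::] cs.
Proof.
rewrite /item; elim: q cur => [|b q IH] cur /=; first by rewrite cats0.
by rewrite IH (cat_rcons b).
Qed.

(** The first item carries [x] to the verifier and survives all rounds. The initial answer [false]
    in it is a placeholder that gets corrected before any certificate is formed. *)
Lemma rounds_item j cs : rounds j cs -> exists a cs', cs = item x a ++ cs'.
Proof.
elim=> [|{}j {}cs u _ [a [cs' ->]] _ _].
  by exists false, [::]; rewrite cats0.
by rewrite truth_item -catA; do 2!eexists.
Qed.

Lemma leading_truth cs u : (exists a cs', cs = item x a ++ cs') ->
  leading (truth D [::] cs ++ u) = x.
Proof. by move=> [a [cs' ->]]; rewrite truth_item -catA leading_item. Qed.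

(* An accepting path whose oracle answers extend the known true ones must disagree
   with every rejecting path under [D] on a query whose answer is not yet known:
   otherwise some oracle would produce both outcomes. *)
Lemma rounds_le j cs n (c : config N) : robustly_underproductive N ->
  run D n (init N x) c -> code (cstate c) = Halt _ _ _ rej ->
  rounds j cs -> j <= n.
Proof.
move=> rob r rc; have [qs [sz _ loc _]] := run_local r.
(* The measure of progress is the number of queries of the rejecting path that the list mentions; it
   cannot exceed the length of that path. *)
suff H : rounds j cs ->
    j <= count (fun q => q \in map fst (parse [::] cs)) qs.
  move=> /H /leq_trans; apply; exact: leq_trans (count_size _ _) sz.
elim=> // {}j {}cs u _ IH _ [m [c' [r' ac]]].
apply: leq_ltn_trans IH _.
set l := parse [::] _ in r' *.
have domE : map fst (parse [::] (truth D [::] cs)) = map fst (parse [::] cs).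
  by rewrite parse_truth -map_comp; apply: eq_map.
have sub q : q \in map fst (parse [::] cs) -> q \in map fst l.
  by rewrite /l parse_cat map_cat mem_cat domE => ->.
have [q [q_qs q_l q_cs]] : exists q,
    [/\ q \in qs, q \in map fst l & q \notin map fst (parse [::] cs)].
  (* The hybrid oracle follows the list where it has an answer and [D] elsewhere. Were no query of
     the rejecting path newly listed, it would agree with [D] on that path and thus admit both
     outcomes. *)
  apply: contrapT => no; pose D' : language := fun q =>
    if lookup l q is Some b then b : Prop else D q.
  apply: (rob D' x) => o [->|->].
    by exists m, c'; split=> //; apply: prun_run r' => q b; rewrite /D' => ->.
  exists n, c; split=> //; apply: loc => q q_qs; rewrite /D'.
  case E: (lookup l q) => [b|//].
  have q_l : q \in map fst l by rewrite -lookup_dom E.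
  have q_cs : q \in map fst (parse [::] cs).
    by apply/negPn/negP => h; apply: no; exists q.
  move: E; rewrite /l parse_cat lookup_cat parse_truth lookup_truthful q_cs.
  by case=> <-; split=> /asboolP.
rewrite -(count_predC (fun q => q \in map fst (parse [::] cs))) in sz *.
have -> : count (fun q => q \in map fst l) qs =
  count (fun q => q \in map fst (parse [::] cs)) qs +
  count (fun q => (q \in map fst l) && (q \notin map fst (parse [::] cs))) qs.
  elim: (qs) => //= q1 qs1 ->.
  by have := @sub q1; case: (_ \in map fst (parse _ _)); case: (_ \in map fst l); lia.
rewrite -addn1 leq_add2l -has_count; apply/hasP; exists q => //.
by rewrite q_l q_cs.
Qed.

(** The true answers to the queries of the accepting path are appended; the corrected entries before
    them are true as well, so first-match lookup returns the answers of [D]. The bound counts one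
    column to end an unfinished word and, for each of at most [n] queries, at most [n.*2] letters
    and an end column. *)
Lemma cert_complete cs n (c : config N) :
  run D n (init N x) c -> code (cstate c) = Halt _ _ _ acc ->
  1 + n * (n.*2 + 1) <= U ->
  exists2 u, size u = U & cert x (truth D [::] cs ++ u).
Proof.
move=> r ac le_U; have [qs [sz szq _ loc]] := run_local r.
pose it q := item q `[< D q >].
pose cur := pending [::] (truth D [::] cs).
(* The list may stop in the middle of a word [cur]; the first new column ends it, with its true
   answer. *)
pose u0 := (false, `[< D cur >]) :: flatten (map it qs).
have sz_u0 : size u0 <= U.
  apply: leq_trans le_U; rewrite /u0 /= add1n ltnS.
  have le_q q : q \in qs -> size q <= n.*2.
    move=> /szq; rewrite /= ffunE eq_sym (negPf (input_neq_oracle N)) /=.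
    by rewrite add0n.
  apply: leq_trans (_ : size qs * (n.*2 + 1) <= _); last by rewrite leq_mul2r sz orbT.
  elim: (qs) le_q => //= q qs1 IH le_q; rewrite size_cat size_item mulSn.
  have := le_q q (mem_head _ _).
  have := IH (fun q' h => le_q q' (mem_behead (s := q :: qs1) h)).
  by lia.
(* The padding claims a negative answer for the empty word, but it comes after all true answers and
   so overrides none of them. *)
exists (u0 ++ nseq (U - size u0) (false, false)).
  by rewrite size_cat size_nseq subnKC.
exists n, c; split=> //; apply: loc => q hq.
rewrite parse_cat parse_truth /u0 /= -/cur parse_cat.
have -> : parse [::] (flatten (map it qs)) = [seq (p, `[< D p >]) | p <- qs].
  by elim: (qs) => //= q1 qs1 <-; rewrite parse_item.
set l0 := (X in X ++ (_ :: _ ++ _)); set l1 := map _ qs; set l2 := parse _ (nseq _ _).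
have -> : l0 ++ (cur, `[< D cur >]) :: l1 ++ l2 =
  [seq (p.1, `[< D p.1 >]) | p <- parse [::] cs ++ (cur, true) :: [seq (p, true) | p <- qs]]
  ++ l2.
  by rewrite map_cat /= -catA /=; do 3!congr cons || congr cat; rewrite -map_comp.
rewrite lookup_cat lookup_truthful map_cat mem_cat /= inE -map_comp.
by rewrite map_id hq !orbT.
Qed.

End Rounds.

(** * Polynomial bounds *)

(** A base of at least 2 absorbs constants into the exponent, and the bound is exactly what [k]
    nested loops over [n + 2] marks can count. *)
Definition polyb (f : nat -> nat) := exists k, forall n, f n <= (n + 2) ^ k.

Lemma polyb_le f g : (forall n, f n <= g n) -> polyb g -> polyb f.
Proof. by move=> H [k Hk]; exists k => n; apply: leq_trans (H n) (Hk n). Qed.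

Lemma polyb_const c : polyb (fun _ => c).
Proof.
exists c => n; apply: leq_trans (_ : 2 ^ c <= _); first exact/ltnW/ltn_expl.
by case: c => // c; rewrite leq_exp2r ?leq_addl.
Qed.

Lemma leq_exp2_base n k k' : k <= k' -> (n + 2) ^ k <= (n + 2) ^ k'.
Proof. by move=> ?; rewrite leq_pexp2l // addn2. Qed.

Lemma polyb_id : polyb id.
Proof. by exists 1 => n; rewrite expn1 leq_addr. Qed.

Lemma polyb_add f g : polyb f -> polyb g -> polyb (fun n => f n + g n).
Proof.
move=> [k Hk] [l Hl]; exists (maxn k l).+1 => n.
rewrite expnS; apply: leq_trans (_ : 2 * (n + 2) ^ maxn k l <= _); last first.
  by rewrite leq_mul2r leq_addl orbT.
rewrite mul2n -addnn leq_add //.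
  by apply: leq_trans (Hk n) (leq_exp2_base _ (leq_maxl _ _)).
by apply: leq_trans (Hl n) (leq_exp2_base _ (leq_maxr _ _)).
Qed.

Lemma polyb_mul f g : polyb f -> polyb g -> polyb (fun n => f n * g n).
Proof.
by move=> [k Hk] [l Hl]; exists (k + l) => n; rewrite expnD leq_mul.
Qed.

Lemma polyb_exp f k : polyb f -> polyb (fun n => f n ^ k).
Proof.
move=> Hf; elim: k => [|k IH]; first exact: (polyb_const 1).
by apply: polyb_le (polyb_mul Hf IH) => n; rewrite expnS.
Qed.

Lemma polyb_double f : polyb f -> polyb (fun n => (f n).*2).
Proof. by move=> h; apply: polyb_le (polyb_add h h) => n; rewrite addnn. Qed.

Lemma polyb_comp f g : polyb f -> polyb g -> polyb (fun n => f (g n)).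
Proof.
move=> [k Hk] /polyb_add /(_ (polyb_const 2)) /(polyb_exp k).
by apply: polyb_le => n; apply: Hk.
Qed.

Lemma polyb_horner (p : {poly nat}) : polyb (fun n => p.[n]%R).
Proof.
elim/poly_ind: p => [|p c IH].
  by apply: polyb_le (polyb_const 0) => n; rewrite horner0.
apply: polyb_le (polyb_add (polyb_mul IH polyb_id) (polyb_const c)) => n.
by rewrite hornerMXaddC.
Qed.

Lemma polyb_poly f : polyb f -> exists p : {poly nat}, forall n, f n <= p.[n]%R.
Proof.
move=> [k Hk]; exists (('X + 2%:P) ^+ k)%R => n; rewrite horner_exp hornerD.
rewrite hornerX hornerC; apply: leq_trans (Hk n) _.
by elim: (k) => // k' IH; rewrite expnS GRing.exprS leq_mul.
Qed.

Lemma polyb_nest_time d m B : polyb m -> polyb B ->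
  polyb (fun n => nest_time d (m n) (B n)).
Proof.
move=> Hm HB; elim: d => [//|d IH] /=.
apply: polyb_add; last by apply: polyb_add (polyb_double Hm) (polyb_const 5).
apply: polyb_add (polyb_const 1); apply: polyb_mul Hm _.
exact: polyb_add IH (polyb_const 2).
Qed.

(** * Uniqueness of the outcome of a deterministic machine *)

Section Determinism.
Variables (O : Type) (M : otm O) (D : language).
Hypothesis M_det : deterministic M.

Lemma step_det (c c1 c2 : config M) : step D c c1 -> step D c c2 -> c1 = c2.
Proof.
rewrite /step; have := M_det (cstate c).
case: (code _) => // [y n _|d /(_ (scanned c))/eqP/cards1P [a ->]].
  by case=> [[h ->]|[h ->]] [[h' ->]|[h' ->]].
by case=> a1 /set1P -> -> [a2 /set1P -> ->].
Qed.

Lemma run_halt_unique n1 n2 (c c1 c2 : config M) o1 o2 :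
  run D n1 c c1 -> code (cstate c1) = Halt _ _ _ o1 ->
  run D n2 c c2 -> code (cstate c2) = Halt _ _ _ o2 -> o1 = o2.
Proof.
have nostep (e e' : config M) o : code (cstate e) = Halt _ _ _ o -> ~ step D e e'.
  by rewrite /step => ->.
elim: n1 n2 c => [|n1 IH] [|n2] c /=.
- by move=> <- E <-; rewrite E => -[].
- by move=> <- /nostep E [c' /E].
- by move=> [c' s _] _ <- /nostep/(_ s).
- by move=> [c' s r] h1 [c'' s' r'] h2; apply: (IH n2 c') => //; rewrite (step_det s s').
Qed.

End Determinism.

(** * Simulating a machine inside another one *)

Section Simulation.
Variables (O' : Type) (M : otm O') (X : finType) (O : Type).
Let G := aux M.
Let T := (tape_index M + X)%type.
Variables (xa : X -> symbol G -> symbol G * dir) (look : frag O G T) (F : X).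
Variable fin : O' -> O + ((T -> symbol G) -> T -> symbol G * dir).

Definition sim_act (a : {ffun tape_index M -> symbol G * dir})
    (r : T -> symbol G) (j : T) : symbol G * dir :=
  match j with inl i => a i | inr k => xa k (r j) end.

(** The summands stand for a state being simulated, for a run of [look] on behalf of a query state,
    and for a query state about to resume with its answer. *)
Definition sim_state : finType := (state M + state M * fstate look + state M)%type.

(* Consulting the oracle is replaced by running [look], which leaves the answer
   on tape [F]. *)
Definition sim_code (q : sim_state) : instr O (option sim_state) G T :=
  match q with
  | inl (inl q) =>
    match code q with
    | Halt o =>
        match fin o with
        | inl o' => Halt _ _ _ o'
        | inr h => do_instr _ (fun _ => None) h
        end
    | Query _ _ =>
        do_instr _ (fun _ => Some (inl (inr (q, fstart look)))) (@stay G T)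
    | Step d =>
        Step _ (fun s : {ffun T -> symbol G} =>
          [set (Some (inl (inl a.1)), [ffun j => sim_act a.2 s j])
          | a in d [ffun i => s (inl i)]])
    end
  | inl (inr (q, s)) =>
      instr_map (fun t => Some (if t is Some s' then inl (inr (q, s')) else inr q))
                (fcode s)
  | inr q =>
    match code q with
    | Query y n =>
        do_instr _ (fun r => Some (inl (inl (if r (inr F) == bit G true then y else n))))
          (fun r j => if j == inr F then (None, Stay) else (r j, Stay))
    | _ => do_instr _ (fun _ => None) (@stay G T)
    end
  end.

Lemma sim_total q : instr_total (sim_code q).
Proof.
case: q => [[q|[q s]]|q] /=; last first.
- by case: (code q) => [o|y n|d] s; rewrite cards1.
- by apply: instr_map_total; apply: ftotal.
have := code_total q; case: (code q) => [o|y n|d] /=.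
- by case: (fin o) => // h _ s; rewrite cards1.
- by move=> _ s; rewrite cards1.
- move=> H s; have /card_gt0P [a ha] := H [ffun i => s (inl i)].
  apply/card_gt0P; exists (Some (inl (inl a.1)), [ffun j => sim_act a.2 s j]).
  by apply/imsetP; exists a.
Qed.

(** Instantiated twice: [simN] answers queries from a list and halts with the verdict, while [runK]
    counts the steps and leaves the verdict on a tape. *)
Definition simulate (q : state M) : frag O G T :=
  @Frag O G T sim_state (inl (inl q)) sim_code sim_total.

Lemma sim_free q : ffree look -> ffree (simulate q).
Proof.
move=> lf [[p|[p s]]|p] /=; first by case: (code p) => // o; case: (fin o).
  by apply: instr_map_free; apply: lf.
by case: (code p).
Qed.

Lemma sim_det q : deterministic M -> fdet look -> fdet (simulate q).
Proof.
move=> Md ld [[p|[p s]]|p] /=; last first.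
- by case: (code p) => [o|y n|d] s; rewrite cards1.
- exact: instr_map_det.
have := Md p; case: (code p) => [o|y n|d] /=.
- by case: (fin o) => // h _ s; rewrite cards1.
- by move=> _ s; rewrite cards1.
- move=> H s; have /eqP/cards1P [a ->] := H [ffun i => s (inl i)].
  by rewrite imset_set1 cards1.
Qed.

Variables (ot : T) (D : language) (QH : O -> Prop) (q0 : state M).
Notation fwin := (@fwin O G T ot D QH (simulate q0)).
Notation ex := (@ex O G T ot D QH).

Definition simtapes (c : config M) (ts : tapes G T) :=
  forall i, ts (inl i) = ntape (ctapes c i).

Definition sim_next (c : config M) (a : state M * {ffun tape_index M -> symbol G * dir})
    (ts : tapes G T) : tapes G T :=
  fun j => match j with
  | inl i => ntape (ctapes (act c a) i)
  | inr k => let b := xa k (read (ts j)) in nmove b.2 (nwrite b.1 (ts j))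
  end.

Definition at_ (q : state M) : option (fstate (simulate q0)) := Some (inl (inl q)).

Lemma sim_step m n c ts d Q : simtapes c ts -> code (cstate c) = Step _ d ->
  (exists2 a, a \in d (scanned c) & fwin m n (at_ a.1, sim_next c a ts) Q) ->
  (m -> forall a, a \in d (scanned c) -> fwin m n (at_ a.1, sim_next c a ts) Q) ->
  fwin m n.+1 (at_ (cstate c), ts) Q.
Proof.
move=> S E H1 H2.
have scE : [ffun i => ([ffun i => rd ts i] : {ffun T -> symbol G}) (inl i)] = scanned c.
  by apply/ffunP => i; rewrite !ffunE /rd S ntape_read.
have appE a : app ([ffun j => sim_act a.2 ([ffun i => rd ts i] : {ffun _ -> _}) j]
     : {ffun T -> symbol G * dir}) ts = sim_next c a ts.
  apply/funext => -[i|k]; rewrite /app ffunE /= ffunE //.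
  by rewrite S -ntape_write -ntape_move.
apply: win_step.
  have [a ha w] := H1; exists (at_ a.1, sim_next c a ts) => //.
  rewrite /fstep /= E /=; exists (at_ a.1, [ffun j => sim_act a.2 ([ffun i => rd ts i] : {ffun _ -> _}) j]).
    by apply/imsetP; exists a => //; rewrite scE.
  by rewrite /= appE.
move=> hm c'; rewrite /fstep /= E /= => -[a' /imsetP [a ha ->] ->] /=.
by rewrite appE; apply: H2 => //; rewrite -scE.
Qed.

Lemma sim_query m B n c ts y no Q : code (cstate c) = Query _ _ _ y no ->
  ex m look ts B (fun ts' =>
    fwin m n (at_ (if rd ts' (inr F) == bit G true then y else no),
              upd ts' (inr F) (nwrite None (ts' (inr F)))) Q) ->
  fwin m (B + n + 2) (at_ (cstate c), ts) Q.
Proof.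
move=> E H; rewrite addn2.
have K : fwin m (B + n.+1) (Some (inl (inr (cstate c, fstart look))), ts) Q.
  pose e s : fstate (simulate q0) := inl (inr (cstate c, s)).
  apply: (@fwin_lift O G T ot D QH look (simulate q0) e (Some (inr (cstate c)))
            _ m B n.+1 Q (Some (fstart look))).
    by move=> s /=; apply: instr_map_ext => -[].
  apply: fwin_imp H => ts' H.
  have appE : app (fun j : T => if j == inr F then (None, Stay) else (rd ts' j, Stay)) ts'
      = upd ts' (inr F) (nwrite None (ts' (inr F))).
    apply/funext => j; rewrite /app /upd; case: eqP => [->//|_] /=.
    by rewrite nwrite_read.
  apply: win_step; last move=> _ c'.
    eexists; first by rewrite /fstep /= E; apply/istep_do; reflexivity.
    by rewrite appE; exact: H.
  rewrite /fstep /= E => /istep_do ->; by rewrite appE; exact: H.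
rewrite addnS in K; apply: win_step; last move=> _ c'.
  eexists; first by rewrite /fstep /= E; apply/istep_do; reflexivity.
  by rewrite app_stay; exact: K.
rewrite /fstep /= E => /istep_do ->; by rewrite app_stay; exact: K.
Qed.

Lemma sim_exit m n c ts o h Q : code (cstate c) = Halt _ _ _ o -> fin o = inr h ->
  0 < n -> Q (app (h (rd ts)) ts) -> fwin m n (at_ (cstate c), ts) Q.
Proof.
case: n => // n E Eh _ H; apply: win_step; last move=> _ c'.
  eexists; first by rewrite /fstep /= E Eh; apply/istep_do; reflexivity.
  exact: win_ret.
rewrite /fstep /= E Eh => /istep_do ->; exact: win_ret.
Qed.

Lemma sim_halt m n c ts o o' Q : code (cstate c) = Halt _ _ _ o -> fin o = inl o' ->
  QH o' -> fwin m n (at_ (cstate c), ts) Q.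
Proof. by move=> E Eh H; apply: win_ret; rewrite /ffin /= E Eh. Qed.

End Simulation.
Arguments at_ {O' M X O xa look F fin q0} q.
Arguments sim_step {O' M X O xa look F fin ot D QH q0 m n c ts d Q}.
Arguments sim_query {O' M X O xa look F fin ot D QH q0 m} B n {c ts y no Q}.
Arguments sim_exit {O' M X O xa look F fin ot D QH q0 m n c ts o h Q}.
Arguments sim_halt {O' M X O xa look F fin ot D QH q0 m n c ts o o' Q}.

(** * Calling a deterministic machine as a subroutine *)

Section Subroutine.
Variables (K : otm bool) (X : finType) (b : nat -> nat).
Hypotheses (K_det : deterministic K) (K_free : oracle_free K).
Hypothesis K_time : forall w n c, run set0 n (init K w) c -> n <= b (size w).
Let G := aux K.
Let T : finType := (tape_index K + X)%type.
Variables (tk F : X) (tk_F : tk != F).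
Variables (ot : T) (D : language) (QH : bool -> Prop).
Notation frag := (frag bool G T).
Notation go := (@go bool G T).
Notation tapes := (tapes G T).
Notation ex := (@ex bool G T ot D QH true).
Implicit Types (ts : tapes) (Q : tapes -> Prop).

(* Every simulated step leaves a mark on tape [tk], so that the number of marks
   bounds the space used. *)
Definition tick (k : X) (s : symbol G) : symbol G * dir :=
  if k == tk then (bit G true, MoveRight) else (s, Stay).

Definition answer (o : bool) : bool + ((T -> symbol G) -> T -> symbol G * dir) :=
  inr (fun r j => if j == inr F then (bit G o, Stay) else (r j, Stay)).

Definition runK : frag :=
  simulate (X := X) tick (fhalt G T false) F answer (start K).

Lemma runK_det : fdet runK.
Proof. by apply: sim_det. Qed.

(** The number [t] counts the letters written as input and the steps simulated since; the right half
    includes the scanned cell, hence one more. *)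
Definition near (t : nat) ts := forall i : tape_index K,
  size (left_part (ts (inl i))) <= t /\ size (right_part (ts (inl i))) <= t.+1.

Definition marks (t : nat) : tape G := bits G (nseq t true) [::].

Lemma marksS t : nmove MoveRight (nwrite (bit G true) (marks t)) = marks t.+1.
Proof.
by rewrite /marks write_bits right_bits rcons_nseq.
Qed.

Lemma size_nmove_nwrite d a (t : tape G) n :
  size (left_part t) <= n -> size (right_part t) <= n.+1 ->
  size (left_part (nmove d (nwrite a t))) <= n.+1 /\
  size (right_part (nmove d (nwrite a t))) <= n.+2.
Proof.
move=> hl hr; have [hl' hr'] : size (left_part (nwrite a t)) <= n /\
    size (right_part (nwrite a t)) <= n.+1.
  rewrite /nwrite; case: ifP => // _ /=; split=> //.
  apply: leq_trans (size_bcons _ _) _; rewrite ltnS size_behead.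
  by case: (size _) hr.
have hb (s : seq (symbol G)) k : size s <= k -> size (behead s) <= k.
  by rewrite size_behead; apply: leq_trans; exact: leq_pred.
have hc x (s : seq (symbol G)) k : size s <= k -> size (bcons x s) <= k.+1.
  by move=> h; apply: leq_trans (size_bcons _ _) _.
case: d; split; rewrite /nmove /=; do ?[exact: hc | exact: leqW].
- exact/leqW/hb.
- exact/leqW/hb.
Qed.

Lemma ex_runK w t ts Q :
  simtapes (init K w) ts -> near t ts ->
  ts (inr tk) = marks t -> ts (inr F) = bits G [::] [::] ->
  (forall t' ts', t' <= t + b (size w) -> near t' ts' -> ts' (inr tk) = marks t' ->
     ts' (inr F) = bits G [::] [:: `[< accepted K set0 w >]] ->
     (forall k, k != tk -> k != F -> ts' (inr k) = ts (inr k)) -> Q ts') ->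
  ex runK ts (b (size w)).+1 Q.
Proof.
move=> S0 N0 M0 F0 HQ.
(* After [j] simulated steps [n] are left; for [n = 0] the run of [K] would be longer than its time
   bound. *)
suff H n : forall j c t' ts', j + n = (b (size w)).+1 -> run set0 j (init K w) c ->
    t' = t + j -> simtapes c ts' -> near t' ts' -> ts' (inr tk) = marks t' ->
    ts' (inr F) = bits G [::] [::] ->
    (forall k, k != tk -> k != F -> ts' (inr k) = ts (inr k)) ->
    fwin ot D QH (f := runK) true n (at_ (cstate c), ts') Q.
  by apply: (H _ 0 (init K w) t ts) => //; rewrite ?addn0.
elim: n => [|n IH] j c t' ts' Ej r Et S Nt Mt Ft Ot.
  by have := K_time r; lia.
case E: (code (cstate c)) => [o|y no|d].
- apply: (sim_exit E (erefl : answer o = inr _)) => //.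
  have -> : app (fun j => if j == inr F then (bit G o, Stay) else (rd ts' j, Stay)) ts'
      = upd ts' (inr F) (bits G [::] [:: o]).
    apply/funext => k; rewrite /app /upd; case: eqP => [->|_] /=.
      by rewrite Ft write_bits.
    by rewrite nwrite_read.
  apply: (HQ t').
  + by have := K_time r; lia.
  + by move=> i; rewrite /upd /=; apply: Nt.
  + by rewrite upd_neq.
  + rewrite upd_eq; congr (bits G [::] [:: _]).
    case: o E => E; first by apply/esym/asboolP; exists j, c.
    (* Halting with [false] excludes acceptance because a deterministic machine has a single
       outcome. *)
    apply/esym/asboolPn => -[j' [c' [r' E']]].
    by have := run_halt_unique K_det r E r' E'.
  + by move=> k k1 k2; rewrite upd_neq ?Ot.
- by have := K_free (cstate c); rewrite E.
- have nxt a : a \in d (scanned c) ->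
      fwin ot D QH (f := runK) true n (at_ a.1, sim_next tick c a ts') Q.
    move=> ha; have rn : run set0 j.+1 (init K w) (act c a).
      by apply: run_rcons r _; rewrite /step E; exists a.
    apply: (IH j.+1 (act c a) t'.+1) => //.
    + by rewrite addSnnS.
    + by rewrite Et addnS.
    + move=> i; rewrite /sim_next ctapes_act ntape_move ntape_write -S.
      by have [] := Nt i; apply: size_nmove_nwrite.
    + by rewrite /sim_next /tick eqxx Mt marksS.
    + by rewrite /sim_next /tick eq_sym (negPf tk_F) /= nwrite_read Ft.
    + move=> k k1 k2; rewrite /sim_next /tick (negPf k1) /= nwrite_read.
      exact: Ot.
  apply: (sim_step S E) => // .
  have /card_gt0P [a ha] : 0 < #|d (scanned c)|.
    by have := code_total (cstate c); rewrite E; apply.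
  by exists a => //; apply: nxt.
Qed.

Definition sweep (er : bool) (dK : dir) (ert : bool) (dT : dir) : frag :=
  fdo bool (fun r j => match j with
    | inl _ => (if er then None else r j, dK)
    | inr k => if k == tk then (if ert then None else r j, dT) else (r j, Stay)
    end).

Definition ticked (r : T -> symbol G) : bool := r (inr tk) != None.

(** Blanks may separate symbols on the tapes of [K], so only the marks show how far they extend.
    After [t] moves to the left nothing is left of the heads, and at most [2 t + 1] cells are in
    use: [t] are erased while the marks are traversed, [t] more while the marks are erased, and one
    at the end. *)
Definition cleanup : frag :=
  fseq (fseq (go (inr tk) MoveLeft)
             (fwhile ticked (sweep false MoveLeft false MoveLeft)))
  (fseq (go (inr tk) MoveRight)
  (fseq (fwhile ticked (sweep true MoveRight false MoveRight))
  (fseq (fseq (go (inr tk) MoveLeft)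
              (fwhile ticked (sweep true MoveRight true MoveLeft)))
        (sweep true MoveRight false Stay)))).

Lemma cleanup_det : fdet cleanup.
Proof.
by do ?[apply: fseq_det | apply: fwhile_det | exact: fdo_det | exact: prim_det].
Qed.

Definition cleared ts : tapes := fun j => match j with
  | inl _ => bits G [::] [::]
  | inr k => if k == tk then bits G [::] [::] else ts (inr k)
  end.

Lemma erase_right (t : tape G) : left_part t = [::] ->
  nmove MoveRight (nwrite None t) = Tape [::] (behead (right_part t)).
Proof.
case: t => l r /= ->; rewrite /nwrite; case: eqP => [e|_]; first by rewrite /nmove -e.
by rewrite /nmove /= /read /= head_bcons behead_bcons.
Qed.

Lemma ex_sweep_left t ts Q : near t ts -> ts (inr tk) = marks t ->
  (forall ts', (forall i, left_part (ts' (inl i)) = [::] /\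
       size (right_part (ts' (inl i))) <= t.*2.+1) ->
     ts' (inr tk) = Tape [::] (bcons None (map (@bit G) (nseq t true))) ->
     (forall k, k != tk -> ts' (inr k) = ts (inr k)) -> Q ts') ->
  ex (fseq (go (inr tk) MoveLeft)
       (fwhile ticked (sweep false MoveLeft false MoveLeft))) ts (t.*2 + 2) Q.
Proof.
move=> N0 M0 HQ; apply: (ex_seq 1 (t.*2 + 1)); first by lia.
apply: ex_go => //.
suff H n : forall u ts', n + u = t ->
    (forall i, size (left_part (ts' (inl i))) <= n /\
       size (right_part (ts' (inl i))) <= t.+1 + u) ->
    ts' (inr tk) = nmove MoveLeft (bits G (nseq n true) (nseq u true)) ->
    (forall k, k != tk -> ts' (inr k) = ts (inr k)) ->
    ex (fwhile ticked (sweep false MoveLeft false MoveLeft)) ts' (n.*2 + 1) Q.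
  apply: (H t 0); first by rewrite addn0.
  - by move=> i; rewrite addn0 upd_neq.
  - by rewrite upd_eq M0.
  - by move=> k k1; rewrite upd_neq.
elim: n => [|n IH] u ts' E N M Ot.
  apply: ex_while_end => //; first by rewrite /ticked /rd M /= /read /= head_bcons.
  apply: HQ => //; last by rewrite M -E.
  move=> i; have [h1 h2] := N i; split; last by lia.
  by case: (left_part _) h1.
have Z : ts' (inr tk) = bits G (nseq n true) (nseq u.+1 true).
  by rewrite M -[n.+1]addn1 nseqD cats1 left_bits.
apply: (ex_while_next 1 (n.*2 + 1)); first by lia.
  by rewrite /ticked /rd Z.
apply: ex_do => //; apply: (IH u.+1); first by lia.
- move=> i; rewrite /app /= nwrite_read; have [h1 h2] := N i; split.
    by rewrite size_behead -subn1 leq_subLR add1n.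
  by apply: leq_trans (size_bcons _ _) _; rewrite addnS ltnS.
- by rewrite /app /= eqxx nwrite_read Z.
- by move=> k k1; rewrite /app (negPf k1) nwrite_read Ot.
Qed.

Lemma ex_sweep_right t ts Q :
  (forall i, left_part (ts (inl i)) = [::] /\
       size (right_part (ts (inl i))) <= t.*2.+1) ->
  ts (inr tk) = bits G [::] (nseq t true) ->
  (forall ts', (forall i, left_part (ts' (inl i)) = [::] /\
       size (right_part (ts' (inl i))) <= t.+1) ->
     ts' (inr tk) = marks t ->
     (forall k, k != tk -> ts' (inr k) = ts (inr k)) -> Q ts') ->
  ex (fwhile ticked (sweep true MoveRight false MoveRight)) ts (t.*2 + 1) Q.
Proof.
move=> N0 M0 HQ.
suff H n : forall u ts', n + u = t ->
    (forall i, left_part (ts' (inl i)) = [::] /\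
       size (right_part (ts' (inl i))) <= t.+1 + n) ->
    ts' (inr tk) = bits G (nseq u true) (nseq n true) ->
    (forall k, k != tk -> ts' (inr k) = ts (inr k)) ->
    ex (fwhile ticked (sweep true MoveRight false MoveRight)) ts' (n.*2 + 1) Q.
  apply: (H t 0) => //; first by rewrite addn0.
  by move=> i; have [h1 h2] := N0 i; split=> //; lia.
elim: n => [|n IH] u ts' E N M Ot.
  apply: ex_while_end => //; first by rewrite /ticked /rd M.
  by apply: HQ => //; [move=> i; rewrite -[t.+1]addn0|rewrite M -E].
apply: (ex_while_next 1 (n.*2 + 1)); first by lia.
  by rewrite /ticked /rd M.
apply: ex_do => //; apply: (IH u.+1); first by lia.
- move=> i; have [h0 h] := N i.
  rewrite (_ : app _ _ _ = nmove MoveRight (nwrite None (ts' (inl i)))) //.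
  rewrite erase_right //; split=> //.
  by rewrite size_behead -subn1 leq_subLR add1n ?addnS in h *.
- rewrite /app eqxx nwrite_read M -[nseq n.+1 _]/(true :: nseq n true) right_bits.
  by rewrite rcons_nseq.
- by move=> k k1; rewrite /app (negPf k1) nwrite_read Ot.
Qed.

Lemma ex_sweep_erase t ts Q :
  (forall i, left_part (ts (inl i)) = [::] /\
       size (right_part (ts (inl i))) <= t.+1) ->
  ts (inr tk) = marks t ->
  (forall ts', (forall i, left_part (ts' (inl i)) = [::] /\
       size (right_part (ts' (inl i))) <= 1) ->
     ts' (inr tk) = bits G [::] [::] ->
     (forall k, k != tk -> ts' (inr k) = ts (inr k)) -> Q ts') ->
  ex (fseq (go (inr tk) MoveLeft)
       (fwhile ticked (sweep true MoveRight true MoveLeft))) ts (t.*2 + 2) Q.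
Proof.
move=> N0 M0 HQ; apply: (ex_seq 1 (t.*2 + 1)); first by lia.
apply: ex_go => //.
suff H n : forall ts',
    (forall i, left_part (ts' (inl i)) = [::] /\
       size (right_part (ts' (inl i))) <= n.+1) ->
    ts' (inr tk) = nmove MoveLeft (marks n) ->
    (forall k, k != tk -> ts' (inr k) = ts (inr k)) ->
    ex (fwhile ticked (sweep true MoveRight true MoveLeft)) ts' (n.*2 + 1) Q.
  apply: (H t).
  - by move=> i; rewrite upd_neq.
  - by rewrite upd_eq M0.
  - by move=> k k1; rewrite upd_neq.
elim: n => [|n IH] ts' N M Ot.
  by apply: ex_while_end => //; [rewrite /ticked /rd M|apply: HQ].
have Z : ts' (inr tk) = bits G (nseq n true) [:: true].
  by rewrite M /marks -[n.+1]addn1 nseqD cats1 left_bits.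
apply: (ex_while_next 1 (n.*2 + 1)); first by lia.
  by rewrite /ticked /rd Z.
apply: ex_do => //; apply: IH.
- move=> i; have [h0 h] := N i.
  rewrite (_ : app _ _ _ = nmove MoveRight (nwrite None (ts' (inl i)))) //.
  rewrite erase_right //; split=> //.
  by rewrite size_behead -subn1 leq_subLR add1n ?addnS in h *.
- by rewrite /app eqxx Z nwrite_blank.
- by move=> k k1; rewrite /app (negPf k1) nwrite_read Ot.
Qed.

Lemma ex_cleanup t ts Q : near t ts -> ts (inr tk) = marks t -> Q (cleared ts) ->
  ex cleanup ts (6 * t + 10) Q.
Proof.
move=> N M HQ; apply: (ex_seq (t.*2 + 2) (4 * t + 7)); first by lia.
apply: (ex_sweep_left N M) => ts1 N1 M1 O1.
apply: (ex_seq 1 (4 * t + 6)); first by lia.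
apply: ex_go => //; apply: (ex_seq (t.*2 + 1) (t.*2 + 4)); first by lia.
apply: (@ex_sweep_right t) => [i||ts2 N2 M2 O2].
- by rewrite upd_neq.
- by rewrite upd_eq M1 /nmove /= /read /= head_bcons behead_bcons.
apply: (ex_seq (t.*2 + 2) 1); first by lia.
apply: (ex_sweep_erase N2 M2) => ts3 N3 M3 O3; apply: ex_do => //.
congr (Q _): HQ; apply/funext => -[i|k].
  rewrite [RHS](_ : _ = nmove MoveRight (nwrite None (ts3 (inl i)))) //.
  have [h0 h] := N3 i; rewrite erase_right //=.
  by case: (right_part _) h => [|a [|]].
rewrite /app /=; case: eqP => [->|/eqP k1]; rewrite nwrite_read ?M3 //=.
by rewrite O3 // O2 // upd_neq // O1.
Qed.

(* Branches on the verdict of [K]; as all tapes involved are wiped, [f] and [g] are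
   entered with the tapes as they were before the input of [K] was written. *)
Definition callK (f g : frag) : frag :=
  fseq runK (fseq cleanup
    (fif (fun r => r (inr F) == bit G true)
      (fseq (erase bool G (inr F : T) Stay) f)
      (fseq (erase bool G (inr F : T) Stay) g))).

Lemma callK_det f g : fdet f -> fdet g -> fdet (callK f g).
Proof.
move=> hf hg; apply: fseq_det; first exact: runK_det.
apply: fseq_det; first exact: cleanup_det.
by apply: fif_det; apply: fseq_det => //; exact: prim_det.
Qed.

Lemma ex_callK f g w t ts B n Q :
  simtapes (init K w) ts -> near t ts ->
  ts (inr tk) = marks t -> ts (inr F) = bits G [::] [::] ->
  (accepted K set0 w -> ex f (cleared ts) B Q) ->
  (~ accepted K set0 w -> ex g (cleared ts) B Q) ->
  6 * t + 7 * b (size w) + 20 + B <= n -> ex (callK f g) ts n Q.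
Proof.
move=> S N M E Hf Hg le_n.
apply: (ex_seq (b (size w)).+1 (6 * (t + b (size w)) + 10 + B.+2)); first by lia.
apply: (ex_runK S N M E) => t' ts' le_t N' M' E' O'.
apply: (ex_seq (6 * (t + b (size w)) + 10) B.+2) => //.
apply: ex_le (_ : 6 * t' + 10 <= _) _; first by lia.
have cE : upd (cleared ts') (inr F) (bits G [::] [::]) = cleared ts.
  apply/funext => -[i|k] //; rewrite /upd /cleared; case: eqP => [[->]|/eqP k2].
    by rewrite eq_sym (negPf tk_F) E.
  by case: eqP => [//|/eqP k1]; apply: O' => //; apply: contraNneq k2 => ->.
have eF : cleared ts' (inr F) = bits G [::] [:: `[< accepted K set0 w >]].
  by rewrite /cleared eq_sym (negPf tk_F).
apply: (ex_cleanup N' M'); apply: (ex_if B.+1) => //.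
  rewrite /rd eF => /eqP [/asboolP a]; apply: (ex_seq 1 B) => //.
  by apply: ex_prim => //; rewrite eF nwrite_blank // cE; apply: Hf.
rewrite /rd eF => ne; have a : ~ accepted K set0 w.
  by move=> a; case/eqP: ne; rewrite asboolT.
apply: (ex_seq 1 B) => //.
by apply: ex_prim => //; rewrite eF nwrite_blank // cE; apply: Hg.
Qed.

Variables (V P : X).
Hypotheses (V_tk : V != tk) (P_tk : P != tk) (V_F : V != F) (P_F : P != F)
  (V_P : V != P).
Let kin : T := inl (input_tape K).

(** Every letter written on the input tape of [K] comes with a mark, which places the input inside
    the region that [cleanup] sweeps. *)
Definition kput (g : (T -> symbol G) -> symbol G) : frag :=
  fdo bool (fun r j => if j == kin then (g r, MoveRight)
    else if j == inr tk then (bit G true, MoveRight) else (r j, Stay)).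

Definition serialize : frag :=
  fseq (rew bool G (inr V : T))
  (fseq (fwhile (fun r => r (inr V) != None)
    (fseq (kput (fun _ => bit G true))
    (fseq (kput (fun r => r (inr V))) (go (inr V) MoveRight))))
  (fseq (fwhile (fun r => r (inr P) != None)
    (fseq (kput (fun _ => bit G false))
    (fseq (kput (fun _ => bit G false)) (go (inr P) MoveRight))))
  (fseq (rew bool G (inr P : T)) (rew bool G kin)))).

Lemma serialize_det : fdet serialize.
Proof.
by do ?[apply: fseq_det | apply: fwhile_det | exact: fdo_det | exact: prim_det
       | exact: rew_det].
Qed.

(* Input format of the verifier: [1c] stands for the known bit [c], and [00] for an
   unknown bit. *)
Definition code_known (v : word) : word := flatten [seq [:: true; c] | c <- v].
Definition code_unknown (r : nat) : word := flatten (nseq r [:: false; false]).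

Definition loaded (w : word) ts : tapes :=
  upd (upd ts (inr tk) (marks (size w))) kin (bits G w [::]).

Lemma loaded_upd w ts k t : k != tk ->
  upd (loaded w ts) (inr k) t = loaded w (upd ts (inr k) t).
Proof. by move=> k1; rewrite /loaded updC // (updC _ _ _ (i := inr tk)) // eq_sym. Qed.

Lemma loaded_at w ts k : k != tk -> loaded w ts (inr k) = ts (inr k).
Proof. by move=> k1; rewrite /loaded !upd_neq. Qed.

Lemma ex_kput g c w ts n Q : 0 < n -> g (rd (loaded w ts)) = bit G c ->
  Q (loaded (rcons w c) ts) -> ex (kput g) (loaded w ts) n Q.
Proof.
move=> n0 Eg HQ; apply: ex_do => //; congr (Q _): HQ; rewrite Eg.
apply/funext => j; rewrite /app /rd /loaded /upd.
case: (j =P kin) => [_|_].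
  by rewrite [(_, _).1]/= [(_, _).2]/= write_bits right_bits.
case: (j =P _) => [_|_].
  by rewrite [(_, _).1]/= [(_, _).2]/= size_rcons marksS.
by rewrite nwrite_read.
Qed.

Lemma size_code_known v : size (code_known v) = (size v).*2.
Proof. by elim: v => //= c u; rewrite doubleS => <-. Qed.

Lemma size_code_unknown r : size (code_unknown r) = r.*2.
Proof. by elim: r => //= r; rewrite doubleS => <-. Qed.

Lemma code_known_rcons v c :
  code_known (rcons v c) = rcons (rcons (code_known v) true) c.
Proof. by rewrite /code_known map_rcons flatten_rcons -!cats1 -catA. Qed.

Lemma code_unknownS v r :
  v ++ code_unknown r.+1 = rcons (rcons v false) false ++ code_unknown r.
Proof. by rewrite !cat_rcons. Qed.

Lemma ex_serialize v r ts n Q :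
  ts kin = bits G [::] [::] -> ts (inr tk) = bits G [::] [::] ->
  ts (inr P) = bits G [::] (nseq r true) -> ts (inr V) = bits G v [::] ->
  let w := code_known v ++ code_unknown r in
  20 * (size v + r) + 40 <= n ->
  Q (upd (upd ts (inr tk) (marks (size w))) kin (bits G [::] w)) ->
  ex serialize ts n Q.
Proof.
move=> Ek Et Ep Ev; set w := _ ++ _ => /= le_n HQ.
have l0 ts' : ts' kin = bits G [::] [::] -> ts' (inr tk) = bits G [::] [::] ->
    ts' = loaded [::] ts' by move=> h1 h2; rewrite /loaded !upd_idE.
apply: (ex_seq ((size v).*2 + 5) (18 * (size v + r) + 35)); first by lia.
apply: (@ex_rew _ _ _ _ _ _ _ _ _ v [::]) => //; rewrite cats0.
rewrite (l0 (upd ts _ _)) ?upd_neq //; last by rewrite eq_sym.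
apply: (ex_seq (4 * size v + 1) (14 * (size v + r) + 34)); first by lia.
suff H l1 : forall l2, ex (fwhile (fun r => r (inr V) != None)
    (fseq (kput (fun _ => bit G true))
    (fseq (kput (fun r => r (inr V))) (go (inr V) MoveRight))))
    (loaded (code_known l2) (upd ts (inr V) (bits G l2 l1))) (4 * size l1 + 1)
    (fun ts' => ts' = loaded (code_known (l2 ++ l1))
                        (upd ts (inr V) (bits G (l2 ++ l1) [::]))).
  apply: ex_imp (H v [::]) => ts' -> {H ts'}; rewrite cat0s -Ev upd_id.
  apply: (ex_seq (4 * r + 1) (10 * (size v + r) + 33)); first by lia.
  suff H r1 : forall r2 u, ex (fwhile (fun r => r (inr P) != None)
      (fseq (kput (fun _ => bit G false))
      (fseq (kput (fun _ => bit G false)) (go (inr P) MoveRight))))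
      (loaded u (upd ts (inr P) (bits G (nseq r2 true) (nseq r1 true)))) (4 * r1 + 1)
      (fun ts' => ts' = loaded (u ++ code_unknown r1)
                  (upd ts (inr P) (bits G (nseq (r2 + r1) true) [::]))).
    rewrite -{1}[ts](upd_id _ (inr P)) Ep.
    apply: ex_imp (H r 0 (code_known v)) => ts' ->; rewrite add0n -/w.
    apply: (ex_seq (r.*2 + 5) (8 * (size v + r) + 28)); first by lia.
    apply: (@ex_rew _ _ _ _ _ _ _ _ _ (nseq r true) [::]).
    - by rewrite loaded_at // upd_eq.
    - by rewrite size_nseq.
    rewrite cats0 loaded_upd // upd_upd -Ep upd_id.
    apply: (@ex_rew _ _ _ _ _ _ _ _ _ w [::]).
    - by rewrite /loaded upd_eq.
    - by rewrite size_cat size_code_known size_code_unknown; lia.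
    by rewrite cats0 /loaded upd_upd.
  elim: r1 => [|r1 IH] r2 u.
    apply: ex_while_end => //; first by rewrite /rd loaded_at // upd_eq.
    by rewrite addn0 cats0.
  apply: (ex_while_next 3 (4 * r1 + 1)); first by lia.
    by rewrite /rd loaded_at // upd_eq.
  apply: (ex_seq 1 2) => //; apply: (ex_kput (c := false)) => //.
  apply: (ex_seq 1 1) => //; apply: (ex_kput (c := false)) => //.
  apply: ex_go => //; rewrite loaded_at // upd_eq loaded_upd // upd_upd.
  rewrite -[nseq r1.+1 _]/(true :: nseq r1 true) right_bits.
  have := IH r2.+1 (rcons (rcons u false) false).
  by rewrite code_unknownS addSnnS rcons_nseq.
elim: l1 => [|c l1 IH] l2.
  apply: ex_while_end => //; first by rewrite /rd loaded_at // upd_eq.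
  by rewrite cats0.
apply: (ex_while_next 3 (4 * size l1 + 1)); first by rewrite /=; lia.
  by rewrite /rd loaded_at // upd_eq.
apply: (ex_seq 1 2) => //; apply: (ex_kput (c := true)) => //.
apply: (ex_seq 1 1) => //; apply: (ex_kput (c := c)) => //.
  by rewrite /rd loaded_at // upd_eq.
apply: ex_go => //; rewrite loaded_at // upd_eq loaded_upd // upd_upd right_bits.
by rewrite -code_known_rcons -cat_rcons; exact: IH.
Qed.

Definition askK (f g : frag) : frag := fseq serialize (callK f g).

Lemma askK_det f g : fdet f -> fdet g -> fdet (askK f g).
Proof.
by move=> hf hg; apply: fseq_det; [exact: serialize_det|exact: callK_det].
Qed.

Lemma ex_askK f g v r ts B n Q :
  (forall i, ts (inl i) = bits G [::] [::]) -> ts (inr tk) = bits G [::] [::] ->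
  ts (inr F) = bits G [::] [::] ->
  ts (inr P) = bits G [::] (nseq r true) -> ts (inr V) = bits G v [::] ->
  let w := code_known v ++ code_unknown r in
  (accepted K set0 w -> ex f ts B Q) -> (~ accepted K set0 w -> ex g ts B Q) ->
  40 * (size v + r) + 7 * b ((size v + r).*2) + 60 + B <= n ->
  ex (askK f g) ts n Q.
Proof.
move=> Ek Et Ef Ep Ev w Hf Hg le_n.
have sw : size w = (size v + r).*2.
  by rewrite size_cat size_code_known size_code_unknown doubleD.
apply: (ex_seq (20 * (size v + r) + 40) (6 * size w + 7 * b (size w) + 20 + B)).
  by rewrite sw; lia.
apply: (ex_serialize (Ek _) Et Ep Ev) => //.
set ts1 := upd _ _ _.
have cE : cleared ts1 = ts.
  apply/funext => -[i|k]; first by rewrite /cleared Ek.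
  rewrite /cleared /ts1; case: eqP => [->//|/eqP k1].
  by rewrite !upd_neq.
apply: (@ex_callK _ _ w (size w)); rewrite ?cE //.
- move=> i; rewrite /ts1 /= ffunE; case: eqP => [->|/eqP ne].
    by rewrite upd_eq /ntape /= norm_bits.
  by rewrite !upd_neq ?Ek.
- move=> i; rewrite /ts1; have [->|ne] := eqVneq (inl i) kin.
    by rewrite upd_eq /= !size_map.
  by rewrite !upd_neq ?Ek.
- by rewrite /ts1 upd_neq // upd_eq.
- by rewrite /ts1 upd_neq // upd_neq // eq_sym.
- exact: Hf.
- exact: Hg.
Qed.

End Subroutine.

(** * The nondeterministic verifier *)

Section Guess.
Variables (O : Type) (G T : finType) (ot : T).
Variables (D : language) (QH : O -> Prop).

Definition fguess (i : T) : frag O G T.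
Proof.
refine (@Frag O G T unit tt (fun _ => Step _ (fun s : {ffun T -> symbol G} =>
  [set (None, [ffun j => if j == i then (bit G b, MoveRight) else (s j, Stay)])
  | b : bool])) _).
move=> _ s; apply/card_gt0P.
exists (None, [ffun j => if j == i then (bit G true, MoveRight) else (s j, Stay)]).
by apply/imsetP; exists true.
Defined.

Lemma fguess_free i : ffree (fguess i). Proof. by []. Qed.

Lemma ex_guess m i ts n (Q : tapes G T -> Prop) : 0 < n ->
  (if m then forall b, Q (upd ts i (nmove MoveRight (nwrite (bit G b) (ts i))))
   else exists b, Q (upd ts i (nmove MoveRight (nwrite (bit G b) (ts i))))) ->
  ex ot D QH m (fguess i) ts n Q.
Proof.
case: n => // n _ H.
have appE b : app ([ffun j => if j == i then (bit G b, MoveRight)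
      else (([ffun i => rd ts i] : {ffun T -> symbol G}) j, Stay)]
      : {ffun T -> symbol G * dir}) ts =
    upd ts i (nmove MoveRight (nwrite (bit G b) (ts i))).
  apply/funext => j; rewrite /app /upd !ffunE; case: eqP => [->//|_].
  by rewrite nwrite_read.
have [b Hb] : exists b, Q (upd ts i (nmove MoveRight (nwrite (bit G b) (ts i)))).
  by case: m H => // H; exists true.
apply: win_step.
  exists (None, upd ts i (nmove MoveRight (nwrite (bit G b) (ts i)))); last exact: win_ret.
  rewrite /fstep /= -appE; eexists; first by apply/imsetP; exists b.
  by [].
move=> hm c'; rewrite hm /= in H; rewrite /fstep /= => -[a /imsetP [b' _ ->] ->].
by rewrite /= appE; apply: win_ret; exact: H.
Qed.

End Guess.

Definition pairok (w : word) (b : bool) := nth false w 0 -> b = nth false w 1.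

(* [compl w cs]: the columns [cs] result from the input [w] by filling in unknown
   bits; a missing bit at the end of [w] is read as [0]. *)
Fixpoint compl (w : word) (cs : seq column) : Prop :=
  if cs is (b1, b2) :: cs' then
    [/\ w != [::], pairok w b1, pairok (drop 2 w) b2 & compl (drop 4 w) cs']
  else w = [::].

Lemma compl_size w cs : compl w cs -> size cs <= size w.
Proof.
elim: cs w => //= -[b1 b2] cs IH w [w0 _ _ /IH]; rewrite size_drop.
by case: w w0 => //= a w _; lia.
Qed.

Section Verifier.
Variable N : otm outcome.
Let G := aux N.
Let X : finType := 'I_6.
Let T : finType := (tape_index N + X)%type.
(* Tapes besides those of [N]: the input, the two tracks of the column list, a copy
   of the query, its answer, and a mismatch flag. *)
Definition vIn : X := @Ordinal 6 0 isT.
Definition v1 : X := @Ordinal 6 1 isT.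
Definition v2 : X := @Ordinal 6 2 isT.
Definition vY : X := @Ordinal 6 3 isT.
Definition vF : X := @Ordinal 6 4 isT.
Definition vM : X := @Ordinal 6 5 isT.
Let ot : T := inr v1.
Notation x_ k := (inr k : T).
Variables (D : language) (QH : bool -> Prop).
Notation frag := (frag bool G T).
Notation tapes := (tapes G T).
Notation ex := (@ex bool G T ot D QH).
Notation go := (@go bool G T).
Notation cpy := (@cpy bool G T).
Notation put := (@put bool G T).
Notation erase := (@erase bool G T).
Notation rew := (@rew bool G T).
Notation clear := (@clear bool G T).
Notation bits := (bits G).
Implicit Types (ts : tapes) (Q : tapes -> Prop).

Definition pairstep (i : T) : frag :=
  fseq (fif (fun r => r (x_ vIn) == bit G true)
    (fseq (go (x_ vIn) MoveRight)
       (prim bool i (fun r => bit G (r (x_ vIn) == bit G true)) MoveRight))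
    (fseq (go (x_ vIn) MoveRight) (fguess bool G i)))
  (go (x_ vIn) MoveRight).

Lemma ex_pairstep m (i : T) w ts n Q : i != x_ vIn ->
  right_part (ts (x_ vIn)) = map (@bit G) w ->
  let next b := upd (upd ts (x_ vIn)
       (nmove MoveRight (nmove MoveRight (ts (x_ vIn))))) i
       (nmove MoveRight (nwrite (bit G b) (ts i))) in
  3 < n ->
  (if m then forall b, pairok w b -> Q (next b)
   else exists2 b, pairok w b & Q (next b)) ->
  ex m (pairstep i) ts n Q.
Proof.
move=> ne Ew next n3 H.
apply: (ex_seq 3 1) => //.
have h0 : (rd ts (x_ vIn) == bit G true) = nth false w 0.
  by rewrite /rd /read Ew; case: (w) => [|[]].
have h1 : (rd (upd ts (x_ vIn) (nmove MoveRight (ts (x_ vIn)))) (x_ vIn) == bit G true)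
    = nth false w 1.
  by rewrite /rd /read upd_eq /= Ew; case: (w) => [|a [|[]]].
have nextE b : upd (upd (upd ts (x_ vIn) (nmove MoveRight (ts (x_ vIn)))) i
      (nmove MoveRight (nwrite (bit G b) (ts i)))) (x_ vIn)
      (nmove MoveRight (nmove MoveRight (ts (x_ vIn)))) = next b.
  by rewrite updC // upd_upd.
apply: (ex_if 2) => //; rewrite h0 => hw.
  apply: (ex_seq 1 1) => //; apply: ex_go => //; apply: ex_prim => //.
  rewrite h1 upd_neq //; apply: ex_go => //.
  rewrite (upd_neq _ _ (i := i) (j := x_ vIn)) 1?eq_sym // upd_eq nextE.
  by case: m H => [|[b]] H; [apply: H|move=> Hn; rewrite -H].
apply: (ex_seq 1 1) => //; apply: ex_go => //; apply: ex_guess => //.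
have ok b : pairok w b by move=> h; rewrite h in hw.
case: m H => [H b|[b _ H]]; last exists b.
  rewrite upd_neq //; apply: ex_go => //.
  by rewrite (upd_neq _ _ (i := i) (j := x_ vIn)) 1?eq_sym // upd_eq nextE; apply: H.
rewrite upd_neq //; apply: ex_go => //.
by rewrite (upd_neq _ _ (i := i) (j := x_ vIn)) 1?eq_sym // upd_eq nextE.
Qed.

Definition deser : frag :=
  fwhile (fun r => r (x_ vIn) != None)
    (fseq (pairstep (x_ v1)) (pairstep (x_ v2))).

Lemma deser_free : ffree deser.
Proof. by rewrite /deser /pairstep; free_tac; exact: fguess_free. Qed.

(** The predicate [P] treats both modes at once: with the constantly true predicate all completions
    are covered, with equality to a given list the guesses are steered towards that list. *)
Lemma ex_deser m w ts0 (P : seq column -> Prop) ts l n Q :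
  right_part (ts (x_ vIn)) = map (@bit G) w ->
  ts (x_ v1) = bits (map fst l) [::] -> ts (x_ v2) = bits (map snd l) [::] ->
  (forall j, j != x_ vIn -> j != x_ v1 -> j != x_ v2 -> ts j = ts0 j) ->
  (if m then forall cs, compl w cs -> P cs else exists2 cs, compl w cs & P cs) ->
  10 * size w + 1 <= n ->
  (forall cs t, compl w cs -> P cs ->
     Q (upd (upd (upd ts0 (x_ vIn) t) (x_ v1) (bits (map fst (l ++ cs)) [::]))
           (x_ v2) (bits (map snd (l ++ cs)) [::]))) ->
  ex m deser ts n Q.
Proof.
have [k] := ubnP (size w).
elim: k => // k IH in w P ts l n Q * => lt_k Ew E1 E2 Eo HP le_n HQ.
have [w0|w0] := eqVneq w [::].
  apply: ex_while_end; first by lia.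
    by rewrite /rd /read Ew w0.
  have P0 : P [::].
    case: (m) HP => [|[cs]]; first by apply; rewrite w0.
    by rewrite w0; case: cs => [|[b1 b2] cs] // [].
  have := HQ [::] (ts (x_ vIn)); rewrite w0 cats0 => /(_ erefl P0).
  congr Q; apply/funext => j; rewrite /upd; case: eqP => [->//|/eqP j2].
  by case: eqP => [->//|/eqP j1]; case: eqP => [->//|/eqP j0]; rewrite Eo.
apply: (ex_while_next 8 (10 * size (drop 4 w) + 1)).
- apply: leq_trans le_n; rewrite size_drop.
  by case: (w) w0 => //= a w' _; lia.
- by rewrite /rd /read Ew; case: (w) w0.
apply: (ex_seq 4 4) => //; apply: (ex_pairstep (w := w)) => //.
pose next1 b := upd (upd ts (x_ vIn)
  (nmove MoveRight (nmove MoveRight (ts (x_ vIn))))) (x_ v1)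
  (nmove MoveRight (nwrite (bit G b) (ts (x_ v1)))).
have K b1 : pairok w b1 ->
   (if m then forall b2 cs, pairok (drop 2 w) b2 -> compl (drop 4 w) cs -> P ((b1, b2) :: cs)
    else exists b2 cs, [/\ pairok (drop 2 w) b2, compl (drop 4 w) cs & P ((b1, b2) :: cs)]) ->
   ex m (pairstep (x_ v2)) (next1 b1) 4 (fun ts' => ex m deser ts' (10 * size (drop 4 w) + 1) Q).
  move=> ok1 HP1; apply: (ex_pairstep (w := drop 2 w)) => //.
    by rewrite /next1 upd_neq // upd_eq /= Ew; case: (w) => [|a [|a' w']] //=; rewrite drop0.
  have L b2 : pairok (drop 2 w) b2 ->
    (if m then forall cs, compl (drop 4 w) cs -> P ((b1, b2) :: cs)
     else exists2 cs, compl (drop 4 w) cs & P ((b1, b2) :: cs)) ->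
    ex m deser (upd (upd (next1 b1) (x_ vIn)
       (nmove MoveRight (nmove MoveRight (next1 b1 (x_ vIn))))) (x_ v2)
       (nmove MoveRight (nwrite (bit G b2) (next1 b1 (x_ v2)))))
      (10 * size (drop 4 w) + 1) Q.
    move=> ok2 HP2.
    apply: (IH (drop 4 w) (fun cs => P ((b1, b2) :: cs)) _ (rcons l (b1, b2))) => //.
    - by rewrite size_drop; case: (w) w0 lt_k => //= a w' _; lia.
    - rewrite upd_neq // upd_eq /next1 upd_neq // upd_eq /= Ew.
      by case: (w) => [|? [|? [|? [|? w']]]] //=; rewrite drop0.
    - by rewrite upd_neq // upd_neq // /next1 upd_eq E1 write_bits right_bits map_rcons.
    - by rewrite upd_eq /next1 !upd_neq // E2 write_bits right_bits map_rcons.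
    - by move=> j j0 j1 j2; rewrite upd_neq // upd_neq // /next1 upd_neq // upd_neq // Eo.
    - by move=> cs t H1 H2; rewrite cat_rcons; apply: HQ.
  case: (m) HP1 L => [HP1 L b2 ok2|[b2 [cs [ok2 H1 H2]]] L].
    by apply: L => // cs; apply: HP1.
  by exists b2 => //; apply: L => //; exists cs.
case: (m) HP K => [HP K b1 ok1|[[|[b1 b2] cs] /= H1 H2] K].
- by apply: K => // b2 cs ok2 H; apply: HP.
- by rewrite H1 in w0.
- by case: H1 => _ ok1 ok2 H; exists b1 => //; apply: K => //; exists b2, cs.
Qed.

Let nin : T := inl (input_tape N).

Definition copy_act (r : T -> symbol G) (j : T) : symbol G * dir :=
  if j == nin then (r (x_ v2), MoveRight)
  else if (j == x_ v1) || (j == x_ v2) then (r j, MoveRight) else (r j, Stay).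

Definition copystep : frag := fdo bool copy_act.

Definition prep : frag :=
  fseq (rew (x_ v1)) (fseq (rew (x_ v2))
  (fseq (fwhile (fun r => r (x_ v1) == bit G true) copystep)
  (fseq (rew nin) (fseq (rew (x_ v1)) (rew (x_ v2)))))).

Lemma prep_free : ffree prep.
Proof. by rewrite /prep /copystep; free_tac. Qed.

Definition columns (cs : seq column) ts : tapes :=
  upd (upd ts (x_ v1) (bits [::] (map fst cs))) (x_ v2) (bits [::] (map snd cs)).

Lemma size_leading cs : size (leading cs) <= size cs.
Proof. by elim: cs => // -[[] b] cs. Qed.

Lemma ex_prep m cs ts n Q :
  ts (x_ v1) = bits (map fst cs) [::] -> ts (x_ v2) = bits (map snd cs) [::] ->
  ts nin = bits [::] [::] -> 20 * size cs + 50 <= n ->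
  Q (columns cs (upd ts nin (bits [::] (leading cs)))) -> ex m prep ts n Q.
Proof.
move=> E1 E2 En le_n HQ.
have sl := size_leading cs.
apply: (ex_seq (2 * size cs + 5) (18 * size cs + 45)); first by lia.
apply: (@ex_rew _ _ _ _ _ _ _ _ _ (map fst cs) [::]) => //.
  by rewrite size_map; lia.
apply: (ex_seq (2 * size cs + 5) (16 * size cs + 40)); first by lia.
apply: (@ex_rew _ _ _ _ _ _ _ _ _ (map snd cs) [::]) => //.
  by rewrite size_map; lia.
rewrite !cats0.
apply: (ex_seq (4 * size cs + 1) (12 * size cs + 39)); first by lia.
pose st (l c : seq column) := upd (upd (upd ts (x_ v1) (bits (map fst l) (map fst c)))
  (x_ v2) (bits (map snd l) (map snd c))) nin (bits (map snd l) [::]).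
suff H c : forall l, ex m (fwhile (fun r => r (x_ v1) == bit G true) copystep)
   (st l c) (2 * size c + 1) (fun ts' => exists l' r,
     [/\ l ++ c = l' ++ r, map snd l' = map snd l ++ leading c & ts' = st l' r]).
  have st0 : st [::] cs = upd (upd ts (x_ v1) (bits [::] (map fst cs)))
      (x_ v2) (bits [::] (map snd cs)) by rewrite /st upd_idE.
  rewrite -st0; apply: ex_le (_ : 2 * size cs + 1 <= _) _; first by lia.
  apply: ex_imp (H cs [::]) => ts' [l' [r [/= Er El ->]]].
  have sl' : size l' = size (leading cs) by rewrite -(size_map snd) El.
  apply: (ex_seq (2 * size cs + 5) (10 * size cs + 34)); first by lia.
  apply: (@ex_rew _ _ _ _ _ _ _ _ _ (map snd l') [::]).
  - by rewrite /st upd_eq.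
  - by rewrite size_map; lia.
  rewrite cats0 El.
  apply: (ex_seq (2 * size cs + 5) (8 * size cs + 29)); first by lia.
  apply: (@ex_rew _ _ _ _ _ _ _ _ _ (map fst l') (map fst r)).
  - by rewrite upd_neq // /st upd_neq // upd_neq // upd_eq.
  - by rewrite size_map; lia.
  apply: (@ex_rew _ _ _ _ _ _ _ _ _ (map snd l') (map snd r)).
  - by rewrite upd_neq // upd_neq // /st upd_neq // upd_eq.
  - by rewrite size_map; lia.
  congr (Q _): HQ; rewrite -!map_cat -Er /columns /st.
  apply/funext => j; rewrite /upd.
  by case: (j =P x_ v2) => [//|_]; case: (j =P x_ v1) => [//|_]; case: (j =P nin).
elim: c => [|[t b] c IH] l.
  apply: ex_while_end => //.
  by exists l, [::]; rewrite ?cats0.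
case: t; last first.
  apply: ex_while_end => //.
  by exists l, ((false, b) :: c); rewrite ?cats0.
apply: (ex_while_next 1 (2 * size c + 1)); first by rewrite /=; lia.
  by rewrite /rd /st upd_neq // upd_neq // upd_eq.
apply: ex_do => //.
have -> : app (copy_act (rd (st l ((true, b) :: c)))) (st l ((true, b) :: c)) =
    st (rcons l (true, b)) c.
  apply/funext => j; rewrite /app /copy_act /rd.
  have [->|j0] := eqVneq j nin.
    rewrite [(_, _).2]/= [(_, _).1]/= /st !upd_eq (upd_neq _ _ (i := nin)) // upd_eq.
    by rewrite -[read _]/(bit G b) write_bits right_bits map_rcons.
  have [->|j1] := eqVneq j (x_ v1).
    rewrite nwrite_read /st !(upd_neq _ _ (i := nin)) // !(upd_neq _ _ (i := x_ v2)) //.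
    by rewrite !upd_eq right_bits map_rcons.
  have [->|j2] := eqVneq j (x_ v2).
    rewrite nwrite_read /st !(upd_neq _ _ (i := nin)) //.
    by rewrite !upd_eq right_bits map_rcons.
  by rewrite nwrite_read /st !upd_neq.
apply: ex_imp (IH (rcons l (true, b))) => ts' [l' [r [e1 e2 e3]]].
by exists l', r; rewrite -e1 cat_rcons e2 map_rcons cat_rcons.
Qed.

Definition isbit (a : symbol G) := if a is Some (inl _) then true else false.

Lemma bit_prefixP (s : seq (symbol G)) :
  exists2 s', s = map (@bit G) (bit_prefix s) ++ s' & ~~ isbit (head None s').
Proof.
elim: s => [|a s [s' E h]]; first by exists [::].
case: a => [[c|g]|] /=; [|by exists (Some (inr g) :: s)|by exists (None :: s)].
by exists s' => //; rewrite {1}E.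
Qed.

Let qO : T := inl (oracle_tape N).

(** The oracle tape of [N] may hold symbols on both sides of the query, so no blank shows where the
    head has to return to; the copy, having the same length, counts the moves back. *)
Definition copyq : frag :=
  fseq (fwhile (fun r => isbit (r qO))
          (fseq (cpy qO (x_ vY) MoveRight) (go qO MoveRight)))
  (fseq (go (x_ vY) MoveLeft)
  (fseq (fwhile (fun r => r (x_ vY) != None)
          (fseq (go qO MoveLeft) (go (x_ vY) MoveLeft)))
        (go (x_ vY) MoveRight))).

Lemma ex_copyq m ts n Q : ts (x_ vY) = bits [::] [::] ->
  let q := query_word (ts qO) in 10 * size q + 10 <= n ->
  Q (upd ts (x_ vY) (bits [::] q)) -> ex m copyq ts n Q.
Proof.
move=> EY q le_n HQ.
have [s' Es hs'] := bit_prefixP (right_part (ts qO)).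
rewrite -[bit_prefix _]/q in Es.
pose OT q1 q2 : tape G := Tape (map (@bit G) (rev q1) ++ left_part (ts qO))
  (map (@bit G) q2 ++ s').
have O0 : ts qO = OT [::] q by rewrite /OT -Es /=; case: (ts qO).
pose st q1 q2 y := upd (upd ts qO (OT q1 q2)) (x_ vY) y.
have stO q1 q2 y : st q1 q2 y qO = OT q1 q2 by rewrite /st upd_neq // upd_eq.
have stY q1 q2 y : st q1 q2 y (x_ vY) = y by rewrite /st upd_eq.
have st_O q1 q2 y q3 q4 : upd (st q1 q2 y) qO (OT q3 q4) = st q3 q4 y.
  by rewrite /st updC // upd_upd.
have st_Y q1 q2 y y' : upd (st q1 q2 y) (x_ vY) y' = st q1 q2 y'.
  by rewrite /st upd_upd.
have right_OT q1 c q2 : nmove MoveRight (OT q1 (c :: q2)) = OT (rcons q1 c) q2.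
  by rewrite /OT rev_rcons.
have left_OT q1 c q2 : nmove MoveLeft (OT (rcons q1 c) q2) = OT q1 (c :: q2).
  by rewrite /OT rev_rcons.
apply: (ex_seq (3 * size q + 1) (5 * size q + 9)); first by lia.
suff H q2 : forall q1, q1 ++ q2 = q -> ex m (fwhile (fun r => isbit (r qO))
     (fseq (cpy qO (x_ vY) MoveRight) (go qO MoveRight))) (st q1 q2 (bits q1 [::]))
     (3 * size q2 + 1) (fun ts' => ts' = st q [::] (bits q [::])).
  rewrite (_ : ts = st [::] q (bits [::] [::])); last first.
    by rewrite /st !upd_idE // upd_neq.
  apply: ex_imp (H q [::] erefl) => ts' ->.
  apply: (ex_seq 1 (5 * size q + 8)); first by lia.
  apply: ex_go => //; rewrite st_Y stY.
  apply: (ex_seq (3 * size q + 1) 1); first by lia.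
  suff H' q1 : forall q2, q1 ++ q2 = q -> ex m (fwhile (fun r => r (x_ vY) != None)
      (fseq (go qO MoveLeft) (go (x_ vY) MoveLeft)))
      (st q1 q2 (nmove MoveLeft (bits q1 q2))) (3 * size q1 + 1)
      (fun ts' => ts' = st [::] q (nmove MoveLeft (bits [::] q))).
    apply: ex_imp (H' q [::] _) => [ts2 ->|]; last by rewrite cats0.
    apply: ex_go => //; rewrite st_Y stY; congr (Q _): HQ.
    rewrite /st -O0 upd_id; congr upd.
    by rewrite /nmove /= /read /= head_bcons behead_bcons.
  elim/last_ind: q1 => [|q1 c IH] q2 Eq.
    apply: ex_while_end => //; last by rewrite -Eq.
    by rewrite /rd stY /nmove /= /read /= head_bcons.
  rewrite left_bits.
  apply: (ex_while_next 2 (3 * size q1 + 1)).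
  - by rewrite size_rcons; lia.
  - by rewrite /rd stY.
  apply: (ex_seq 1 1) => //; apply: ex_go => //; rewrite stO left_OT st_O.
  apply: ex_go => //; rewrite st_Y stY.
  by apply: IH; rewrite -cat_rcons.
elim: q2 => [|c q2 IH] q1 Eq.
  by apply: ex_while_end => //; rewrite ?/rd ?stO // -Eq cats0.
apply: (ex_while_next 2 (3 * size q2 + 1)).
- by rewrite /=; lia.
- by rewrite /rd stO.
apply: (ex_seq 1 1) => //; apply: ex_prim => //; rewrite /rd stO stY st_Y.
rewrite -[read _]/(bit G c) write_bits right_bits.
apply: ex_go => //; rewrite stO right_OT st_O.
by apply: IH; rewrite cat_rcons.
Qed.

Definition scanstep : frag :=
  fseq (fif (fun r => r (x_ v1) == bit G true)
    (fif (fun r => (r (x_ vM) == None) && (r (x_ vY) == r (x_ v2)))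
       (go (x_ vY) MoveRight) (put (x_ vM) true Stay))
    (fif (fun r => (r (x_ vM) == None) && (r (x_ vY) == None))
       (cpy (x_ v2) (x_ vF) Stay) (fseq (erase (x_ vM) Stay) (rew (x_ vY)))))
  (fseq (go (x_ v1) MoveRight) (go (x_ v2) MoveRight)).

(** The loop ends as soon as [vF] holds an answer, which realizes the first-match semantics of
    [lookup]. *)
Definition scan : frag :=
  fwhile (fun r => (r (x_ v1) != None) && (r (x_ vF) == None)) scanstep.

(* Tape [vM] is marked when the word read so far is no prefix of the query. *)
Definition scanning (q cur : word) ts : Prop :=
  (ts (x_ vM) = bits [::] [::] /\ exists2 r, q = cur ++ r & ts (x_ vY) = bits cur r)
  \/ [/\ ts (x_ vM) = bits [::] [:: true], ~~ prefix cur q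
      & exists d r, d ++ r = q /\ ts (x_ vY) = bits d r].

Definition at_columns (l c : seq column) ts : Prop :=
  ts (x_ v1) = bits (map fst l) (map fst c) /\
  ts (x_ v2) = bits (map snd l) (map snd c).

Definition lookup_tape (o : option bool) : tape G :=
  bits [::] (if o is Some b then [:: b] else [::]).

Definition same_but_scan ts ts' : Prop := forall j,
  [&& j != x_ v1, j != x_ v2, j != x_ vY, j != x_ vM & j != x_ vF] -> ts' j = ts j.

Lemma erase_stay (s : word) : size s <= 1 ->
  nmove Stay (nwrite None (bits [::] s)) = bits [::] [::].
Proof. by case: s => [|a [|]] // _; rewrite /= nwrite_blank. Qed.

Lemma ex_scan m q cs : forall l cur ts n Q,
  at_columns l cs ts -> ts (x_ vF) = bits [::] [::] -> scanning q cur ts ->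
  size cs * (2 * size q + 20) + 1 <= n ->
  (forall ts', (exists l' c', l' ++ c' = l ++ cs /\ at_columns l' c' ts') ->
     (exists d r, d ++ r = q /\ ts' (x_ vY) = bits d r) ->
     (exists2 s, size s <= 1 & ts' (x_ vM) = bits [::] s) ->
     ts' (x_ vF) = lookup_tape (lookup (parse cur cs) q) ->
     same_but_scan ts ts' -> Q ts') ->
  ex m scan ts n Q.
Proof.
elim: cs => [|[t b] cs IH] l cur ts n Q [E1 E2] EF S le_n HQ.
  apply: ex_while_end; [by lia|by rewrite /rd E1|]; apply: HQ => //.
  - by exists l, [::].
  - case: S => [[_ [r -> ->]]|[_ _ H]] //; by exists cur, r.
  - by case: S => [[-> _]|[-> _ _]]; [exists [::]|exists [:: true]].
apply: (ex_while_next (2 * size q + 18) (size cs * (2 * size q + 20) + 1)).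
- by move: le_n => /=; rewrite mulSn; lia.
- by rewrite /rd E1 EF.
apply: (ex_seq (2 * size q + 16) 2); first by lia.
pose adv ts' := upd (upd ts' (x_ v1) (bits (rcons (map fst l) t) (map fst cs)))
  (x_ v2) (bits (rcons (map snd l) b) (map snd cs)).
have adv_at ts' : at_columns (rcons l (t, b)) cs (adv ts').
  by split; rewrite /adv !(upd_eq, upd_neq) // map_rcons.
have adv_ne ts' j : j != x_ v1 -> j != x_ v2 -> adv ts' j = ts' j.
  by move=> j1 j2; rewrite /adv !upd_neq.
have K ts' Q' : at_columns l ((t, b) :: cs) ts' -> Q' (adv ts') ->
    ex m (fseq (go (x_ v1) MoveRight) (go (x_ v2) MoveRight)) ts' 2 Q'.
  move=> [e1 e2] h; apply: (ex_seq 1 1) => //; apply: ex_go => //.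
  by apply: ex_go => //; rewrite upd_neq // e1 e2 !right_bits.
have next ts' cur' : at_columns l ((t, b) :: cs) ts' ->
    ts' (x_ vF) = bits [::] [::] -> scanning q cur' ts' ->
    lookup (parse cur' cs) q = lookup (parse cur ((t, b) :: cs)) q ->
    same_but_scan ts ts' ->
    ex m (fseq (go (x_ v1) MoveRight) (go (x_ v2) MoveRight)) ts' 2
      (fun ts'' => ex m scan ts'' (size cs * (2 * size q + 20) + 1) Q).
  move=> At F0 S' El sb; apply: K => //.
  apply: (IH (rcons l (t, b)) cur') => //.
  - move=> ts2; rewrite El cat_rcons => h1 h2 h3 h4 h5; apply: HQ => // j hj.
    have /and5P [j1 j2 _ _ _] := hj.
    by rewrite h5 // adv_ne // sb.
apply: (ex_if (2 * size q + 15)); first by lia.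
  rewrite /rd E1 => /eqP [Et]; subst t.
  apply: (ex_if 1); first by lia.
    rewrite /rd; case: S => [[EM [r Eq EY]]|[-> //]].
    rewrite EM EY E2 => /andP [_ /eqP]; case: r Eq EY => [//|c r] Eq EY [Ec]; subst c.
    apply: ex_go => //; apply: (next _ (rcons cur b)).
    + by split; rewrite upd_neq.
    + by rewrite upd_neq.
    + left; split; first by rewrite upd_neq.
      by exists r; [rewrite cat_rcons|rewrite upd_eq EY right_bits].
    + by [].
    + by move=> j /and5P [_ _ j3 _ _]; rewrite upd_neq.
  rewrite /rd => nomatch; apply: ex_prim => //; apply: (next _ (rcons cur b)).
  + by split; rewrite upd_neq.
  + by rewrite upd_neq.
  + right; split.
    * by rewrite upd_eq; case: S => [[-> _]|[-> _ _]]; rewrite /= write_bits.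
    * case: S nomatch => [[-> [r Eq ->]]|[_ np _] _]; last first.
        by apply: contra np; apply: prefix_trans; rewrite -cats1 prefix_prefix.
      rewrite E2 /= => ne; apply/negP => /prefixP [s' Es].
      move: Es; rewrite Eq cat_rcons => /eqP; rewrite eqseq_cat // eqxx /=.
      by move=> /eqP Er; rewrite Er eqxx in ne.
    * rewrite upd_neq //; case: S => [[_ [r Eq EY]]|[_ _ //]].
      by exists cur, r.
  + by [].
  + by move=> j /and5P [_ _ _ j4 _]; rewrite upd_neq.
rewrite /rd E1 => Et; have {}Et : t = false by move: Et; case: (t).
subst t.
apply: (ex_if (2 * size q + 14)); first by lia.
  rewrite /rd; case: S => [[EM [r Eq EY]]|[-> //]].
  rewrite EM EY => /andP [_ /eqP]; case: r Eq EY => [|//] Eq EY _.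
  apply: ex_prim; first by lia.
  apply: K; first by split; rewrite upd_neq.
  rewrite /rd E2 EF -[read _]/(bit G b) write_bits.
  apply: ex_while_end; first by lia.
    by rewrite andbC /rd adv_ne // upd_eq.
  apply: HQ.
  - by exists (rcons l (false, b)), cs; rewrite cat_rcons; split=> //; apply: adv_at.
  - by exists cur, [::]; rewrite adv_ne // upd_neq.
  - by exists [::] => //; rewrite adv_ne // upd_neq.
  - by rewrite adv_ne // upd_eq /= Eq cats0 eqxx.
  - by move=> j /and5P [j1 j2 _ _ j5]; rewrite adv_ne // upd_neq.
rewrite /rd => nomatch.
(* At an end column without a match, either letters of the query remain or the word read is no
   prefix of it. *)
have ncur : (cur == q) = false.
  case: S nomatch => [[-> [r Eq ->]]|[_ np _] _].
    by case: r Eq => [|c r] // -> _; apply/eqP => /(congr1 size); rewrite size_cat /=; lia.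
  by apply: contraNF np => /eqP ->; rewrite prefix_refl.
have [d [r [Eq EY]]] : exists d r, d ++ r = q /\ ts (x_ vY) = bits d r.
  by case: S => [[_ [r Eq EY]]|[_ _ //]]; exists cur, r.
apply: (ex_seq 1 (2 * size q + 13)); first by lia.
apply: ex_prim => //.
have -> : nmove Stay (nwrite None (ts (x_ vM))) = bits [::] [::].
  by case: S => [[-> _]|[-> _ _]]; rewrite erase_stay.
apply: (@ex_rew _ _ _ _ _ _ _ _ _ d r).
- by rewrite upd_neq.
- by rewrite -Eq size_cat; lia.
apply: (next _ [::]).
- by split; rewrite !upd_neq.
- by rewrite !upd_neq.
- left; rewrite upd_neq // upd_eq; split=> //; exists q => //.
  by rewrite upd_eq Eq.
- by rewrite /= ncur.
- by move=> j /and5P [_ _ j3 j4 _]; rewrite !upd_neq.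
Qed.

(** A query that the list does not answer ends the path with rejection, mirroring the absence of a
    [pstep]. After an answer everything but [vF] is restored, so that the next query scans the list
    afresh. *)
Definition look : frag :=
  fseq copyq (fseq scan (fseq (rew (x_ v1)) (fseq (rew (x_ v2))
  (fseq (rew (x_ vY)) (fseq (clear (x_ vY)) (fseq (erase (x_ vM) Stay)
  (fif (fun r => r (x_ vF) == None) (fhalt G T false) (fdo bool (@stay G T))))))))).

Lemma look_free : ffree look.
Proof.
rewrite /look /copyq /scan /scanstep; free_tac.
by move=> q.
Qed.

Definition ready cs ts : Prop :=
  [/\ at_columns [::] cs ts, ts (x_ vY) = bits [::] [::],
      ts (x_ vF) = bits [::] [::] & ts (x_ vM) = bits [::] [::]].

Definition look_time (k s : nat) := (k + 1) * (2 * s + 20) + 4 * k + 20 * s + 60.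

Lemma ex_look m cs ts n Q : ready cs ts ->
  let q := query_word (ts qO) in
  look_time (size cs) (size q) <= n ->
  (forall b, lookup (parse [::] cs) q = Some b ->
     Q (upd ts (x_ vF) (bits [::] [:: b]))) ->
  (lookup (parse [::] cs) q = None -> QH false) ->
  ex m look ts n Q.
Proof.
move=> [At EY EF EM] q; rewrite /look_time => le_n H1 H2.
set A := size cs * (2 * size q + 20).
have EA : (size cs + 1) * (2 * size q + 20) = A + (2 * size q + 20).
  by rewrite mulnDl mul1n.
rewrite {}EA in le_n.
apply: (ex_seq (10 * size q + 10) (A + 4 * size cs + 12 * size q + 50)); first by lia.
apply: ex_copyq => //.
apply: (ex_seq (A + 1) (4 * size cs + 12 * size q + 49)); first by lia.
apply: (@ex_scan _ q cs [::] [::]).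
- by case: At => e1 e2; split; rewrite upd_neq.
- by rewrite upd_neq.
- by left; split; [rewrite upd_neq|exists q; rewrite ?upd_eq].
- exact: leqnn.
move=> ts1 [l [c [Elc [e1 e2]]]] [d [r [Edr eY]]] [s s1 eM] eF sb.
have szl : size l <= size cs by rewrite -[cs]Elc size_cat; lia.
have szd : size d <= size q by rewrite -Edr size_cat; lia.
apply: (ex_seq (2 * size cs + 5) (2 * size cs + 12 * size q + 44)); first by lia.
apply: (@ex_rew _ _ _ _ _ _ _ _ _ (map fst l) (map fst c)) => //.
  by rewrite size_map; lia.
apply: (ex_seq (2 * size cs + 5) (12 * size q + 39)); first by lia.
apply: (@ex_rew _ _ _ _ _ _ _ _ _ (map snd l) (map snd c)) => //.
  by rewrite size_map; lia.
apply: (ex_seq (2 * size q + 5) (10 * size q + 34)); first by lia.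
apply: (@ex_rew _ _ _ _ _ _ _ _ _ d r); [by rewrite !upd_neq|by lia|].
apply: (ex_seq (2 * size q + 1) (8 * size q + 33)); first by lia.
apply: (@ex_clear _ _ _ _ _ _ _ _ _ (d ++ r)); [by rewrite upd_eq|by rewrite Edr; lia|].
apply: (ex_seq 1 (8 * size q + 32)); first by lia.
apply: ex_prim => //; rewrite !upd_neq // eM erase_stay // upd_upd.
set ts2 := upd _ (x_ vM) _.
have E2 : ts2 = upd ts (x_ vF) (lookup_tape (lookup (parse [::] cs) q)).
  apply/funext => j.
  have [->|jF] := eqVneq j (x_ vF); first by rewrite /ts2 !(upd_eq, upd_neq).
  rewrite [RHS]upd_neq //.
  have [->|jM] := eqVneq j (x_ vM); first by rewrite /ts2 upd_eq EM.
  have [->|jY] := eqVneq j (x_ vY); first by rewrite /ts2 upd_neq // upd_eq EY.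
  have [->|j2] := eqVneq j (x_ v2).
    by rewrite /ts2 !(upd_eq, upd_neq) // -map_cat Elc; case: At.
  have [->|j1] := eqVneq j (x_ v1).
    by rewrite /ts2 !(upd_eq, upd_neq) // -map_cat Elc; case: At.
  rewrite /ts2 !upd_neq // sb; last by rewrite j1 j2 jY jM.
  by rewrite upd_neq.
apply: (ex_if 1); first by lia.
  rewrite E2 /rd upd_eq => h; apply: ex_halt; apply: H2.
  by case: lookup h.
rewrite E2 /rd upd_eq => h; apply: ex_do => //; rewrite app_stay.
by case: lookup h H1 => [b|] // _; apply.
Qed.

End Verifier.

(** * Correctness and running time of the verifier *)

Section VerifierMachine.
Variables (N : otm outcome) (b : nat -> nat).
Hypothesis N_time : forall D x n c, run D n (init N x) c -> n <= b (size x).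
Hypothesis b_mono : {homo b : m n / m <= n}.
Let G := aux N.
Let T : finType := (tape_index N + 'I_6)%type.
Notation x_ k := (inr k : T).
Let ot : T := inr v1.

Definition idle (k : 'I_6) (a : symbol G) : symbol G * dir := (a, Stay).

Definition simN : frag bool G T :=
  simulate (X := 'I_6) idle (look N) vF
    (fun o => inl (if o is acc then true else false)) (start N).

Definition verify : frag bool G T := fseq (deser N) (fseq (prep N) simN).

Lemma vIn_v1 : x_ vIn != x_ v1. Proof. by []. Qed.

Definition verifier : otm bool := machine vIn_v1 false verify.

Lemma verifier_free : oracle_free verifier.
Proof.
suff H : ffree verify by move=> [q|] //; apply: H.
apply: fseq_free; [exact: deser_free|apply: fseq_free; first exact: prep_free].
by apply: sim_free; exact: look_free.
Qed.

Lemma ready_next cs (c : config N) a ts : ready cs ts ->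
  ready cs (sim_next (X := 'I_6) idle c a ts).
Proof. by rewrite /ready /at_columns /sim_next /= !nwrite_read. Qed.

(** A path answered by the list is a path under the oracle of all words listed as positive. Since
    the time bound of [N] holds for every oracle, it applies even when the guessed answers are
    wrong. *)
Lemma query_word_size l x j (c : config N) : prun l j (init N x) c ->
  size (query_word (ctapes c (oracle_tape N))) <= (b (size x)).*2.
Proof.
move=> r; have {}r : run (fun q => lookup l q = Some true) j (init N x) c.
  by apply: prun_run r => q [] ->.
apply: leq_trans (size_bit_prefix _) _.
apply: leq_trans (size_right_run (oracle_tape N) r) _.
rewrite /= ffunE eq_sym (negPf (input_neq_oracle N)) /= add0n leq_double.
exact: N_time r.
Qed.

Lemma look_time_le k s s' : s <= s' -> look_time k s <= look_time k s'.
Proof.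
by move=> le_s; rewrite /look_time; have := leq_mul (leqnn (k + 1)) le_s; nia.
Qed.

(** Each simulated step extends a [prun], whose length is at most [b (size x)]; the induction is on
    the number of steps left. The charge per step allows for the look-up of a longest possible
    query. *)
Lemma fwin_simN D cs x c ts j n Q :
  let l := parse [::] cs in
  ready cs ts -> simtapes c ts -> prun l j (init N x) c ->
  (b (size x) - j).+1 * (look_time (size cs) (b (size x)).*2 + 3) <= n ->
  fwin ot D (fun o => o = true -> cert N x cs) (f := simN) true n
    (at_ (cstate c), ts) Q.
Proof.
move=> l; set t := look_time _ _.
have bound j' c' : prun l j' (init N x) c' -> j' <= b (size x).
  move=> r; apply: (@N_time (fun q => lookup l q = Some true)).
  by apply: prun_run r => q [] ->.
move E: (b (size x) - j) => d.
elim/ltn_ind: d j c ts n E => d IH j c ts n E Rd S r le_n.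
have le_t : t + 3 <= n by move: le_n; rewrite mulSn; lia.
have nxt c1 ts1 : pstep l c c1 -> ready cs ts1 -> simtapes c1 ts1 ->
    fwin ot D (fun o => o = true -> cert N x cs) (f := simN) true (n - (t + 3))
      (at_ (cstate c1), ts1) Q.
  move=> s R1 S1; have r1 := prun_rcons r s; have b1 := bound _ _ r1.
  case: d IH E le_n => [|d] IH E le_n; first by lia.
  by apply: (IH d _ j.+1) => //; [lia|move: le_n; rewrite mulSn; lia].
rewrite -(subnKC le_t); move: (n - (t + 3)) nxt => n1 nxt {le_n le_t IH E}.
case E: (code (cstate c)) => [o|y no|dl].
- by apply: (sim_halt E erefl); case: o E => // E _; exists j, c.
- rewrite (_ : t + 3 + n1 = t + n1.+1 + 2); last by lia.
  apply: (sim_query t n1.+1 E); apply: (@ex_look N D _ true cs) => //.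
    by rewrite S ntape_query; apply: look_time_le; exact: query_word_size r.
  move=> a; rewrite S ntape_query => Ea.
  rewrite /rd upd_eq upd_upd.
  rewrite upd_idE; last by case: Rd.
  have -> : (read (bits G [::] [:: a]) == bit G true) = a by case: (a).
  apply: win_le (leqnSn _) _.
  apply: (nxt (Config (if a then y else no) (ctapes c))) => //.
  by rewrite /pstep E; exists a.
- have nx a : a \in dl (scanned c) -> fwin ot D (fun o => o = true -> cert N x cs)
      (f := simN) true (t + 2 + n1) (at_ a.1, sim_next idle c a ts) Q.
    move=> ha; apply: (@win_le _ _ _ _ n1); first by lia.
    apply: (nxt (act c a)) => //; first by rewrite /pstep E; exists a.
    exact: (ready_next c a Rd).
  rewrite (_ : t + 3 + n1 = (t + 2 + n1).+1); last by lia.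
  apply: (sim_step S E) => //.
  have /card_gt0P [a ha] : 0 < #|dl (scanned c)|.
    by have := code_total (cstate c); rewrite E; apply.
  by exists a => //; apply: nx.
Qed.

(** Only the existence of an accepting path is at stake, so the budget [B] may be arbitrary; the
    running time is controlled by the statement about all paths. *)
Lemma may_simN D cs n c c' Q :
  prun (parse [::] cs) n c c' -> code (cstate c') = Halt _ _ _ acc ->
  exists B, forall ts, ready cs ts -> simtapes c ts ->
    fwin ot D (fun o => o = true) (f := simN) false B (at_ (cstate c), ts) Q.
Proof.
elim: n c => [|n IH] c.
  by move=> <- E; exists 0 => ts _ _; apply: (sim_halt E erefl).
move=> [c1 s r] h; have [B HB] := IH c1 r h.
move: s; rewrite /pstep; case E: (code (cstate c)) => [//|y no|dl].
- move=> [a Ea Ec1].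
  exists (look_time (size cs) (size (query_word (ctapes c (oracle_tape N)))) + B + 2).
  move=> ts Rd S; apply: (sim_query _ B E).
  apply: (@ex_look N D _ false cs _ _ _ Rd) => [|a'|]; rewrite S ntape_query ?Ea //.
  move=> -[<-]; rewrite /rd upd_eq upd_upd.
  rewrite upd_idE; last by case: Rd.
  have -> : (read (bits G [::] [:: a]) == bit G true) = a by case: (a).
  by rewrite Ec1 in HB; apply: HB.
- move=> [a ha Ec1]; exists B.+1 => ts Rd S; apply: (sim_step S E) => //.
  exists a => //; rewrite Ec1 in HB; apply: (HB (sim_next idle c a ts)) => //.
  exact: ready_next.
Qed.

Definition verify_time (m : nat) :=
  10 * m + 1 + (20 * m + 50 + (b m).+1 * (look_time m (b m).*2 + 3)).

Lemma ntapes_init w : ntapes (init verifier w) =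
  upd (fun _ => bits G [::] [::]) (x_ vIn) (bits G [::] w).
Proof.
apply/funext => j; rewrite /ntapes /= ffunE /upd; case: eqP => _ //.
by rewrite /ntape /= norm_bits.
Qed.

Lemma prepared w cs t (ts := upd (fun _ => bits G [::] [::]) (x_ vIn) (bits G [::] w)) :
  let ts1 := columns cs (upd (upd (upd (upd ts (x_ vIn) t)
     (x_ v1) (bits G (map fst cs) [::])) (x_ v2) (bits G (map snd cs) [::]))
     (inl (input_tape N)) (bits G [::] (leading cs))) in
  ready cs ts1 /\ simtapes (init N (leading cs)) ts1.
Proof.
split=> // i; rewrite /columns !(upd_neq _ _ (i := x_ _)) //= ffunE /upd.
have [->|ne] := eqVneq i (input_tape N).
  by rewrite eqxx /ntape /= norm_bits.
by case: eqP => // -[] e; rewrite e eqxx in ne.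
Qed.

Lemma win_verify D w :
  fwin ot D (fun o => o = true -> exists2 cs, compl w cs & cert N (leading cs) cs)
    (f := verify) true (verify_time (size w))
    (Some (fstart verify), ntapes (init verifier w)) (@none G T).
Proof.
rewrite ntapes_init; set ts := upd _ _ _.
apply: (ex_seq (10 * size w + 1) _ (leqnn _)).
apply: (@ex_deser _ _ _ _ w ts (fun _ => True) ts [::]) => // cs t Hcs _.
have le_cs := compl_size Hcs.
apply: (ex_seq (20 * size w + 50) _ (leqnn _)).
apply: (@ex_prep _ _ _ _ cs) => //; first by rewrite !leq_add2r leq_mul2l le_cs orbT.
have [Rd S] := prepared w cs t.
have r0 : prun (parse [::] cs) 0 (init N (leading cs)) (init N (leading cs)) by [].
have := @fwin_simN D cs (leading cs) (init N (leading cs)) _ 0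
  ((b (size w)).+1 * (look_time (size w) (b (size w)).*2 + 3)) (@none G T) Rd S r0.
move=> /(_ _) H; apply: fwin_outcome (H _).
  by move=> o h e; exists cs => //; apply: h.
have le_b : b (size (leading cs)) <= b (size w).
  by apply: b_mono; apply: leq_trans (size_leading _) le_cs.
rewrite subn0; apply: leq_mul; first by rewrite ltnS.
rewrite leq_add2r /look_time; have := leq_mul le_cs le_b.
have : (b (size (leading cs))).*2 <= (b (size w)).*2 by rewrite leq_double.
move: (_.*2) (_.*2) => p p' le_p _.
have := leq_mul le_cs le_p; nia.
Qed.

(** Soundness is read off the statement about all paths; for completeness the verifier guesses the
    given completion and follows the given path. *)
Lemma accepted_verifier w : accepted verifier set0 w <->
  exists2 cs, compl w cs & cert N (leading cs) cs.
Proof.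
split=> [[n [c [r h]]]|[cs Hcs [n [c [r h]]]]].
  exact: (run_halt r (win_verify _ w) h erefl).
have [B HB] : exists B, fwin ot set0 (fun o => o = true) (f := verify) false B
    (Some (fstart verify), ntapes (init verifier w)) (@none G T).
  rewrite ntapes_init; set ts := upd _ _ _.
  have [B HB] := may_simN set0 (@none G T) r h.
  exists (10 * size w + 1 + (20 * size cs + 50 + B)).
  apply: (ex_seq (10 * size w + 1) _ (leqnn _)).
  apply: (@ex_deser _ _ _ _ w ts (eq cs) ts [::]) => //; first by exists cs.
  move=> cs' t _ <-; apply: (ex_seq (20 * size cs + 50) _ (leqnn _)).
  by apply: (@ex_prep _ _ _ _ cs) => //; have [] := prepared w cs t; apply: HB.
have [n' [c' [o [r' h' E]]]] := @fwin_halts _ _ _ _ _ vIn_v1 false verify _ _ _ (init verifier w) _ HB.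
by exists n', c'; split=> //; rewrite h' E.
Qed.

Lemma verifier_time D w n c : run D n (init verifier w) c ->
  n <= verify_time (size w).
Proof. by move=> r; apply: (run_bound r (win_verify _ w)). Qed.

End VerifierMachine.

(** * The deterministic oracle machine *)

Fixpoint flat (cs : seq column) : word :=
  if cs is (b1, b2) :: cs' then [:: b1, b2 & flat cs'] else [::].

Lemma size_flat cs : size (flat cs) = (size cs).*2.
Proof. by elim: cs => // -[b1 b2] cs /= ->. Qed.

Lemma flat_cat cs cs' : flat (cs ++ cs') = flat cs ++ flat cs'.
Proof. by elim: cs => // -[b1 b2] cs /= ->. Qed.

Lemma flat_split cs a u : flat cs = flat a ++ u ->
  exists2 u', cs = a ++ u' & flat u' = u.
Proof.
elim: a cs => [|[a1 a2] a IH] [|[b1 b2] cs] //= E; try by [exists [::]|exists ((b1, b2) :: cs)].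
by case: E => -> -> /IH [u' -> <-]; exists u'.
Qed.

(** A column takes two bits, so an even total makes the code end at a column boundary; otherwise the
    second bit of the last column would be a free guess in addition to the [r] unknown ones. *)
Lemma compl_code v r cs : ~~ odd (size v + r) ->
  compl (code_known v ++ code_unknown r) cs <->
  exists2 u, size u = r & flat cs = v ++ u.
Proof.
elim: cs v r => [|[b1 b2] cs IH] v r ev.
  split=> [|[u su]].
    by case: v ev => // ev; case: r ev => // ev _; exists [::].
  by case: v ev => // ev; case: u su => // <-.
case: v ev => [|a1 [|a2 v]] ev.
- case: r ev => [|[|r]] // ev.
    by split=> [[]//|[[|? ?]]].
  rewrite /= negbK in ev; split.
    move=> [_ _ _]; rewrite /code_unknown /= !drop0 => /(IH [::] _ ev).
    by move=> [u su /= ->]; exists [:: b1, b2 & u]; rewrite //= su.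
  move=> [[|c1 [|c2 u]] //= [su] [-> -> e]]; split=> //; rewrite /= !drop0.
  by apply/(IH [::]) => //; exists u.
- case: r ev => [//|r] ev; rewrite /= !negbK in ev; split.
    move=> [_ /= /(_ isT) -> _]; rewrite drop0 => /(IH [::] _ ev).
    by move=> [u su /= ->]; exists (b2 :: u); rewrite //= su.
  move=> [[|c u] //= [su] [-> -> e]]; split=> //; rewrite /= drop0.
  by apply/(IH [::]) => //; exists u.
- rewrite /= !negbK in ev; split.
    move=> [_ /= /(_ isT) -> /(_ isT) ->]; rewrite drop0 => /(IH _ _ ev).
    by move=> [u su ->]; exists u.
  move=> [u su [-> -> e]]; split=> //; rewrite /= drop0.
  by apply/IH => //; exists u.
Qed.

Lemma bit_prefix_bits (G : finType) (w : word) : bit_prefix (map (@bit G) w) = w.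
Proof. by elim: w => //= c w ->. Qed.

Section OracleMachine.
Variables (N : otm outcome) (K : otm bool) (b : nat -> nat) (d : nat).
Hypotheses (K_det : deterministic K) (K_free : oracle_free K).
Hypothesis K_time : forall w n c, run set0 n (init K w) c -> n <= b (size w).
Hypothesis K_accepts : forall w,
  accepted K set0 w <-> exists2 cs, compl w cs & cert N (leading cs) cs.
Hypothesis b_mono : {homo b : m n / m <= n}.
Let G := aux K.
Let X : finType := ('I_6 + 'I_d * bool)%type.
Let T : finType := (tape_index K + X)%type.
Notation y_ k := (inl k : X).
Notation x_ k := (inr (inl k) : T).
(* Tapes besides those of [K]: the input, the oracle tape, the known bits of the
   list, one mark per unknown bit, the verdict of [K], and a step counter for [K].
   The tapes in ['I_d * bool] hold [size x + 2] marks each and drive two nests of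
   [d] loops. *)
Definition uIn : 'I_6 := @Ordinal 6 0 isT.
Definition uO : 'I_6 := @Ordinal 6 1 isT.
Definition uV : 'I_6 := @Ordinal 6 2 isT.
Definition uP : 'I_6 := @Ordinal 6 3 isT.
Definition uF : 'I_6 := @Ordinal 6 4 isT.
Definition uT : 'I_6 := @Ordinal 6 5 isT.
Let ot : T := x_ uO.
Variables (D : language) (QH : bool -> Prop).
Notation frag := (frag bool G T).
Notation tapes := (tapes G T).
Notation ex := (@ex bool G T ot D QH true).
Notation go := (@go bool G T).
Notation cpy := (@cpy bool G T).
Notation put := (@put bool G T).
Notation erase := (@erase bool G T).
Notation rew := (@rew bool G T).
Notation clear := (@clear bool G T).
Notation bits := (bits G).
Implicit Types (ts : tapes) (Q : tapes -> Prop).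

Definition skip : frag := fdo bool (@stay G T).

Lemma ex_skip ts n Q : 0 < n -> Q ts -> ex skip ts n Q.
Proof. by move=> n0 H; apply: ex_do => //; rewrite app_stay. Qed.

Definition truthstep : frag :=
  fif (fun r => r (x_ uV) == bit G true)
    (fseq (go (x_ uV) MoveRight)
       (fseq (cpy (x_ uV) (x_ uO) MoveRight) (go (x_ uV) MoveRight)))
    (fseq (go (x_ uV) MoveRight) (fseq (rew (x_ uO))
       (fseq (fask (put (x_ uV) true Stay) (put (x_ uV) false Stay))
          (fseq (clear (x_ uO)) (go (x_ uV) MoveRight))))).

(** The letters of an unfinished last word are on the oracle tape when the loop ends, hence the
    final rewinding and clearing. *)
Definition truthify : frag :=
  fseq (rew (x_ uV)) (fseq (fwhile (fun r => r (x_ uV) != None) truthstep)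
    (fseq (rew (x_ uO)) (clear (x_ uO)))).

Definition truth_time (s : nat) := s * (4 * s + 20) + 10 * s + 30.

Lemma ex_truthify cs ts n Q :
  ts (x_ uV) = bits (flat cs) [::] -> ts (x_ uO) = bits [::] [::] ->
  truth_time (size cs) <= n ->
  Q (upd ts (x_ uV) (bits (flat (truth D [::] cs)) [::])) -> ex truthify ts n Q.
Proof.
rewrite /truth_time => EV EO le_n HQ.
set s := size cs in le_n; set A := s * (4 * s + 20) in le_n.
apply: (ex_seq (4 * s + 5) (A + 6 * s + 25)); first by lia.
apply: (@ex_rew _ _ _ _ _ _ _ _ _ (flat cs) [::]) => //.
  by rewrite size_flat; lia.
rewrite cats0.
pose st l c cur := upd (upd ts (x_ uV) (bits l (flat c))) (x_ uO) (bits cur [::]).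
have stV l c cur : st l c cur (x_ uV) = bits l (flat c) by [].
have stO l c cur : st l c cur (x_ uO) = bits cur [::] by [].
have st_V l c cur t : upd (st l c cur) (x_ uV) t =
    upd (upd ts (x_ uV) t) (x_ uO) (bits cur [::]).
  by rewrite /st updC // upd_upd.
have -> : upd ts (x_ uV) (bits [::] (flat cs)) = st [::] cs [::].
  by rewrite /st [RHS]upd_idE // upd_neq.
apply: (ex_seq (A + 1) (6 * s + 20)); first by lia.
suff H c : forall l cur, size cur + size c <= s ->
    ex (fwhile (fun r => r (x_ uV) != None) truthstep) (st l c cur)
      (size c * (4 * s + 20) + 1)
      (fun ts' => exists2 cur', size cur' <= s &
         ts' = st (l ++ flat (truth D cur c)) [::] cur').
  apply: ex_imp (H cs [::] [::] (leqnn _)) => ts' [cur le_cur ->].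
  apply: (ex_seq (2 * s + 5) (2 * s + 1)); first by lia.
  apply: (@ex_rew _ _ _ _ _ _ _ _ _ cur [::]) => //; first by lia.
  apply: (@ex_clear _ _ _ _ _ _ _ _ _ cur); [by rewrite upd_eq cats0|by lia|].
  congr (Q _): HQ; rewrite /st !upd_upd cat0s.
  by rewrite (upd_idE (i := x_ uO)) // upd_neq.
elim: c => [|[t a] c IH] l cur le_s.
  apply: ex_while_end => //; exists cur; first by move: le_s; rewrite addn0.
  by rewrite cats0.
apply: (ex_while_next (4 * s + 19) (size c * (4 * s + 20) + 1)).
- by rewrite -[size (_ :: _)]/((size c).+1) mulSn; lia.
- by [].
have {}le_s : size cur + (size c).+1 <= s := le_s.
case: t.
  apply: (ex_if 3); [by lia|move=> _|by []].
  apply: (ex_seq 1 2) => //; apply: ex_go => //; rewrite stV st_V.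
  set l1 := nmove _ _; have El1 : l1 = bits (rcons l true) (a :: flat c).
    by rewrite /l1 /flat right_bits.
  rewrite {l1}El1; apply: (ex_seq 1 1) => //; apply: ex_prim => //.
  rewrite -[rd _ _]/(bit G a) upd_eq write_bits right_bits upd_upd.
  apply: ex_go => //; rewrite updC // upd_upd upd_neq // upd_eq right_bits.
  have := IH (rcons (rcons l true) a) (rcons cur a).
  rewrite !cat_rcons; apply.
  by rewrite size_rcons addSnnS.
apply: (ex_if (4 * s + 18)); [by lia|by []|move=> _].
apply: (ex_seq 1 (4 * s + 17)); first by lia.
apply: ex_go => //; rewrite stV st_V.
set l1 := nmove _ _; have El1 : l1 = bits (rcons l false) (a :: flat c).
  by rewrite /l1 /flat right_bits.
have le_cur : size cur <= s by lia.
rewrite {l1}El1; apply: (ex_seq (2 * s + 5) (2 * s + 12)); first by lia.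
apply: (@ex_rew _ _ _ _ _ _ _ _ _ cur [::]); [by rewrite upd_eq|by lia|].
rewrite cats0 upd_upd.
apply: (ex_seq 2 (2 * s + 10)); first by lia.
have K1 a' : a' = `[< D cur >] -> 
  ex (fseq (clear (x_ uO)) (go (x_ uV) MoveRight))
   (upd (upd (upd ts (x_ uV) (bits (rcons l false) (a :: flat c)))
            (x_ uO) (bits [::] cur)) (x_ uV)
        (nmove Stay (nwrite (bit G a') (bits (rcons l false) (a :: flat c)))))
   (2 * s + 10) (fun ts' => ex (fwhile (fun r => r (x_ uV) != None) truthstep) ts'
      (size c * (4 * s + 20) + 1) (fun ts' => exists2 cur', size cur' <= s &
         ts' = st (l ++ flat (truth D cur ((false, a) :: c))) [::] cur')).
  move=> Ea; rewrite write_bits updC // upd_upd.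
  apply: (ex_seq (2 * s + 1) 1); first by lia.
  apply: (@ex_clear _ _ _ _ _ _ _ _ _ cur); [by rewrite upd_eq|by lia|].
  rewrite upd_upd; apply: ex_go => //.
  rewrite upd_neq // upd_eq updC // upd_upd right_bits.
  have := IH (rcons (rcons l false) a') [::].
  rewrite !cat_rcons Ea; by apply; rewrite add0n; lia.
have qE : query_word (upd (upd ts (x_ uV) (bits (rcons l false) (a :: flat c)))
    (x_ uO) (bits [::] cur) ot) = cur.
  by rewrite upd_eq /query_word bit_prefix_bits.
apply: (ex_ask 1) => //; rewrite qE => hD.
  by apply: ex_prim => //; rewrite upd_neq // upd_eq; apply: K1; rewrite asboolT.
by apply: ex_prim => //; rewrite upd_neq // upd_eq; apply: K1; rewrite asboolF.
Qed.

Definition ask (f g : frag) : frag := askK (y_ uT) (y_ uF) (y_ uV) (y_ uP) f g.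

(** Prefix search fixes single bits, so the question put to [K] is phrased with bits: [v] may end
    inside a column. *)
Definition acceptable (v : word) (r : nat) : Prop :=
  exists2 u, size u = r &
    exists2 cs, flat cs = v ++ u & cert N (leading cs) cs.

Lemma accepts_code v r : ~~ odd (size v + r) ->
  accepted K set0 (code_known v ++ code_unknown r) <-> acceptable v r.
Proof.
move=> ev; rewrite K_accepts; split.
  by move=> [cs /(compl_code _ ev) [u su Eu] h]; exists u => //; exists cs.
by move=> [u su [cs Eu h]]; exists cs => //; apply/compl_code => //; exists u.
Qed.

Definition clean ts : Prop :=
  [/\ forall i, ts (inl i) = bits [::] [::], ts (x_ uT) = bits [::] [::]
    & ts (x_ uF) = bits [::] [::]].

Definition ask_time (s : nat) := 40 * s + 7 * b s.*2 + 60.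

Lemma ex_ask_acceptable f g v r ts B n Q : clean ts ->
  ts (x_ uP) = bits [::] (nseq r true) -> ts (x_ uV) = bits v [::] ->
  ~~ odd (size v + r) ->
  (acceptable v r -> ex f ts B Q) -> (~ acceptable v r -> ex g ts B Q) ->
  ask_time (size v + r) + B <= n -> ex (ask f g) ts n Q.
Proof.
move=> [c1 c2 c3] EP EV ev Hf Hg le_n.
apply: (ex_askK K_det K_free K_time _ _ _ _ _ _ c1 c2 c3 EP EV _ _ le_n) => //.
  by move/(accepts_code ev)/Hf.
by move=> h; apply: Hg => /(accepts_code ev).
Qed.

Definition search : frag :=
  fwhile (fun r => r (x_ uP) != None)
    (fseq (erase (x_ uP) MoveRight) (fseq (put (x_ uV) true MoveRight)
      (ask skip (fseq (go (x_ uV) MoveLeft) (put (x_ uV) false MoveRight))))).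

(** One question per bit suffices: some extension exists, so if [true] fails as the next bit then
    [false] succeeds. The total number [s] of known and unknown bits stays fixed, which keeps it
    even and makes all questions equally expensive. *)
Lemma ex_search s r : forall v ts n Q, clean ts ->
  ts (x_ uP) = bits [::] (nseq r true) -> ts (x_ uV) = bits v [::] ->
  size v + r = s -> ~~ odd s -> acceptable v r ->
  r * (ask_time s + 5) + 1 <= n ->
  (forall u, size u = r -> acceptable (v ++ u) 0 ->
    Q (upd (upd ts (x_ uV) (bits (v ++ u) [::])) (x_ uP) (bits [::] [::]))) ->
  ex search ts n Q.
Proof.
elim: r => [|r IH] v ts n Q cl EP EV Es ev acc le_n HQ.
  apply: ex_while_end; [by lia|by rewrite /rd EP|].
  have := HQ [::] erefl; rewrite cats0 => /(_ acc).
  by rewrite -EV upd_id -EP upd_id.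
apply: (ex_while_next (ask_time s + 4) (r * (ask_time s + 5) + 1)).
- by move: le_n; rewrite mulSn; lia.
- by rewrite /rd EP.
apply: (ex_seq 1 (ask_time s + 3)); first by lia.
apply: ex_prim => //; rewrite EP erase_bits.
apply: (ex_seq 1 (ask_time s + 2)); first by lia.
apply: ex_prim => //; rewrite upd_neq // EV write_bits right_bits.
set ts1 := upd _ _ _.
have Es1 a : size (rcons v a) + r = s by rewrite size_rcons -Es addSnnS.
have next a : acceptable (rcons v a) r ->
    ex search (upd ts1 (x_ uV) (bits (rcons v a) [::])) (r * (ask_time s + 5) + 1) Q.
  move=> acc'; apply: (IH (rcons v a)) => //.
  move=> u su; rewrite cat_rcons => acc2; have := HQ (a :: u) _ acc2.
  rewrite /= su => /(_ erefl) H; congr (Q _): H.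
  apply/funext => i; rewrite /ts1 /upd.
  by case: (i == x_ uP); case: (i == x_ uV).
apply: (@ex_ask_acceptable skip _ (rcons v true) r ts1 2 (ask_time s + 2)) => //.
- by rewrite Es1.
- move=> acc'; apply: ex_skip => //; have := next _ acc'.
  by rewrite upd_idE // /ts1 upd_eq.
- move=> nacc; apply: (ex_seq 1 1) => //; apply: ex_go => //.
  rewrite /ts1 upd_eq left_bits upd_upd; apply: ex_prim => //.
  rewrite upd_eq write_bits right_bits upd_upd.
  have := next false; rewrite /ts1 upd_upd; apply.
  move: acc => [] [//|a u] /= [su] [cs Eu h].
  case: a Eu => Eu.
    by case: nacc; exists u => //; exists cs; rewrite ?cat_rcons.
  by exists u => //; exists cs; rewrite ?cat_rcons.
- by rewrite Es1.
Qed.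

Definition counters (c : bool) : seq T := [seq inr (inr (j, c)) | j <- enum 'I_d].

Lemma counters_uniq c : uniq (counters c).
Proof.
by rewrite map_inj_uniq ?enum_uniq // => i j [].
Qed.

Lemma size_counters c : size (counters c) = d.
Proof. by rewrite size_map size_enum_ord. Qed.

Lemma counters_neq c i k : i \in counters c -> x_ k != i.
Proof. by move=> /mapP [j _ ->]. Qed.

(** Two marks per iteration, because each of the appended columns has two unknown bits. *)
Definition fill : frag :=
  fseq (nest (counters false)
         (fseq (put (x_ uP) true MoveRight) (put (x_ uP) true MoveRight)))
       (rew (x_ uP)).

Lemma ex_fill m ts n Q : ts (x_ uP) = bits [::] [::] ->
  {in counters false, forall i, ts i = bits [::] (nseq m true)} ->
  nest_time d m 2 + (4 * m ^ d + 5) <= n ->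
  Q (upd ts (x_ uP) (bits [::] (nseq (m ^ d).*2 true))) -> ex fill ts n Q.
Proof.
move=> EP EC le_n HQ.
apply: (ex_seq (nest_time d m 2) (4 * m ^ d + 5)) => //.
pose I j ts' := ts' (x_ uP) = bits (nseq j.*2 true) [::] /\
  forall i, i \notin counters false -> i != x_ uP -> ts' i = ts i.
have := @ex_nest _ _ _ ot D QH true (counters false) m 2
  (fseq (put (x_ uP) true MoveRight) (put (x_ uP) true MoveRight)) I.
rewrite size_counters => H.
apply: ex_imp (H _ _ (counters_uniq _) _ _ EC) => [ts' [[E1 E2] E3]| | |].
- apply: (@ex_rew _ _ _ _ _ _ _ _ _ (nseq (m ^ d).*2 true) [::]) => //.
    by rewrite size_nseq; lia.
  rewrite cats0; congr (Q _): HQ; apply/funext => i; rewrite /upd.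
  case: eqP => // /eqP ne; have [ic|ic] := boolP (i \in counters false).
    by rewrite E3.
  by rewrite E2.
- move=> j ts' i t ic [h1 h2]; split; first by rewrite upd_neq ?(counters_neq _ ic).
  move=> i' ic' ne; rewrite upd_neq ?h2 //.
  by apply: contraNneq ic' => ->.
- move=> j ts' _ [h1 h2]; apply: (ex_seq 1 1) => //; apply: ex_prim => //.
  rewrite h1 write_bits right_bits rcons_nseq; apply: ex_prim => //.
  rewrite upd_eq upd_upd write_bits right_bits rcons_nseq -doubleS.
  split; last by move=> i ic; rewrite upd_neq // eq_sym (counters_neq _ ic).
  split; first by rewrite upd_eq.
  by move=> i ic ne; rewrite upd_neq // h2.
- by split.
Qed.

(** The question before the search separates the two cases: without an extension the machine
    rejects, and with one the precondition of [search] holds. *)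
Definition round : frag :=
  fseq truthify (fseq fill (fseq (ask skip (fhalt G T false)) search)).

(** Both the number of columns appended in a round and the number of rounds, each produced by [d]
    nested loops; hence the square in [columns_bound], next to the initial item of [n.+1]
    columns. *)
Definition pads (n : nat) := (n + 2) ^ d.

Definition columns_bound (n : nat) := n.+1 + pads n * pads n.

Definition round_time (n : nat) : nat :=
  truth_time (columns_bound n) + (nest_time d (n + 2) 2 + (4 * pads n + 5) +
    (ask_time (columns_bound n).*2 + 2
     + ((pads n).*2 * (ask_time (columns_bound n).*2 + 5) + 1))).

Definition reducer_time (n : nat) : nat :=
  10 * n + 20 + nest_time d (n + 2) (round_time n).

Variables (x : word).
Let m := size x + 2.
Let U := pads (size x).
Let total_columns := columns_bound (size x).

Definition roundinv (j : nat) ts : Prop :=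
  [/\ clean ts, ts (x_ uO) = bits [::] [::], ts (x_ uP) = bits [::] [::],
      {in counters false, forall i, ts i = bits [::] (nseq m true)}
    & exists2 cs, rounds N D x U j cs & ts (x_ uV) = bits (flat cs) [::]].

Definition refuted : Prop := exists j cs, rounds N D x U j cs /\
  ~ exists2 u, size u = U & cert N x (truth D [::] cs ++ u).

Lemma ask_time_le s s' : s <= s' -> ask_time s <= ask_time s'.
Proof.
move=> le_s; rewrite /ask_time; have : b s.*2 <= b s'.*2.
  by apply: b_mono; rewrite leq_double.
by lia.
Qed.

Lemma acceptable_columns j cs (v := flat (truth D [::] cs)) r :
  rounds N D x U j cs ->
  acceptable v r.*2 <-> exists2 u, size u = r & cert N x (truth D [::] cs ++ u).
Proof.
move=> rd; have lead u := leading_truth D u (rounds_item rd).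
split=> [[u su [cs' /flat_split [u' -> Eu'] h]]|[u su h]].
  exists u'; last by rewrite lead in h.
  by apply: double_inj; rewrite -size_flat Eu'.
exists (flat u); first by rewrite size_flat su.
by exists (truth D [::] cs ++ u); rewrite ?flat_cat ?lead.
Qed.

Hypothesis QH_refuted : refuted -> QH false.

Lemma ex_round j ts : j < U -> roundinv j ts ->
  ex round ts (round_time (size x))
    (fun ts' => roundinv j.+1 ts' /\ {in counters true, ts' =1 ts}).
Proof.
move=> lt_j [cl EO EP EC [cs rd EV]].
(* As [j < U], the columns of this round still fit into the bound for [U] rounds, so all rounds
   share one time bound. *)
have scs : size cs + U <= total_columns.
  rewrite (rounds_size rd) -addnA leq_add2l -{2}[U]mul1n -mulnDl.
  by rewrite leq_mul2r addn1 lt_j orbT.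
have s2 : size (flat (truth D [::] cs)) + U.*2 = (size cs + U).*2.
  by rewrite size_flat size_truth doubleD.
set A := ask_time (size cs + U).*2.
have le_A : A <= ask_time total_columns.*2 by apply: ask_time_le; rewrite leq_double.
apply: (ex_seq (truth_time total_columns) _ (leqnn _)).
apply: (ex_truthify EV EO).
  have le_cs : size cs <= total_columns by lia.
  rewrite /truth_time; have := leq_mul le_cs le_cs; nia.
set ts1 := upd _ _ _.
apply: (ex_seq (nest_time d m 2 + (4 * U + 5)) _ (leqnn _)).
apply: (@ex_fill m) => //.
  move=> i ic; rewrite /ts1 upd_neq; first exact: EC.
  by rewrite eq_sym (counters_neq _ ic).
set ts2 := upd _ _ _.
have cl2 : clean ts2.
  by case: cl => c1 c2 c3; split=> [i||]; rewrite /ts2 /ts1 !upd_neq.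
have EP2 : ts2 (x_ uP) = bits [::] (nseq U.*2 true) by rewrite /ts2 upd_eq.
have EV2 : ts2 (x_ uV) = bits (flat (truth D [::] cs)) [::].
  by rewrite /ts2 /ts1 upd_neq // upd_eq.
apply: (ex_seq (ask_time total_columns.*2 + 2) _ (leqnn _)).
apply: (@ex_ask_acceptable _ _ (flat (truth D [::] cs)) U.*2 _ 1) => //.
- by rewrite s2 odd_double.
- move=> acc; apply: ex_skip => //.
  apply: (@ex_search (size cs + U).*2 U.*2 (flat (truth D [::] cs))) => //.
  + by rewrite odd_double.
  + by rewrite leq_add2r leq_mul2l leq_add2r le_A orbT.
  move=> u su [[|//] _ [cs' Eu h]].
  set ts3 := upd _ _ _.
  have other i : i != x_ uP -> i != x_ uV -> ts3 i = ts i.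
    by move=> n1 n2; rewrite /ts3 /ts2 /ts1 !upd_neq.
  split; last by move=> i ic; rewrite other // eq_sym (counters_neq _ ic).
  split.
  + by case: cl => c1 c2 c3; split=> [i||]; rewrite other.
  + by rewrite other.
  + by rewrite /ts3 upd_eq.
  + by move=> i ic; rewrite other ?EC // eq_sym (counters_neq _ ic).
  rewrite cats0 in Eu; exists cs'; last by rewrite /ts3 upd_neq // upd_eq Eu.
  have [u' Ecs' Eu'] := flat_split Eu.
  rewrite Ecs'; apply: roundsS => //.
    by apply: double_inj; rewrite -size_flat Eu'.
  by rewrite Ecs' (leading_truth D u' (rounds_item rd)) in h.
- move=> nacc; apply: ex_halt; apply: QH_refuted; exists j, cs; split=> //.
  by move=> h; apply: nacc; apply/(acceptable_columns _ rd).
- by rewrite s2 -/A; lia.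
Qed.

(** Before the first round only the input, the list and the counters are in use, and the counters of
    both nests all carry the same content. *)
Definition upto (i v a : tape G) : tapes := fun j => match j with
  | inl _ => bits [::] [::]
  | inr (inl k) => if k == uIn then i else if k == uV then v else bits [::] [::]
  | inr (inr _) => a
  end.

Definition tact (g : symbol G -> symbol G * dir) (t : tape G) : tape G :=
  nmove (g (read t)).2 (nwrite (g (read t)).1 t).

Definition all_act (ga gi gv : symbol G -> symbol G * dir) : frag :=
  fdo bool (fun r j => match j with
  | inl _ => (r j, Stay)
  | inr (inl k) => if k == uIn then gi (r j) else if k == uV then gv (r j)
                   else (r j, Stay)
  | inr (inr _) => ga (r j)
  end).

Lemma ex_all_act ga gi gv i v a n Q : 0 < n ->
  Q (upto (tact gi i) (tact gv v) (tact ga a)) ->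
  ex (all_act ga gi gv) (upto i v a) n Q.
Proof.
move=> n0 H; apply: ex_do => //; congr (Q _): H.
apply/funext => -[j|[k|p]]; rewrite /app /upto /tact /rd.
- by rewrite nwrite_read.
- by case: eqP => // _; case: eqP => // _; rewrite nwrite_read.
- by [].
Qed.

Definition mk (d' : dir) (_ : symbol G) : symbol G * dir := (bit G true, d').
Definition mv (d' : dir) (a : symbol G) : symbol G * dir := (a, d').

Lemma tact_mv d' t : tact (mv d') t = nmove d' t.
Proof. by rewrite /tact /= nwrite_read. Qed.

Lemma tact_mk d' t : tact (mk d') t =
  nmove d' (Tape (left_part t) (bit G true :: behead (right_part t))).
Proof. by case: t => l r; rewrite /tact /mk nwrite_bit. Qed.

(** The counters receive one mark per letter of the input and two more for the base [size x + 2] of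
    [pads]. Writing the latter on the left leaves the heads on the first mark, as the nests
    require. *)
Definition prologue : frag :=
  fseq (fwhile (fun r => r (x_ uIn) != None)
    (fseq (all_act (mk MoveRight) (mv Stay) (mk MoveRight))
      (fseq (cpy (x_ uIn) (x_ uV) MoveRight) (go (x_ uIn) MoveRight))))
  (fseq (put (x_ uV) false MoveRight) (fseq (put (x_ uV) false MoveRight)
  (fseq (go (x_ uIn) MoveLeft)
  (fseq (fwhile (fun r => r (x_ uIn) != None)
           (all_act (mv MoveLeft) (mv MoveLeft) (mv Stay)))
  (fseq (all_act (mv MoveLeft) (mv Stay) (mv Stay))
  (fseq (all_act (mk MoveLeft) (mv Stay) (mv Stay))
        (all_act (mk Stay) (mv Stay) (mv Stay)))))))).

Lemma upto_In i v a t : upd (upto i v a) (x_ uIn) t = upto t v a.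
Proof.
apply/funext => -[j|[k|p]] //; rewrite /upd /upto.
by case: eqP => [[->]|ne] //; case: eqP => // e; case: ne; rewrite e.
Qed.

Lemma upto_V i v a t : upd (upto i v a) (x_ uV) t = upto i t a.
Proof.
apply/funext => -[j|[k|p]] //; rewrite /upd /upto.
case: eqP => [[->]|ne] //; case: eqP => // _.
by case: eqP => // e; case: ne; rewrite e.
Qed.

Lemma ex_prologue n Q : 10 * size x + 20 <= n ->
  (forall ts, roundinv 0 ts -> 
     {in counters true, forall i, ts i = bits [::] (nseq m true)} -> Q ts) ->
  ex prologue (upto (bits [::] x) (bits [::] [::]) (bits [::] [::])) n Q.
Proof.
move=> le_n HQ; set s := size x in le_n.
pose data (w : word) := flat [seq (true, c) | c <- w].
pose marks k := bits (nseq k true) [::].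
apply: (ex_seq (4 * s + 1) (6 * s + 19)); first by lia.
suff H x2 : forall x1, x1 ++ x2 = x -> ex (fwhile (fun r => r (x_ uIn) != None)
    (fseq (all_act (mk MoveRight) (mv Stay) (mk MoveRight))
      (fseq (cpy (x_ uIn) (x_ uV) MoveRight) (go (x_ uIn) MoveRight))))
    (upto (bits x1 x2) (bits (data x1) [::]) (marks (size x1))) (4 * size x2 + 1)
    (fun ts' => ts' = upto (bits x [::]) (bits (data x) [::]) (marks s)).
  apply: ex_imp (H x [::] erefl) => ts' -> {H ts'}.
  apply: (ex_seq 1 (6 * s + 18)); first by lia.
  apply: ex_prim => //; rewrite upto_V [upto _ _ _ _]/= write_bits right_bits.
  apply: (ex_seq 1 (6 * s + 17)); first by lia.
  apply: ex_prim => //; rewrite upto_V [upto _ _ _ _]/= write_bits right_bits.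
  have -> : rcons (rcons (data x) false) false = flat (item x false).
    by rewrite /item -[X in flat X]cats1 flat_cat -!cats1 -catA.
  set v := bits (flat _) _.
  apply: (ex_seq 1 (6 * s + 16)); first by lia.
  apply: ex_go => //; rewrite upto_In [upto _ _ _ _]/=.
  apply: (ex_seq (2 * s + 1) 3); first by lia.
  suff H x1 : forall x2, x1 ++ x2 = x -> ex (fwhile (fun r => r (x_ uIn) != None)
           (all_act (mv MoveLeft) (mv MoveLeft) (mv Stay)))
      (upto (nmove MoveLeft (bits x1 x2)) v
         (bits (nseq (size x1) true) (nseq (size x2) true))) (2 * size x1 + 1)
      (fun ts' => exists i, ts' = upto i v (bits [::] (nseq s true))).
    apply: ex_imp (H x [::] _) => [ts' [i ->]|]; last by rewrite cats0.
    apply: (ex_seq 1 2) => //; apply: ex_all_act => //.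
    apply: (ex_seq 1 1) => //; apply: ex_all_act => //.
    apply: ex_all_act => //; rewrite !tact_mv ![nmove Stay _]/=.
    set a := tact (mk Stay) _; have Ea : a = bits [::] (nseq m true).
      by rewrite /a !tact_mk /= !behead_bcons /m addn2.
    apply: HQ; last by move=> i' /mapP [k _ ->].
    split=> //; first by move=> i' /mapP [k _ ->].
    by exists (item x false); first exact: rounds0.
  elim/last_ind: x1 => [|x1 c IH] x2 Ex.
    apply: ex_while_end => //; last by exists (nmove MoveLeft (bits [::] x2)); rewrite /s -Ex.
    by rewrite /rd /= /nmove /= /read /= head_bcons.
  rewrite left_bits; apply: (ex_while_next 1 (2 * size x1 + 1)) => //.
    by rewrite size_rcons; lia.
  apply: ex_all_act => //; rewrite !tact_mv [nmove Stay _]/=.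
  rewrite size_rcons -rcons_nseq left_bits.
  by have := IH (c :: x2); rewrite -cat_rcons; apply.
elim: x2 => [|c x2 IH] x1 Ex.
  by apply: ex_while_end => //; rewrite /s -Ex cats0.
apply: (ex_while_next 3 (4 * size x2 + 1)) => //; first by rewrite /=; lia.
apply: (ex_seq 1 2) => //; apply: ex_all_act => //; rewrite !tact_mv [nmove Stay _]/=.
apply: (ex_seq 1 1) => //; apply: ex_prim => //; rewrite upto_V.
apply: ex_go => //; rewrite upto_In.
have := IH (rcons x1 c); rewrite cat_rcons => /(_ Ex).
congr (ex _ _ _ _); congr upto.
- by rewrite -right_bits.
- rewrite -[rd _ _]/(bit G c) [upto _ _ _ _]/= /tact [_.1]/= [_.2]/= !(write_bits, right_bits).
  by rewrite /data map_rcons -cats1 flat_cat /= -!cats1 -catA.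
- by rewrite /tact [_.1]/= [_.2]/= write_bits right_bits size_rcons rcons_nseq.
Qed.

Definition main : frag :=
  fseq prologue (fseq (nest (counters true) round) (fhalt G T true)).

Lemma main_det : fdet main.
Proof.
rewrite /main /prologue /all_act; det_tac.
apply: nest_det; rewrite /round /truthify /truthstep /fill /search /ask /skip; det_tac.
- by apply: nest_det; det_tac.
- by apply: askK_det; det_tac.
- by apply: askK_det; det_tac.
Qed.

Lemma uIn_uO : x_ uIn != ot. Proof. by []. Qed.

Definition reducer : otm bool := machine uIn_uO false main.

(** No productivity of [N] is assumed: under any oracle the machine either meets a list without a
    certified extension or completes [U] rounds. What this says about [N] is settled afterwards. *)
Lemma win_main : (forall cs, rounds N D x U U cs -> QH true) ->
  fwin ot D QH (f := main) true (reducer_time (size x))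
    (Some (fstart main), ntapes (init reducer x)) (@none G T).
Proof.
move=> QH_done.
have -> : ntapes (init reducer x) = upto (bits [::] x) (bits [::] [::]) (bits [::] [::]).
  apply/funext => -[j|[k|p]]; rewrite /ntapes /= ffunE //.
  case: eqP => [[->]|ne]; first by rewrite eqxx /ntape /= norm_bits.
  by case: (k =P uIn) => [e|_]; [case: ne; rewrite e|case: eqP].
apply: (ex_seq (10 * size x + 20) _ (leqnn _)).
apply: ex_prologue => // ts inv0 E.
apply: (ex_seq (nest_time d m (round_time (size x))) 0); first by rewrite addn0.
have := @ex_nest _ _ _ ot D QH true (counters true) m (round_time (size x)) round roundinv.
rewrite size_counters => H.
apply: ex_imp (H _ _ (counters_uniq _) _ inv0 E) => [ts' [[_ _ _ _ [cs rd _]] _]| |].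
- by apply: ex_halt; apply: QH_done rd.
- move=> j ts' i t ic [[c1 c2 c3] EO EP EC EV].
  have ne k := counters_neq k ic.
  split; rewrite ?upd_neq //.
    by split=> [i'||]; rewrite upd_neq //; case/mapP: ic => k _ ->.
  move=> i' ic'; rewrite upd_neq ?EC //; case/mapP: ic => k _ ->.
  by case/mapP: ic' => k' _ ->; apply/eqP => -[].
- by move=> j ts' lt_j inv; apply: ex_round.
Qed.

End OracleMachine.

(** * Collapse of the reducibilities *)

Lemma polyb_look_time f g : polyb f -> polyb g ->
  polyb (fun n => look_time (f n) (g n)).
Proof.
move=> hf hg; rewrite /look_time.
by repeat first [exact: hf | exact: hg | apply: polyb_const | apply: polyb_add
  | apply: polyb_mul].
Qed.

Lemma polyb_verify_time b : polyb b -> polyb (verify_time b).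
Proof.
move=> hb; rewrite /verify_time.
have hS : polyb (fun n => (b n).+1).
  by apply: polyb_le (polyb_add hb (polyb_const 1)) => n; rewrite addn1.
apply: polyb_add.
  by apply: polyb_add (polyb_const 1); exact: polyb_mul (polyb_const 10) polyb_id.
apply: polyb_add.
  by apply: polyb_add (polyb_const 50); exact: polyb_mul (polyb_const 20) polyb_id.
apply: polyb_mul hS _; apply: polyb_add (polyb_const 3).
exact: polyb_look_time polyb_id (polyb_double hb).
Qed.

Lemma polyb_reducer_time b d : polyb b -> polyb (reducer_time b d).
Proof.
move=> hb.
have hm : polyb (fun n => n + 2) by apply: polyb_add polyb_id (polyb_const 2).
have hp : polyb (pads d) by apply: polyb_exp.
have hS : polyb S by apply: polyb_le (polyb_add polyb_id (polyb_const 1)) => n; rewrite addn1.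
have hc : polyb (columns_bound d) by apply: polyb_add hS (polyb_mul hp hp).
have ha : polyb (ask_time b).
  apply: polyb_add (polyb_const 60); apply: polyb_add.
    exact: polyb_mul (polyb_const 40) polyb_id.
  by apply: polyb_mul (polyb_const 7) _; exact: polyb_comp hb (polyb_double polyb_id).
have ht : polyb truth_time.
  by rewrite /truth_time; repeat first [exact: polyb_id | apply: polyb_const
    | apply: polyb_add | apply: polyb_mul].
have hac := polyb_comp ha (polyb_double hc).
have hr : polyb (round_time b d).
  rewrite /round_time; apply: polyb_add; first exact: polyb_comp ht hc.
  apply: polyb_add.
    apply: polyb_add; first exact: polyb_nest_time hm (polyb_const 2).
    exact: polyb_add (polyb_mul (polyb_const 4) hp) (polyb_const 5).
  apply: polyb_add; first exact: polyb_add hac (polyb_const 2).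
  apply: polyb_add (polyb_const 1); apply: polyb_mul (polyb_double hp) _.
  exact: polyb_add hac (polyb_const 5).
rewrite /reducer_time; apply: polyb_add; last exact: polyb_nest_time.
by apply: polyb_add (polyb_const 20); apply: polyb_mul (polyb_const 10) polyb_id.
Qed.

Lemma polyb_monotone f : polyb f ->
  exists2 g, (forall n, f n <= g n) & polyb g /\ {homo g : m n / m <= n}.
Proof.
move=> [k Hk]; exists (fun n => (n + 2) ^ k) => //; split; first by exists k.
by move=> m n le_mn; case: (k) => // k'; rewrite leq_exp2r // leq_add2r.
Qed.

Lemma poly_time_monotone O (M : otm O) : poly_time M ->
  exists b, [/\ polyb b, {homo b : m n / m <= n}
    & forall D x n c, run D n (init M x) c -> n <= b (size x)].
Proof.
move=> [p Hp]; have [b le_b [pb mb]] := polyb_monotone (polyb_horner p).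
by exists b; split=> // D x n c /Hp /leq_trans; apply.
Qed.

(** * Deterministic reductions as robustly underproductive ones *)

Section Relabel.
Variable M : otm bool.

Definition relabel_instr (i : instr bool (state M) (aux M) (tape_index M)) :
    instr outcome (state M) (aux M) (tape_index M) :=
  match i with
  | Halt o => Halt _ _ _ (if o then acc else rej)
  | Query y n => Query _ _ _ y n
  | Step d => Step _ d
  end.

Lemma relabel_total q : instr_total (relabel_instr (code q)).
Proof. by have := code_total q; case: (code q). Qed.

Definition relabel : otm outcome :=
  OTM (start M) (input_neq_oracle M) relabel_total.

Lemma relabel_run D n (c c' : config relabel) : run D n c c' <->
  run (M := M) D n (Config (cstate c : state M) (ctapes c))
    (Config (cstate c' : state M) (ctapes c')).
Proof.
elim: n c => [|n IH] c.
  split=> [-> //|[]]; case: c => q t; case: c' => q' t' /=.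
  by move=> -> ->.
split=> [[c1 s /IH r]|[[q t] s r]].
  exists (Config (cstate c1 : state M) (ctapes c1)) => //.
  move: s; rewrite /step /=; case: (code _) => //= [y m|dl].
    by case=> -[h ->]; [left|right].
  by case=> a ha ->; exists a.
exists (Config (M := relabel) q t); last exact/IH.
move: s; rewrite /step /=; case: (code _) => //= [y m|dl].
  by case=> -[h [-> ->]]; [left|right].
by case=> a ha [-> ->]; exists a.
Qed.

Lemma relabel_outcomes D x o : outcomes relabel D x o <->
  exists2 a, outcomes M D x a & o = if a then acc else rej.
Proof.
split=> [[n [c [/relabel_run r h]]]|[a [n [c [r h]]] ->]].
  move: h; rewrite /=; case E: (code _) => [a||] //= -[<-].
  by exists a => //; exists n, (Config (cstate c : state M) (ctapes c)).
exists n, (Config (M := relabel) (cstate c) (ctapes c)); split.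
  by apply/relabel_run; case: c r {h}.
by rewrite /= h.
Qed.

Lemma relabel_time : poly_time M -> poly_time relabel.
Proof. by move=> [p Hp]; exists p => D x n c /relabel_run; apply: Hp. Qed.

End Relabel.

(** A deterministic machine has at most one outcome per oracle and input, and relabelling turns it
    into [acc] or [rej]: the two never occur together, and [unknown] does not occur. *)
Lemma le_T_p_U : (le_T_p `<=` le_T_U)%classic.
Proof.
move=> [A B] [M [Md Mt EA]]; exists (relabel M); split.
- exact: relabel_time.
- move=> D x H.
  have /relabel_outcomes [a [n [c [r h]]] ea] := H acc (or_introl erefl).
  have /relabel_outcomes [a' [n' [c' [r' h']]] ea'] := H rej (or_intror erefl).
  have e := run_halt_unique Md r h r' h'.
  by move: ea ea'; rewrite e; case: (a').
- move=> x H.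
  have /relabel_outcomes [a _] : outcomes (relabel M) B x unknown by rewrite H.
  by case: a.
- rewrite EA; apply/seteqP; split=> x.
    by move=> h; apply/relabel_outcomes; exists true.
  by move=> /relabel_outcomes [[] h].
Qed.

(** * The collapse under P = NP *)

Section Collapse.
Hypothesis P_NP : class_P = class_NP.

(** Here P = NP enters, for a single language that depends on [N] only; neither the oracle nor the
    input of the reduction is fixed yet. *)
Lemma deterministic_verifier (N : otm outcome) : poly_time N ->
  exists K : otm bool, [/\ deterministic K, oracle_free K, poly_time K
    & forall w, accepted K set0 w <->
        exists2 cs, compl w cs & cert N (leading cs) cs].
Proof.
move=> /poly_time_monotone [b [pb mb Hb]].
have [K [Kd Kf Kt EK]] : class_P (accepted (verifier N) set0).
  rewrite P_NP; exists (verifier N); split=> //; first exact: verifier_free.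
  have [p Hp] := polyb_poly (polyb_verify_time pb).
  by exists p => D w n c r; apply: leq_trans (verifier_time Hb mb r) (Hp _).
by exists K; split=> // w; rewrite -EK; exact: (accepted_verifier Hb mb).
Qed.

(** By totality of the code every path can be prolonged until it halts. This is needed because
    overproductivity only says that the set of outcomes differs from [[set unknown]], which the
    empty set would also satisfy. *)
Lemma halting_outcome O (M : otm O) D x : poly_time M ->
  exists o, outcomes M D x o.
Proof.
move=> [p Hp].
suff H k : forall n c, run D n (init M x) c -> n + k = (p.[size x]%R).+1 ->
    exists o, outcomes M D x o by apply: (H _ 0 (init M x) erefl); rewrite add0n.
elim: k => [|k IH] n c r E; first by have := Hp _ _ _ _ r; lia.
case Ec: (code (cstate c)) => [o|y m|dl].
- by exists o, n, c.
- have [h|h] := EM (D (query_word (ctapes c (oracle_tape M)))).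
    apply: (IH n.+1 (Config y (ctapes c))); last by lia.
    by apply: run_rcons r _; rewrite /step Ec; left.
  apply: (IH n.+1 (Config m (ctapes c))); last by lia.
  by apply: run_rcons r _; rewrite /step Ec; right.
- have /card_gt0P [a ha] : 0 < #|dl (scanned c)|.
    by have := code_total (cstate c); rewrite Ec; apply.
  apply: (IH n.+1 (act c a)); last by lia.
  by apply: run_rcons r _; rewrite /step Ec; exists a.
Qed.

Lemma le_T_U_p : (le_T_U `<=` le_T_p)%classic.
Proof.
move=> [A B] [N [Nt Nrob Nover EA]].
have [K [Kd Kf Kt HK]] := deterministic_verifier Nt.
have [b [pb _ Hb]] := poly_time_monotone Nt.
have [bK [pbK mbK HbK]] := poly_time_monotone Kt.
(* One exponent for both purposes: the power exceeds the room that [cert_complete] asks for on paths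
   of length at most [b n], and it exceeds [b n] itself, as [rounds_le] requires. *)
have [d Hd] : polyb (fun n => 2 + b n * ((b n).*2 + 1)).
  apply: polyb_add (polyb_const 2) _; apply: (polyb_mul pb).
  exact: polyb_add (polyb_double pb) (polyb_const 1).
have KT w n c : run set0 n (init K w) c -> n <= bK (size w) by apply: HbK.
pose U (x : word) := pads d (size x).
pose QH (D : language) (x : word) (o : bool) : Prop := if o then exists cs, rounds N D x (U x) (U x) cs
  else refuted N d D x.
(* Stated for every oracle, since [poly_time] quantifies over all of them. *)
have win D x : fwin (inr (inl uO)) D (QH D x) (f := main K d) true
    (reducer_time bK d (size x)) (Some (fstart (main K d)), ntapes (init (reducer K d) x))
    (@none _ _).
  apply: (@win_main N K bK d) => //.
  by move=> cs rd; exists cs.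
have Rdet : deterministic (reducer K d) by apply: machine_det; exact: main_det.
exists (reducer K d); split=> //.
  have [p Hp] := polyb_poly (polyb_reducer_time d pbK).
  by exists p => D x n c r; apply: leq_trans (run_bound r (win D x)) (Hp _).
rewrite EA; apply/seteqP; split=> x; last first.
  move=> [n [c [r h]]]; have /= [cs rd] := run_halt r (win B x) h.
  apply: contrapT => nacc; apply: (Nover x).
  (* A rejecting path is shorter than [U], but each of the [U] completed rounds has revealed another
     of its queries. *)
  have norej : ~ outcomes N B x rej.
    move=> [n' [c' [r' h']]]; have le_U := rounds_le Nrob r' h' rd.
    have le_n := Hb _ _ _ _ r'.
    by have := Hd (size x); rewrite -/(pads d (size x)) -/(U x); nia.
  have [o ho] := halting_outcome B x Nt.
  by apply/seteqP; split=> [[]|_ ->] //; case: o ho.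
move=> [n [c [r h]]].
(* The reduction halts; were its verdict negative, the accepting path of [N] under [B] would supply
   the extension claimed not to exist. *)
have [n' [c' [o [r' h' q]]]] := fwin_halts (c := init (reducer K d) x) (win B x).
case: o q h' => [_ h'|[j [cs [rd no]]] _]; first by exists n', c'.
case: no; apply: (cert_complete cs r h).
have le_n := Hb _ _ _ _ r; have := Hd (size x); rewrite -/(pads d _).
by rewrite /pads; have := leq_mul le_n le_n; nia.
Qed.

End Collapse.

Theorem theorem4p10 : le_T_U <> le_T_p -> class_P <> class_NP.
Proof.
move=> ne P_NP; apply: ne; apply/seteqP; split; last exact: le_T_p_U.
exact: le_T_U_p.
Qed.
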